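(* Let $L \subset \mathbb{R}^n$ be a unimodular integral lattice with no characteristic vector $w$ such that $|w|^2 < n$. Then $L \cong \mathbb{Z}^n$.
   Context: $\mathbb{R}^n$ carries its standard Euclidean inner product $(\cdot,\cdot)$. The norm of a vector $v$ means $|v|^2 = (v,v)$. A unimodular integral lattice in $\mathbb{R}^n$ is a lattice $L \subset \mathbb{R}^n$ (the $\mathbb{Z}$-span of a basis of $\mathbb{R}^n$) of discriminant $1$ such that $(v,v') \in \mathbb{Z}$ for all $v,v' \in L$. A characteristic vector of $L$ is a vector $w \in L$ such that $|v|^2 \equiv (v,w) \bmod 2$ for all $v \in L$. The notation $L \cong \mathbb{Z}^n$ means isomorphism of lattices, i.e. there is a linear isometry of $\mathbb{R}^n$ carrying $L$ onto the standard lattice $\mathbb{Z}^n$. *)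

(* Defs.v *)
From mathcomp Require Import all_boot all_order all_algebra.
From mathcomp Require Import classical_sets reals.

Set Implicit Arguments.
Unset Strict Implicit.
Unset Printing Implicit Defensive.

Import Order.TTheory GRing.Theory Num.Theory.

Local Open Scope classical_set_scope.
Local Open Scope ring_scope.

Section Lattices.
Variables (R : realType) (n : nat).

Definition dotv (u v : 'rV[R]_n) : R := \sum_(i < n) u 0 i * v 0 i.

(* "Norm" in the lattice sense: the squared Euclidean length. *)
Definition normv (v : 'rV[R]_n) : R := dotv v v.

Definition zspan (B : 'M[R]_n) : set 'rV[R]_n :=
  [set v | exists c : 'rV[int]_n, v = \sum_(i < n) (c 0 i)%:~R *: row i B].

(* The n rows of B form a basis of R^n and L is their Z-span. *)
Definition lattice_basis (L : set 'rV[R]_n) (B : 'M[R]_n) : Prop :=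
  B \in unitmx /\ L = zspan B.

Definition is_lattice (L : set 'rV[R]_n) : Prop :=
  exists B : 'M[R]_n, lattice_basis L B.

Definition gram (B : 'M[R]_n) : 'M[R]_n :=
  \matrix_(i, j) dotv (row i B) (row j B).

(* The determinant of the Gram matrix does not depend on the chosen basis. *)
Definition has_discriminant (L : set 'rV[R]_n) (d : R) : Prop :=
  exists2 B : 'M[R]_n, lattice_basis L B & \det (gram B) = d.

Definition unimodular_integral_lattice (L : set 'rV[R]_n) : Prop :=
  [/\ is_lattice L,
      has_discriminant L 1
    & forall v v', L v -> L v' -> dotv v v' \is a Num.int].

Definition characteristic_vector (L : set 'rV[R]_n) (w : 'rV[R]_n) : Prop :=
  L w /\ forall v, L v -> exists k : int, normv v - dotv v w = 2 * k%:~R.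

Definition Zn_lattice : set 'rV[R]_n :=
  [set v | forall i, v 0 i \is a Num.int].

Definition lattice_isomorphic (L M : set 'rV[R]_n) : Prop :=
  exists f : {linear 'rV[R]_n -> 'rV[R]_n},
    (forall u v, dotv (f u) (f v) = dotv u v) /\ f @` L = M.

End Lattices.

Arguments Zn_lattice : clear implicits.

(* Main.v *)
Require Import Defs.
From mathcomp Require Import all_boot all_order all_algebra.
From mathcomp Require Import boolp classical_sets reals topology normedtype derive sequences exp trigo.
From mathcomp Require Import complex ring lra zify.

Set Implicit Arguments.
Unset Strict Implicit.
Unset Printing Implicit Defensive.

Import Order.TTheory GRing.Theory Num.Theory.
Import numFieldNormedType.Exports.

Local Open Scope ring_scope.
Local Open Scope complex_scope.

(** Elkies' argument. Let G be a Gram matrix of L, w a characteristic vector, and let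
th_L, th'_L (here [thetaA], [thetaC]) be the theta series of L and of its translate
L + w/2. By Poisson summation, tau -> -1/tau and tau -> tau + 1 permute th_L(tau),
th_L(tau + 1) and th'_L(tau), up to phases, as they permute the n-th powers of the Jacobi
theta functions th3(tau), th3(tau + 1) and th2(tau) of Z. So the quotients |th_L| / |th3|^n
and |th'_L| / |th2|^n are permuted as well, and bounding them for Im tau >= 3/4 bounds them
everywhere; the absence of short characteristic vectors makes the second quotient bounded
at the cusp. The maximum principle for power series in q = exp(i pi tau) shows that a
common bound M > 1 can always be decreased, hence |th_L| <= |th3|^n. The quotient
th_L / th3^n = 1 + (r - 2n) q + ..., where r is the number of norm 1 vectors, is then
bounded by its constant term, so r = 2n. Distinct non-opposite norm 1 vectors are
orthogonal, and n of them form an orthonormal basis of L. *)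

(** No function of tau is differentiated or integrated: the analysis consists of inequalities for
    absolutely convergent sums, and a contour integral becomes a mean over N equally spaced points
    with N going to infinity. The heights are chosen to fit together. The reciprocals of the
    normalized Jacobi functions are power series converging for Im tau >= 1/2 because 3 exp(- pi /
    2) < 1, where 3 is the growth rate of the reciprocal of a series whose later coefficients are at
    most 2. The height 3/4 lies below the corners of the fundamental domain, at sqrt(3) / 2, so the
    descent into Im tau >= 3/4 gains a fixed factor at each step. Passing from 1/2 to 3/4 lowers a
    bound M > 1 because exp(- pi / 4) < 1/2 and the constant term 1 of th_L / th3^n is less than M.
    In place of a point where the quotients are maximal, the infimum of all common bounds is
    used. *)

Notation cn := (@Normc.normc _).
Notation Re := (@complex.Re _).
Notation Im := (@complex.Im _).

(** * Real-valued modulus, real and imaginary parts *)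

Section ComplexNorm.
Variable R : realType.
Local Notation C := R[i].
Implicit Types (z w : C) (x : R).

Lemma cn0 : cn (0 : C) = 0. Proof. exact: Normc.normc0. Qed.
Lemma cn1 : cn (1 : C) = 1. Proof. exact: Normc.normc1. Qed.
Lemma cnM z w : cn (z * w) = cn z * cn w. Proof. exact: Normc.normcM. Qed.
Lemma cnV z : cn z^-1 = (cn z)^-1. Proof. exact: Normc.normcV. Qed.
Lemma cnN z : cn (- z) = cn z. Proof. exact: normcN. Qed.
Lemma cnD z w : cn (z + w) <= cn z + cn w. Proof. exact: le_normcD. Qed.
Lemma cnB z w : cn (z - w) <= cn z + cn w.
Proof. by rewrite -(cnN w); exact: cnD. Qed.
Lemma cn_ge0 z : 0 <= cn z. Proof. by case: z => a b; exact: sqrtr_ge0. Qed.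
Lemma cn_eq0 z : (cn z == 0) = (z == 0).
Proof.
by apply/eqP/eqP => [/Normc.eq0_normc|->]; last exact: cn0.
Qed.
Lemma cn_gt0 z : (0 < cn z) = (z != 0).
Proof. by rewrite lt_def cn_ge0 andbT cn_eq0. Qed.
Lemma cn_real x : cn (x%:C) = `|x|.
Proof. by rewrite /= expr0n addr0 sqrtr_sqr. Qed.
Lemma cnX z k : cn (z ^+ k) = cn z ^+ k.
Proof. by elim: k => [|k IH]; rewrite ?cn1 // !exprS cnM IH. Qed.
Lemma cn_natr k : cn (k%:R : C) = k%:R.
Proof. by rewrite -(rmorph_nat (real_complex R)) cn_real ger0_norm. Qed.
Lemma cnDB z w : cn z - cn w <= cn (z + w).
Proof. by rewrite lerBlDr -[X in cn X <= _](addrK w); exact: cnB. Qed.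
Lemma cn_distC z w : cn (z - w) = cn (w - z).
Proof. by rewrite -cnN opprB. Qed.

Lemma cn_sum (I : Type) (r : seq I) (P : pred I) (F : I -> C) :
  cn (\sum_(i <- r | P i) F i) <= \sum_(i <- r | P i) cn (F i).
Proof.
elim/big_ind2: _ => //; first by rewrite cn0.
by move=> x a y b h1 h2; apply: le_trans (cnD _ _) _; exact: lerD.
Qed.

Lemma cn_small_eq0 z : (forall e : R, 0 < e -> cn z < e) -> z = 0.
Proof.
move=> h; apply/eqP; rewrite -cn_eq0; apply/negPn/negP => nz.
have := h (cn z); rewrite lt_def nz cn_ge0 => /(_ isT).
by rewrite ltxx.
Qed.

Lemma Re_le_cn z : `|Re z| <= cn z.
Proof.
case: z => a b /=; rewrite -[X in X <= _]sqrtr_sqr ler_sqrt ?addr_ge0 ?sqr_ge0 //.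
by rewrite lerDl sqr_ge0.
Qed.

Lemma Im_le_cn z : `|Im z| <= cn z.
Proof.
case: z => a b /=; rewrite -[X in X <= _]sqrtr_sqr ler_sqrt ?addr_ge0 ?sqr_ge0 //.
by rewrite lerDr sqr_ge0.
Qed.

Lemma rcD x y : (x + y)%:C = x%:C + y%:C :> C. Proof. exact: rmorphD. Qed.
Lemma rcB x y : (x - y)%:C = x%:C - y%:C :> C. Proof. exact: rmorphB. Qed.
Lemma rcN x : (- x)%:C = - x%:C :> C. Proof. exact: rmorphN. Qed.
Lemma rcM x y : (x * y)%:C = x%:C * y%:C :> C. Proof. exact: rmorphM. Qed.
Lemma rcX x k : (x ^+ k)%:C = x%:C ^+ k :> C. Proof. exact: rmorphXn. Qed.
Lemma rcV x : (x^-1)%:C = x%:C^-1 :> C. Proof. exact: fmorphV. Qed.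
Lemma rc_nat k : (k%:R)%:C = k%:R :> C. Proof. exact: rmorph_nat. Qed.
Lemma rc_int (k : int) : (k%:~R)%:C = k%:~R :> C. Proof. exact: rmorph_int. Qed.

Lemma ReD z w : Re (z + w) = Re z + Re w. Proof. by case: z; case: w. Qed.
Lemma ImD z w : Im (z + w) = Im z + Im w. Proof. by case: z; case: w. Qed.
Lemma ReM z w : Re (z * w) = Re z * Re w - Im z * Im w.
Proof. by case: z; case: w. Qed.
Lemma ImM z w : Im (z * w) = Re z * Im w + Im z * Re w.
Proof. by case: z => a b; case: w => c d. Qed.
Lemma ReN z : Re (- z) = - Re z. Proof. by case: z. Qed.
Lemma ImN z : Im (- z) = - Im z. Proof. by case: z. Qed.
Lemma sqr_cn z : cn z ^+ 2 = Re z ^+ 2 + Im z ^+ 2.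
Proof. by case: z => a b /=; rewrite sqr_sqrtr ?addr_ge0 ?sqr_ge0. Qed.

End ComplexNorm.

(** * Unordered sums of complex numbers *)

Section Sums.
Variable R : realType.
Local Notation C := R[i].

(** Convergence along the net of finite subsets, given as duplicate-free lists. No enumeration is
    involved, so series over Z, Z^n, pairs and fibres are treated alike; by [summable_has_sum] and
    [has_sum_summable] it is the same as absolute convergence. *)
Definition has_sum (T : eqType) (f : T -> C) (s : C) :=
  forall e : R, 0 < e -> exists X : seq T, forall Y : seq T, uniq Y ->
    {subset X <= Y} -> cn (\sum_(t <- Y) f t - s) < e.

Definition sum_bounded (T : eqType) (f : T -> C) (B : R) :=
  forall X : seq T, uniq X -> \sum_(t <- X) cn (f t) <= B.

Definition summable (T : eqType) (f : T -> C) := exists B, sum_bounded f B.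

(** The value is 0 when there is no sum; [csumE] recovers it from any proof of convergence. *)
Definition csum (T : eqType) (f : T -> C) : C := xget 0 [set s | has_sum f s].

Lemma ler_sum_subset (T : eqType) (F : T -> R) (X Y : seq T) :
  uniq X -> uniq Y -> {subset X <= Y} -> (forall t, 0 <= F t) ->
  \sum_(t <- X) F t <= \sum_(t <- Y) F t.
Proof.
move=> uX uY sXY F0.
have /(perm_big _) -> : perm_eq Y (X ++ [seq t <- Y | t \notin X]).
  apply: uniq_perm => //.
    rewrite cat_uniq uX filter_uniq // andbT /=; apply/hasPn => t.
    by rewrite mem_filter => /andP[].
  move=> t; rewrite mem_cat mem_filter; case: (boolP (t \in X)) => //=.
  by move/sXY.
by rewrite big_cat /= lerDl sumr_ge0.
Qed.

Lemma has_sum_unique (T : eqType) (f : T -> C) s s' :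
  has_sum f s -> has_sum f s' -> s = s'.
Proof.
move=> h h'; apply/eqP; rewrite -subr_eq0; apply/eqP/cn_small_eq0 => e e0.
have e2 : 0 < e / 2 by rewrite divr_gt0.
have [X hX] := h _ e2; have [X' hX'] := h' _ e2.
have := hX (undup (X ++ X')) (undup_uniq _).
have := hX' (undup (X ++ X')) (undup_uniq _).
set S := \sum_(t <- _) _ => h1 h2.
have -> : s - s' = (S - s') - (S - s) by ring.
apply: le_lt_trans (cnB _ _) _; rewrite [e]splitr; apply: ltrD.
  by apply: h1 => t; rewrite mem_undup mem_cat orbC => ->.
by apply: h2 => t; rewrite mem_undup mem_cat => ->.
Qed.

Lemma csumE (T : eqType) (f : T -> C) s : has_sum f s -> csum f = s.
Proof.
by move=> h; apply: (@has_sum_unique _ f) => //; apply: xgetPex; exists s.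
Qed.

Lemma has_sum_ext (T : eqType) (f g : T -> C) s :
  f =1 g -> has_sum f s -> has_sum g s.
Proof. by move=> /funext ->. Qed.

Lemma has_sumD (T : eqType) (f g : T -> C) s s' :
  has_sum f s -> has_sum g s' -> has_sum (fun t => f t + g t) (s + s').
Proof.
move=> h h' e e0.
have e2 : 0 < e / 2 by rewrite divr_gt0.
have [X hX] := h _ e2; have [X' hX'] := h' _ e2.
exists (X ++ X') => Y uY sY.
rewrite big_split /= opprD addrACA.
apply: le_lt_trans (cnD _ _) _; rewrite [e]splitr; apply: ltrD.
  by apply: hX => // t tX; apply: sY; rewrite mem_cat tX.
by apply: hX' => // t tX; apply: sY; rewrite mem_cat tX orbT.
Qed.

Lemma has_sumZ (T : eqType) (f : T -> C) c s :
  has_sum f s -> has_sum (fun t => c * f t) (c * s).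
Proof.
move=> h e e0.
have c0 : 0 < cn c + 1 by rewrite ltr_wpDl ?cn_ge0.
have [X hX] := h (e / (cn c + 1)) (divr_gt0 e0 c0).
exists X => Y uY sY; rewrite -mulr_sumr -mulrBr cnM.
have := hX Y uY sY; rewrite ltr_pdivlMr // mulrC; apply: le_lt_trans.
by rewrite ler_wpM2r ?cn_ge0 // lerDl.
Qed.

Lemma has_sumN (T : eqType) (f : T -> C) s :
  has_sum f s -> has_sum (fun t => - f t) (- s).
Proof.
move=> /(has_sumZ (-1)); rewrite mulN1r; apply: has_sum_ext => t.
by rewrite mulN1r.
Qed.

Lemma has_sum_finite (T : eqType) (f : T -> C) (X : seq T) :
  uniq X -> (forall t, t \notin X -> f t = 0) -> has_sum f (\sum_(t <- X) f t).
Proof.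
move=> uX hX e e0; exists X => Y uY sXY.
have /(perm_big _) -> : perm_eq Y (X ++ [seq t <- Y | t \notin X]).
  apply: uniq_perm => //.
    rewrite cat_uniq uX filter_uniq // andbT /=; apply/hasPn => t.
    by rewrite mem_filter => /andP[].
  move=> t; rewrite mem_cat mem_filter; case: (boolP (t \in X)) => //=.
  by move/sXY.
rewrite big_cat /= (_ : \sum_(t <- [seq t <- Y | t \notin X]) f t = 0).
  by rewrite addr0 subrr cn0.
by rewrite big_filter big1 // => t /hX.
Qed.

Lemma has_sum_sum (T : eqType) (I : Type) (r : seq I) (F : I -> T -> C)
    (S : I -> C) : (forall i, has_sum (F i) (S i)) ->
  has_sum (fun t => \sum_(i <- r) F i t) (\sum_(i <- r) S i).
Proof.
move=> h; elim: r => [|i r IH].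
  rewrite big_nil => e e0; exists [::] => Y _ _.
  by rewrite big1 ?subrr ?cn0 // => t _; rewrite big_nil.
rewrite big_cons; apply: has_sum_ext (has_sumD (h i) IH) => t.
by rewrite big_cons.
Qed.

(** Choice inverts [h] on its image, so that a finite list in U can be pulled back with [pmap]. *)
Lemma partial_inverse (T U : eqType) (h : T -> U) : injective h ->
  exists p : U -> option T, pcancel h p /\ forall u t, p u = Some t -> h t = u.
Proof.
move=> ih.
exists (fun u => if pselect (exists t, h t = u) is left e
                 then Some (projT1 (cid e)) else None).
split=> [t|u t].
  case: pselect => [e|[]]; last by exists t.
  by congr Some; case: cid => /= s /ih.
by case: pselect => // e [<-]; case: cid.
Qed.

Lemma has_sum_inj (T U : eqType) (h : T -> U) (f : U -> C) s :
  injective h -> (forall u, (forall t, h t != u) -> f u = 0) ->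
  has_sum (f \o h) s -> has_sum f s.
Proof.
move=> ih f0 hs e e0; have [X hX] := hs e e0.
have [p [hp ph]] := partial_inverse ih.
exists (map h X) => Y uY sY.
have -> : \sum_(u <- Y) f u = \sum_(t <- pmap p Y) (f \o h) t.
  rewrite big_pmap; apply: eq_bigr => u _; case E : (p u) => [t|] /=.
    by rewrite (ph _ _ E).
  apply: f0 => t; apply/eqP => htu; move: E; rewrite -htu hp //.
apply: hX.
  apply: (@pmap_uniq _ _ p h) => //.
  by move=> u; case E : (p u) => [t|] //=; exact: ph.
move=> t tX; rewrite mem_pmap; apply/mapP; exists (h t); last by rewrite hp.
by apply: sY; apply: map_f.
Qed.

Lemma has_sum_bij (T U : eqType) (h : T -> U) (f : U -> C) s :
  bijective h -> has_sum (f \o h) s -> has_sum f s.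
Proof.
move=> bh; apply: has_sum_inj; first exact: bij_inj.
by case: bh => g _ hg u /(_ (g u)); rewrite hg eqxx.
Qed.

Lemma has_sum_norm (T : eqType) (f : T -> C) s B :
  has_sum f s -> sum_bounded f B -> cn s <= B.
Proof.
move=> h hB; rewrite leNgt; apply/negP => hlt.
have [|X hX] := h (cn s - B); first by rewrite subr_gt0.
have sX : {subset X <= undup X} by move=> t; rewrite mem_undup.
have := hX _ (undup_uniq X) sX.
rewrite cn_distC; apply/negP; rewrite -leNgt.
apply: le_trans (cnDB _ _); rewrite cnN lerD2l lerN2.
by apply: le_trans (cn_sum _ _ _) _; apply: hB; exact: undup_uniq.
Qed.

Lemma summable_le (T : eqType) (f g : T -> C) :
  (forall t, cn (f t) <= cn (g t)) -> summable g -> summable f.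
Proof.
move=> fg [B hB]; exists B => X uX; apply: le_trans (hB X uX).
by apply: ler_sum => t _; exact: fg.
Qed.

Lemma summable_inj (T U : eqType) (h : T -> U) (f : U -> C) :
  injective h -> summable f -> summable (f \o h).
Proof.
move=> ih [B hB]; exists B => X uX.
rewrite -(big_map h predT (fun u => cn (f u))); apply: hB.
by rewrite map_inj_uniq.
Qed.

Lemma summableZ (T : eqType) (f : T -> C) c :
  summable f -> summable (fun t => c * f t).
Proof.
move=> [B hB]; exists (cn c * B) => X uX.
under eq_bigr do rewrite cnM.
by rewrite -mulr_sumr ler_wpM2l ?cn_ge0 ?hB.
Qed.

Lemma summable_real_ge0 (T : eqType) (f : T -> R) :
  (forall t, 0 <= f t) -> summable (fun t => (f t)%:C) ->
  exists s, has_sum (fun t => (f t)%:C) s.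
Proof.
move=> f0 [B hB].
pose E := [set x : R | exists2 X, uniq X & x = \sum_(t <- X) f t]%classic.
have supE : has_sup E.
  split; first by exists 0, [::]; rewrite ?big_nil.
  exists B => _ [X uX ->]; apply: le_trans (hB X uX).
  by apply: ler_sum => t _; rewrite cn_real ger0_norm.
exists (sup E)%:C => e e0.
have [_ [X uX ->] hX] := sup_adherent e0 supE.
exists X => Y uY sXY; rewrite -rmorph_sum -rmorphB cn_real ltr_distl.
rewrite (lt_le_trans hX (ler_sum_subset uX uY sXY f0)) /=.
by apply: (@le_lt_trans _ _ (sup E)); [apply: ub_le_sup; [exact: supE.2|exists Y]
  |rewrite ltrDl].
Qed.

(** Positive and negative parts of the real and imaginary parts reduce this to nonnegative families,
    where the sum is the supremum of the finite sums. *)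
Lemma summable_has_sum (T : eqType) (f : T -> C) :
  summable f -> has_sum f (csum f).
Proof.
move=> sf; suff [s hs] : exists s, has_sum f s by rewrite (csumE hs).
have part (g : T -> R) : (forall t, `|g t| <= cn (f t)) ->
    exists s, has_sum (fun t => (g t)%:C) s.
  move=> gf.
  have [s1 h1] : exists s, has_sum (fun t => (Num.max (g t) 0)%:C) s.
    apply: summable_real_ge0; first by move=> t; rewrite le_max lexx orbT.
    apply: summable_le sf => t; apply: le_trans (gf t); rewrite cn_real.
    by case: (lerP (g t) 0) => _; rewrite ?normr0.
  have [s2 h2] : exists s, has_sum (fun t => (Num.max (- g t) 0)%:C) s.
    apply: summable_real_ge0; first by move=> t; rewrite le_max lexx orbT.
    apply: summable_le sf => t; apply: le_trans (gf t); rewrite cn_real.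
    by case: (lerP (- g t) 0) => _; rewrite ?normr0 ?normrN.
  exists (s1 - s2); apply: has_sum_ext (has_sumD h1 (has_sumN h2)) => t /=.
  rewrite -rmorphB; congr (_ %:C).
  by case: (lerP (g t) 0); case: (lerP (- g t) 0); lra.
have [s1 h1] := part (fun t => Re (f t)) (fun t => Re_le_cn (f t)).
have [s2 h2] := part (fun t => Im (f t)) (fun t => Im_le_cn (f t)).
exists (s1 + 'i * s2); apply: has_sum_ext (has_sumD h1 (has_sumZ 'i h2)) => t.
by rewrite -complexE.
Qed.

(** The fibres of [p] may be infinite. For a finite list Y of fibres, a finite W approximates each
    fibre sum within d, and the part of W above Y already approximates the total; d shares e / 2
    among the fibres. *)
Lemma has_sum_fibers (T U : eqType) (p : T -> U) (f : T -> C) (g : U -> C) s :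
  has_sum f s ->
  (forall u, has_sum (fun t => if p t == u then f t else 0) (g u)) ->
  has_sum g s.
Proof.
move=> hf hg e e0.
have [X hX] := hf (e / 2) (divr_gt0 e0 (ltr0Sn _ _)).
exists (map p X) => Y uY sY.
pose d := e / 2 / (size Y).+1%:R.
have d0 : 0 < d by rewrite !divr_gt0.
have /choice [Z hZ] : forall u, exists Z : seq T, forall W, uniq W ->
    {subset Z <= W} ->
    cn (\sum_(t <- W) (if p t == u then f t else 0) - g u) < d.
  by move=> u; exact: hg.
pose W := undup (X ++ flatten (map Z Y)).
have uW : uniq W by exact: undup_uniq.
pose W' := [seq t <- W | p t \in Y].
have hW' : cn (\sum_(t <- W') f t - s) < e / 2.
  apply: hX; first exact: filter_uniq.
  move=> t tX; rewrite mem_filter mem_undup mem_cat tX andbT.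
  by apply: sY; exact: map_f.
have E : \sum_(t <- W') f t =
    \sum_(u <- Y) \sum_(t <- W) (if p t == u then f t else 0).
  rewrite exchange_big big_filter big_mkcond; apply: eq_bigr => t _ /=.
  rewrite -big_mkcond /=; case: ifP => [pY|/negbT pY].
    under eq_bigl do rewrite eq_sym; rewrite -big_filter.
    have -> : [seq i <- Y | i == p t] = [:: p t].
      rewrite -[LHS]/(seq.filter (pred1 (p t)) Y) filter_pred1_uniq //.
    by rewrite big_seq1.
  rewrite big1_seq // => u /andP[/eqP pu uY']; by rewrite pu uY' in pY.
have -> : \sum_(t <- Y) g t - s =
   (\sum_(t <- W') f t - s) -
   \sum_(u <- Y) (\sum_(t <- W) (if p t == u then f t else 0) - g u).
  by rewrite sumrB -E; ring.
apply: le_lt_trans (cnB _ _) _; rewrite [e]splitr; apply: ltr_leD => //.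
apply: le_trans (cn_sum _ _ _) _.
apply: (@le_trans _ _ (\sum_(u <- Y) d)).
  rewrite big_seq [X in _ <= X]big_seq; apply: ler_sum => u uY'.
  apply/ltW/hZ => // t tZ; rewrite mem_undup mem_cat; apply/orP; right.
  by apply/flatten_mapP; exists u.
rewrite big_const_seq count_predT iter_addr_0 -[d *+ _]mulr_natr.
have -> : d * (size Y)%:R = e / 2 * ((size Y)%:R / (size Y).+1%:R).
  by rewrite /d; ring.
apply: ler_piMr; first by rewrite divr_ge0 ?ltW.
by rewrite ler_pdivrMr ?ltr0n // mul1r ler_nat.
Qed.

Lemma has_sum_pair (T U : eqType) (f : T * U -> C) (g : T -> C) s :
  has_sum f s -> (forall t, has_sum (fun u => f (t, u)) (g t)) -> has_sum g s.
Proof.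
move=> hf hg; apply: (has_sum_fibers (p := fst) hf) => t.
apply: (@has_sum_inj _ _ (fun u => (t, u))); first by move=> u v [].
  move=> [t' u] h /=; case: eqP => // e; move: (h u); rewrite e eqxx //.
by apply: has_sum_ext (hg t) => u /=; rewrite eqxx.
Qed.

Lemma has_sum_swap (T U : eqType) (f : T * U -> C) s :
  has_sum f s -> has_sum (fun x : U * T => f (x.2, x.1)) s.
Proof.
move=> h; apply: (@has_sum_bij _ _ (fun x : T * U => (x.2, x.1))).
  by exists (fun x => (x.2, x.1)) => -[].
by apply: has_sum_ext h => -[].
Qed.

Lemma sum_pair_le (T U : eqType) (g : T * U -> R) (h : T -> R) B (X : seq (T * U)) :
  (forall x, 0 <= g x) ->
  (forall t Y, uniq Y -> \sum_(u <- Y) g (t, u) <= h t) ->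
  (forall X, uniq X -> \sum_(t <- X) h t <= B) ->
  uniq X -> \sum_(x <- X) g x <= B.
Proof.
move=> g0 gh hB uX.
pose X1 := undup (map fst X); pose X2 := undup (map snd X).
apply: (@le_trans _ _ (\sum_(x <- [seq (a, b) | a <- X1, b <- X2]) g x)).
  apply: ler_sum_subset => //.
    by apply: allpairs_uniq; rewrite ?undup_uniq // => -[a b] [c d] _ _ [-> ->].
  move=> [a b] abX; apply/allpairsP; exists (a, b).
  by rewrite !mem_undup (map_f fst abX) (map_f snd abX).
rewrite big_allpairs; apply: le_trans (hB X1 (undup_uniq _)).
by apply: ler_sum => t _; apply: gh; exact: undup_uniq.
Qed.

Lemma summableM (T U : eqType) (f : T -> C) (g : U -> C) :
  summable f -> summable g -> summable (fun x : T * U => f x.1 * g x.2).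
Proof.
move=> [B hB] [B' hB']; exists (B * B') => X uX.
apply: (@sum_pair_le _ _ (fun x => cn (f x.1 * g x.2)) (fun t => cn (f t) * B')) => //.
- by move=> x; exact: cn_ge0.
- move=> t Y uY.
  rewrite (eq_bigr (fun u => cn (f t) * cn (g u))) => [|u _]; last by rewrite cnM.
  by rewrite -mulr_sumr ler_wpM2l ?cn_ge0 ?hB'.
move=> Z uZ; rewrite -mulr_suml ler_wpM2r ?hB //.
by have := hB' [::] isT; rewrite big_nil.
Qed.

Lemma has_sumM (T U : eqType) (f : T -> C) (g : U -> C) s s' :
  summable f -> summable g -> has_sum f s -> has_sum g s' ->
  has_sum (fun x : T * U => f x.1 * g x.2) (s * s').
Proof.
move=> sf sg hf hg.
have hs := summable_has_sum (summableM sf sg).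
have h1 := has_sum_pair hs (fun t => has_sumZ (f t) hg).
have h2 : has_sum (fun t => f t * s') (s * s').
  by rewrite mulrC; apply: has_sum_ext (has_sumZ s' hf) => t; rewrite mulrC.
by rewrite -(has_sum_unique h1 h2).
Qed.

(** A finite sum avoiding X is the difference of two partial sums within 1 of s, hence below 2.
    Applied to the terms whose real (or imaginary) part has a given sign, this bounds the absolute
    values. *)
Lemma has_sum_summable (T : eqType) (f : T -> C) s : has_sum f s -> summable f.
Proof.
move=> hs; have [X0 hX] := hs 1 ltr01.
pose X := undup X0; have uX : uniq X := undup_uniq X0.
have sub (P : pred T) (Z : seq T) : uniq Z ->
    cn (\sum_(t <- Z | P t && (t \notin X)) f t) < 2.
  move=> uZ; pose Z' := [seq t <- Z | P t && (t \notin X)].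
  have uXZ : uniq (X ++ Z').
    rewrite cat_uniq uX filter_uniq // andbT /=; apply/hasPn => t.
    by rewrite mem_filter => /andP[/andP[]].
  have h1 := hX (X ++ Z') uXZ; have h2 := hX X uX.
  rewrite -big_filter -/Z'.
  have -> : \sum_(t <- Z') f t = (\sum_(t <- X ++ Z') f t - s) - (\sum_(t <- X) f t - s).
    by rewrite big_cat /=; ring.
  apply: le_lt_trans (cnB _ _) _; rewrite (_ : 2 = 1 + 1) //; apply: ltrD.
    by apply: h1 => t tX; rewrite mem_cat mem_undup tX.
  by apply: h2 => t tX; rewrite mem_undup.
have part (g : C -> R) (Z : seq T) : uniq Z -> {morph g : x y / x + y} -> g 0 = 0 ->
    (forall z, `|g z| <= cn z) ->
    \sum_(t <- Z | t \notin X) `|g (f t)| <= 4.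
  move=> uZ gD g0 gn.
  have gs (P : pred T) : g (\sum_(t <- Z | P t) f t) = \sum_(t <- Z | P t) g (f t).
    exact: big_morph.
  rewrite (bigID (fun t => 0 <= g (f t))) /=.
  have h (P : pred T) : `|\sum_(t <- Z | (t \notin X) && P t) g (f t)| <= 2.
    by rewrite -gs; apply: le_trans (gn _) _; apply/ltW; under eq_bigl do rewrite andbC; exact: sub.
  rewrite (_ : 4 = 2 + 2); last by ring.
  apply: lerD.
    apply: le_trans (h (fun t => 0 <= g (f t))); apply: le_trans (ler_norm _).
    by apply: ler_sum => t /andP[_ h0]; rewrite ger0_norm.
  apply: le_trans (h (fun t => ~~ (0 <= g (f t)))); rewrite -normrN; apply: le_trans (ler_norm _).
  rewrite -sumrN; apply: ler_sum => t /andP[_]; rewrite -ltNge => h0.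
  by rewrite ltr0_norm.
exists (\sum_(t <- X) cn (f t) + (4 + 4)) => Z uZ.
rewrite (bigID (fun t => t \in X)) /=; apply: lerD.
  rewrite -big_filter; apply: ler_sum_subset => //; first exact: filter_uniq.
    by move=> t; rewrite mem_filter => /andP[].
  by move=> t; exact: cn_ge0.
apply: le_trans (lerD (part (@complex.Re R) Z uZ _ _ _) (part (@complex.Im R) Z uZ _ _ _)).
- rewrite -big_split; apply: ler_sum => t _.
  case: (f t) => a b /=; rewrite -(ler_pXn2r (ltn0Sn 1)) ?nnegrE ?sqrtr_ge0 ?addr_ge0 //.
  rewrite sqr_sqrtr ?addr_ge0 ?sqr_ge0 // sqrrD !real_normK ?num_real //.
  by rewrite lerD2r lerDl mulrn_wge0 ?mulr_ge0.
- by move=> x y; exact: ReD.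
- by [].
- exact: Re_le_cn.
- by move=> x y; exact: ImD.
- by [].
- exact: Im_le_cn.
Qed.

End Sums.

(** * Elementary estimates for exp, sin, cos and pi *)

Section RealEstimates.
Variable R : realType.
Implicit Types x y : R.

Lemma expR_sub1_le x : expR x - 1 <= x * expR x.
Proof.
have := expR_ge1Dx (- x); rewrite -(ler_pM2r (expR_gt0 x)) -expRD addNr expR0.
lra.
Qed.

Lemma norm_expR_sub1 x : `|expR x - 1| <= `|x| * expR `|x|.
Proof.
have h1 := expR_sub1_le x; have h2 := expR_ge1Dx x.
have h3 : expR x <= expR `|x| by rewrite ler_expR ler_norm.
have h4 : 1 <= expR `|x| by rewrite -expR0 ler_expR.
case: (lerP 0 x) => x0.
  rewrite ger0_norm; last by lra.
  by apply: le_trans h1 _; rewrite (ger0_norm x0).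
rewrite ler0_norm; last by rewrite subr_le0 -expR0 ler_expR ltW.
rewrite (ltr0_norm x0) in h4 *; nra.
Qed.

Lemma norm_expR_sub1B x : `|expR x - 1 - x| <= x ^+ 2 * expR `|x|.
Proof.
have h1 := expR_sub1_le x; have h2 := expR_ge1Dx x.
rewrite ger0_norm; last by lra.
apply: (@le_trans _ _ (x * (expR x - 1))); first by lra.
apply: le_trans (ler_norm _) _; rewrite normrM -(real_normK (num_real x)) expr2.
by rewrite -mulrA ler_wpM2l // norm_expR_sub1.
Qed.

Lemma sin_diff x : 0 < x -> exists2 c, 0 < c < x & sin x = cos c * x.
Proof.
move=> x0.
have hd (y : R) : y \in `]0, x[ -> is_derive y 1 sin (cos y).
  by move=> _; exact: is_derive_sin.
have [c] := MVT x0 hd (continuous_subspaceT (@continuous_sin R)).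
by rewrite in_itv /= sin0 !subr0 => h e; exists c.
Qed.

Lemma norm_sin_le x : `|sin x| <= `|x|.
Proof.
wlog x0 : x / 0 < x => [h|].
  case: (ltrgtP x 0) => [x0|/h //|->]; last by rewrite sin0.
  by rewrite -normrN -sinN -[X in _ <= X]normrN h // oppr_gt0.
have [c _ ->] := sin_diff x0.
by rewrite normrM ler_piMl // cos_max.
Qed.

Lemma half_mulr2n x : (x / 2) *+ 2 = x.
Proof. by rewrite mulr2n -splitr. Qed.

Lemma one_sub_cos x : 1 - cos x = 2 * sin (x / 2) ^+ 2.
Proof.
have := cos_mulr2n (x / 2); have := cos2Dsin2 (x / 2).
rewrite half_mulr2n; lra.
Qed.

Lemma norm_cos_sub1 x : `|1 - cos x| <= `|x|.
Proof.
rewrite one_sub_cos normrM normrX (ger0_norm (ler0n _ 2)).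
have h1 := norm_sin_le (x / 2); have h2 := sin_max (x / 2).
rewrite normrM (_ : `|2^-1| = 2^-1 :> R) in h1; last by rewrite ger0_norm ?invr_ge0.
have := normr_ge0 (sin (x / 2)); have := normr_ge0 x; nra.
Qed.

Lemma norm_cos_sub1_sqr x : `|1 - cos x| <= x ^+ 2.
Proof.
rewrite one_sub_cos normrM normrX (ger0_norm (ler0n _ 2)).
have h1 := norm_sin_le (x / 2); rewrite -(real_normK (num_real x)).
rewrite normrM (_ : `|2^-1| = 2^-1 :> R) in h1; last by rewrite ger0_norm ?invr_ge0.
have := normr_ge0 (sin (x / 2)); have := normr_ge0 x; nra.
Qed.

Lemma norm_sin_subr x : `|sin x - x| <= x ^+ 2.
Proof.
wlog x0 : x / 0 < x => [h|].
  case: (ltrgtP x 0) => [x0|/h //|->]; last by rewrite sin0 subr0 normr0 expr0n.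
  rewrite -normrN (_ : - (sin x - x) = sin (- x) - (- x)); last by rewrite sinN; ring.
  by rewrite -sqrrN h // oppr_gt0.
have [c /andP[c0 cx] ->] := sin_diff x0.
rewrite -[X in _ - X]mul1r -mulrBl normrM distrC expr2.
rewrite (gtr0_norm x0) ler_wpM2r ?(ltW x0) //.
by apply: le_trans (norm_cos_sub1 c) _; rewrite gtr0_norm // ltW.
Qed.

Lemma cos_pi4_sqr : cos (pi / 4 : R) ^+ 2 = 1 / 2.
Proof.
have := cos_mulr2n (pi / 4 : R).
rewrite (_ : (pi / 4) *+ 2 = pi / 2 :> R); last by field.
rewrite cos_pihalf; lra.
Qed.

(** A weak form of Jordan's inequality: sin x = 2 sin(x/2) cos(x/2) = x cos c cos(x/2) for some c
    between 0 and x/2, and both cosines are at least cos(pi/4), whose square is 1/2. *)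
Lemma sin_ge_half x : 0 <= x <= pi / 2 -> x / 2 <= sin x.
Proof.
move=> /andP[x0 xp]; have pi0 := pi_gt0 R.
move: x0; rewrite le_eqVlt => /orP[/eqP <-|x0]; first by rewrite sin0 mul0r.
have x20 : 0 < x / 2 by rewrite divr_gt0.
have cospos y : 0 < y <= pi / 4 -> cos (pi / 4) <= cos y.
  move=> /andP[y0 yp]; rewrite leNgt ltr_cos; first by rewrite -leNgt.
    by rewrite in_itv /=; lra.
  by rewrite in_itv /=; lra.
have k0 : 0 < cos (pi / 4 : R) by apply: cos_gt0_pihalf; lra.
have [c /andP[c0 cx] sc] := sin_diff x20.
have := sin_mulr2n (x / 2); rewrite half_mulr2n => ->; rewrite sc.
have h1 := cospos c; have h2 := cospos (x / 2); have h3 := cos_pi4_sqr.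
have {}h1 : cos (pi / 4) <= cos c by apply: h1; lra.
have {}h2 : cos (pi / 4) <= cos (x / 2) by apply: h2; lra.
have : cos (pi / 4 : R) ^+ 2 <= cos (x / 2) * cos c.
  rewrite expr2; apply: ler_pM => //; exact: ltW.
rewrite h3; nra.
Qed.

(** Expanding sin(pi/3 + pi/6) = 1 gives the cubic (s + 1)(2 s - 1)^2 = 0 for s = sin(pi/6). So s =
    1/2, and |sin x| <= |x| at pi/6 gives the bound. *)
Lemma pi_ge3 : 3 <= pi :> R.
Proof.
have pi0 := pi_gt0 R.
set s := sin (pi / 6 : R); set c := cos (pi / 6 : R).
have s0 : 0 < s by apply: sin_gt0_pi; lra.
have e1 : c ^+ 2 + s ^+ 2 = 1 := cos2Dsin2 _.
have e2 : sin (pi / 3 : R) = 2 * s * c.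
  rewrite (_ : pi / 3 = (pi / 6) *+ 2 :> R) ?sin_mulr2n; last by field.
  by rewrite -/s -/c; ring.
have e3 : cos (pi / 3 : R) = 1 - 2 * s ^+ 2.
  rewrite (_ : pi / 3 = (pi / 6) *+ 2 :> R) ?cos_mulr2n; last by field.
  by rewrite -/c; move: e1; lra.
have e4 : (s + 1) * (2 * s - 1) ^+ 2 = 0.
  have := sinD (pi / 3 : R) (pi / 6).
  rewrite (_ : pi / 3 + pi / 6 = pi / 2 :> R); last by field.
  rewrite sin_pihalf e2 e3 -/s -/c => e.
  have -> : (s + 1) * (2 * s - 1) ^+ 2 =
    1 - (2 * s * c * c + (1 - 2 * s ^+ 2) * s) + 2 * s * (c ^+ 2 + s ^+ 2 - 1).
    by ring.
  by rewrite -e e1; ring.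
have s12 : s = 1 / 2.
  move/eqP: e4; rewrite mulf_eq0 sqrf_eq0 => /orP[] /eqP; lra.
have := norm_sin_le (pi / 6 : R); rewrite -/s s12 !ger0_norm; lra.
Qed.

End RealEstimates.

Fact cexp_key : unit. Proof. by []. Qed.

(** * The complex exponential *)

Section ComplexExp.
Variable R : realType.
Local Notation C := R[i].
Implicit Types (z w : C) (x y : R).

Definition cexp z : C :=
  locked_with cexp_key ((expR (Re z))%:C * (cos (Im z) +i* sin (Im z))).

Lemma cexpE z : cexp z = (expR (Re z))%:C * (cos (Im z) +i* sin (Im z)).
Proof. by rewrite /cexp unlock. Qed.

Lemma cexp0 : cexp 0 = 1.
Proof. by rewrite cexpE /= expR0 cos0 sin0 mul1r. Qed.

Lemma cexpD z w : cexp (z + w) = cexp z * cexp w.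
Proof.
rewrite !cexpE ReD ImD expRD cosD sinD rmorphM mulrACA; congr (_ * _).
by simpc; congr (_ +i* _); ring.
Qed.

Lemma cn_cis x : cn (cos x +i* sin x) = 1 :> R.
Proof. by rewrite /= cos2Dsin2 sqrtr1. Qed.

Lemma cn_cexp z : cn (cexp z) = expR (Re z).
Proof. by rewrite cexpE cnM cn_cis cn_real ger0_norm ?expR_ge0 // mulr1. Qed.

Lemma cexp_real (x : R) : cexp x%:C = (expR x)%:C :> C.
Proof. by rewrite cexpE /= cos0 sin0 mulr1. Qed.

Lemma cexp_neq0 z : cexp z != 0.
Proof. by rewrite -cn_gt0 cn_cexp expR_gt0. Qed.

Lemma cexpN z : cexp (- z) = (cexp z)^-1.
Proof.
apply: (mulIf (cexp_neq0 z)); rewrite mulVf ?cexp_neq0 //.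
by rewrite -cexpD addNr cexp0.
Qed.

Lemma cexpX z k : cexp z ^+ k = cexp (k%:R * z).
Proof.
elim: k => [|k IH]; first by rewrite mul0r cexp0.
by rewrite exprS IH -cexpD -[in RHS]natr1; congr cexp; ring.
Qed.

Definition tpi : C := (2 * pi)%:C * 'i.

Lemma cexp_tpi_nat (k : nat) : cexp (tpi * k%:R) = 1.
Proof.
rewrite mulrC -cexpX (_ : cexp tpi = 1) ?expr1n //.
rewrite cexpE /tpi ReM ImM /= !mulr0 !mul0r !mulr1 subrr addr0 expR0.
by rewrite mulr_natl cos2pi sin2pi mul1r.
Qed.

Lemma cexp_tpi_int (m : int) : cexp (tpi * m%:~R) = 1.
Proof.
case: m => m; first exact: cexp_tpi_nat.
by rewrite NegzE mulrNz mulrN cexpN -pmulrn cexp_tpi_nat invr1.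
Qed.

Lemma cn_re_im x y : cn (x +i* y) <= `|x| + `|y|.
Proof.
have -> : x +i* y = x%:C + 'i * y%:C by rewrite [LHS]complexE.
apply: le_trans (cnD _ _) _; rewrite cnM !cn_real /=.
by rewrite expr0n add0r expr1n sqrtr1 mul1r.
Qed.

Lemma cn_cis_sub1 y : cn ((cos y +i* sin y) - 1) <= 2 * `|y|.
Proof.
have -> : (cos y +i* sin y) - 1 = (cos y - 1) +i* sin y :> C.
  by apply/eqP; rewrite eq_complex /= subr0 !eqxx.
apply: le_trans (cn_re_im _ _) _; rewrite distrC.
have := norm_cos_sub1 y; have := norm_sin_le y; lra.
Qed.

Lemma cn_cis_sub1B y : cn ((cos y +i* sin y) - 1 - 'i * y%:C) <= 2 * y ^+ 2.
Proof.
have -> : (cos y +i* sin y) - 1 - 'i * y%:C = (cos y - 1) +i* (sin y - y) :> C.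
  by apply/eqP; rewrite eq_complex /=; apply/andP; split; apply/eqP; ring.
apply: le_trans (cn_re_im _ _) _; rewrite distrC.
have := norm_cos_sub1_sqr y; have := norm_sin_subr y; lra.
Qed.

(** In this range |exp(i y) - 1| = 2 sin(|y| / 2). The bound keeps roots of unity away from 1 in the
    decay estimate for Fourier coefficients. *)
Lemma cn_cis_sub1_ge y : `|y| <= pi -> `|y| / 2 <= cn ((cos y +i* sin y) - 1).
Proof.
move=> yp; have h0 : 0 <= `|y| / 2 by rewrite divr_ge0.
have -> : (cos y +i* sin y) - 1 = (cos y - 1) +i* sin y :> C.
  by apply/eqP; rewrite eq_complex /= subr0 !eqxx.
rewrite -(ler_pXn2r (ltn0Sn 1)) ?nnegrE ?cn_ge0 // sqr_cn /=.
have e1 : cos y ^+ 2 + sin y ^+ 2 = 1 := cos2Dsin2 _.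
have -> : (cos y - 1) ^+ 2 + sin y ^+ 2 = 2 * (1 - cos y).
  transitivity (cos y ^+ 2 + sin y ^+ 2 - 2 * cos y + 1); first by ring.
  by rewrite e1; ring.
have -> : cos y = cos `|y|.
  by rewrite cos_norm.
rewrite one_sub_cos.
have h1 : `|y| / 2 / 2 <= sin (`|y| / 2).
  by apply: sin_ge_half; apply/andP; split => //; rewrite ler_pdivrMr //; lra.
have : 0 <= `|y| / 2 / 2 by rewrite divr_ge0.
nra.
Qed.

Lemma cn_cexp_sub1 w : cn (cexp w - 1) <= 3 * cn w * expR (cn w).
Proof.
case: w => x y; rewrite cexpE [Re _]/= [Im _]/=; set n := cn (x +i* y).
have hx : `|x| <= n := Re_le_cn (x +i* y).
have hy : `|y| <= n := Im_le_cn (x +i* y).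
have -> : (expR x)%:C * (cos y +i* sin y) - 1 =
  (expR x)%:C * ((cos y +i* sin y) - 1) + (expR x - 1)%:C.
  by rewrite rmorphB /=; ring.
apply: le_trans (cnD _ _) _; rewrite cnM !cn_real ger0_norm ?expR_ge0 //.
have h1 := cn_cis_sub1 y; have h2 := norm_expR_sub1 x.
have n0 : 0 <= n by apply: le_trans hx.
have e1 : expR x <= expR n by rewrite ler_expR; apply: le_trans hx; exact: ler_norm.
have e2 : expR `|x| <= expR n by rewrite ler_expR.
have -> : 3 * n * expR n = expR n * (2 * n) + n * expR n by ring.
apply: lerD.
  by apply: ler_pM; rewrite ?expR_ge0 ?cn_ge0 //; lra.
by apply: le_trans h2 _; apply: ler_pM; rewrite ?expR_ge0.
Qed.

Lemma cn_cexp_sub1B w : cn (cexp w - 1 - w) <= 4 * cn w ^+ 2 * expR (cn w).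
Proof.
case: w => x y; rewrite cexpE [Re _]/= [Im _]/=; set n := cn (x +i* y).
have hx : `|x| <= n := Re_le_cn (x +i* y).
have hy : `|y| <= n := Im_le_cn (x +i* y).
have -> : (expR x)%:C * (cos y +i* sin y) - 1 - (x +i* y) =
  (expR x)%:C * ((cos y +i* sin y) - 1 - 'i * y%:C) +
  ((expR x - 1 - x)%:C + 'i * (y%:C * (expR x - 1)%:C)).
  have -> : x +i* y = x%:C + 'i * y%:C by rewrite [LHS]complexE.
  by rewrite !rmorphB /=; ring.
apply: le_trans (cnD _ _) _; rewrite cnM cn_real ger0_norm ?expR_ge0 //.
have h1 := cn_cis_sub1B y; have h2 := norm_expR_sub1 x.
have h3 := norm_expR_sub1B x.
have n0 : 0 <= n by apply: le_trans hx.
have e1 : expR x <= expR n by rewrite ler_expR; apply: le_trans hx; exact: ler_norm.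
have e2 : expR `|x| <= expR n by rewrite ler_expR.
have x2 : x ^+ 2 <= n ^+ 2 by rewrite -(real_normK (num_real x)) ler_sqr ?nnegrE.
have y2 : y ^+ 2 <= n ^+ 2 by rewrite -(real_normK (num_real y)) ler_sqr ?nnegrE.
have -> : 4 * n ^+ 2 * expR n =
  expR n * (2 * n ^+ 2) + (n ^+ 2 * expR n + n * (n * expR n)) by ring.
apply: lerD.
  apply: ler_pM; rewrite ?expR_ge0 ?cn_ge0 //; apply: le_trans h1 _; lra.
apply: le_trans (cnD _ _) _; apply: lerD.
  rewrite cn_real; apply: le_trans h3 _.
  by apply: ler_pM; rewrite ?expR_ge0 ?sqr_ge0.
rewrite !cnM !cn_real /= expr0n add0r expr1n sqrtr1 mul1r.
apply: ler_pM => //; apply: le_trans h2 _.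
by apply: ler_pM; rewrite ?expR_ge0.
Qed.

End ComplexExp.

(** * Null sequences and dominated convergence *)

Section Limits.
Variable R : realType.
Local Notation C := R[i].

Definition cv0 (u : nat -> C) :=
  forall e : R, 0 < e -> exists N0, forall N, (N0 <= N)%N -> cn (u N) < e.

Lemma cv0D u v : cv0 u -> cv0 v -> cv0 (fun n => u n + v n).
Proof.
move=> hu hv e e0; have e2 : 0 < e / 2 by rewrite divr_gt0.
have [N1 h1] := hu _ e2; have [N2 h2] := hv _ e2.
exists (maxn N1 N2) => N; rewrite geq_max => /andP[l1 l2].
apply: le_lt_trans (cnD _ _) _; rewrite [e]splitr; apply: ltrD; auto.
Qed.

Lemma cv0_le (u v : nat -> C) : (forall n, cn (u n) <= cn (v n)) -> cv0 v -> cv0 u.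
Proof.
move=> uv hv e e0; have [N h] := hv e e0; exists N => n /h; exact: le_lt_trans.
Qed.

Lemma cv0Z u c : cv0 u -> cv0 (fun n => c * u n).
Proof.
move=> hu e e0; have c0 : 0 < cn c + 1 by rewrite ltr_wpDl ?cn_ge0.
have [N h] := hu (e / (cn c + 1)) (divr_gt0 e0 c0); exists N => n /h.
rewrite ltr_pdivlMr // cnM mulrC; apply: le_lt_trans.
by rewrite ler_wpM2r ?cn_ge0 // lerDl.
Qed.

Lemma cv0_cst c : cv0 (fun=> c) -> c = 0.
Proof.
move=> h; apply: cn_small_eq0 => e e0; have [N /(_ N (leqnn N))] := h e e0; exact.
Qed.

Lemma cv0_lin (u : nat -> C) (K : R) :
  (exists N0, forall n, (N0 <= n)%N -> cn (u n) * n%:R <= K) -> cv0 u.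
Proof.
move=> [N0 h] e e0; have [M hM] : exists M : nat, K / e < M%:R.
  by exists (Num.truncn (K / e)).+1; exact: truncnS_gt.
exists (maxn N0 M.+1) => n; rewrite geq_max => /andP[l1 l2].
have n0 : 0 < n%:R :> R by rewrite ltr0n (leq_trans _ l2).
rewrite -(ltr_pM2r n0); apply: le_lt_trans (h n l1) _.
move: hM; rewrite ltr_pdivrMr // mulrC => hM; apply: lt_trans hM _.
by rewrite ltr_pM2l // ltr_nat.
Qed.

Lemma summable_tail (T : eqType) (d : T -> R) (B e : R) : 0 < e ->
  (forall t, 0 <= d t) ->
  (forall X, uniq X -> \sum_(t <- X) d t <= B) ->
  exists X, uniq X /\ forall Y, uniq Y -> (forall t, t \in Y -> t \notin X) ->
    \sum_(t <- Y) d t < e.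
Proof.
move=> e0 d0 hB.
pose E := [set x : R | exists2 X, uniq X & x = \sum_(t <- X) d t]%classic.
have supE : has_sup E.
  split; first by exists 0, [::]; rewrite ?big_nil.
  by exists B => _ [X uX ->]; exact: hB.
have [_ [X uX ->] hX] := sup_adherent e0 supE.
exists X; split => // Y uY dis.
have : \sum_(t <- X ++ Y) d t <= sup E.
  apply: ub_le_sup; first exact: supE.2.
  exists (X ++ Y) => //; rewrite cat_uniq uX uY andbT /=.
  by apply/hasPn => t /dis.
rewrite big_cat /=; lra.
Qed.

(** Dominated convergence for unordered sums: the majorant leaves less than e / 2 outside a finite
    X, termwise convergence handles X, and the rest of e pays for replacing [s n] by a finite
    sum. *)
Lemma tannery (T : eqType) (f : nat -> T -> C) (s : nat -> C) (d : T -> R) B :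
  (forall t, 0 <= d t) ->
  (forall X, uniq X -> \sum_(t <- X) d t <= B) ->
  (forall n t, cn (f n t) <= d t) ->
  (forall t, cv0 (fun n => f n t)) ->
  (forall n, has_sum (f n) (s n)) -> cv0 s.
Proof.
move=> d0 hB fd f0 hs e e0.
have e2 : 0 < e / 2 by rewrite divr_gt0.
have e4 : 0 < e / 4 by rewrite divr_gt0.
have [X [uX hX]] := summable_tail e2 d0 hB.
have [N hN] : exists N0, forall N, (N0 <= N)%N ->
    \sum_(t <- X) cn (f N t) < e / 4.
  have X1 : 0 < (size X).+1%:R :> R by rewrite ltr0n.
  have d1 := divr_gt0 e4 X1.
  have /choice [M hM] : forall t, exists N0, forall N, (N0 <= N)%N ->
     cn (f N t) < e / 4 / (size X).+1%:R by move=> t; exact: f0.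
  exists (\max_(t <- X) M t) => N hN.
  apply: (@le_lt_trans _ _ (\sum_(t <- X) e / 4 / (size X).+1%:R)).
    rewrite big_seq [X in _ <= X]big_seq; apply: ler_sum => t tX.
    by apply/ltW/hM/(leq_trans _ hN); exact: leq_bigmax_seq.
  rewrite big_const_seq count_predT iter_addr_0 -[_ *+ size X]mulr_natr.
  rewrite mulrAC ltr_pdivrMr // ltr_pM2l // ltr_nat //.
exists N => n Nn.
have [Z hZ] := hs n (e / 4) e4.
pose W := undup (X ++ Z).
have sZ : {subset Z <= W} by move=> t tZ; rewrite mem_undup mem_cat tZ orbT.
have h1 := hZ W (undup_uniq _) sZ.
have h2 : cn (\sum_(t <- W) f n t) < e / 4 + e / 2.
  apply: le_lt_trans (cn_sum _ _ _) _.
  rewrite (bigID (mem X)) /=; apply: ltrD.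
    apply: le_lt_trans (hN n Nn); rewrite -big_filter.
    apply: ler_sum_subset => //; first by rewrite filter_uniq ?undup_uniq.
      by move=> t; rewrite mem_filter => /andP[].
    by move=> t; exact: cn_ge0.
  rewrite -big_filter.
  apply: (@le_lt_trans _ _ (\sum_(t <- [seq t <- W | t \notin X]) d t)).
    by apply: ler_sum => t _; exact: fd.
  apply: hX; first by rewrite filter_uniq ?undup_uniq.
  by move=> t; rewrite mem_filter => /andP[].
have -> : s n = \sum_(t <- W) f n t - (\sum_(t <- W) f n t - s n) by ring.
apply: le_lt_trans (cnB _ _) _; lra.
Qed.

End Limits.

(** * Gaussian sums bounded uniformly in the translate *)

Section GaussBounds.
Variable R : realType.
Local Notation C := R[i].

Lemma sum_geom_nat (rho : R) (X : seq nat) : 0 <= rho < 1 -> uniq X ->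
  \sum_(k <- X) rho ^+ k <= (1 - rho)^-1.
Proof.
move=> /andP[r0 r1] uX.
pose N := (\max_(k <- X) k).+1.
apply: (@le_trans _ _ (\sum_(k <- iota 0 N) rho ^+ k)).
  apply: ler_sum_subset => //; first exact: iota_uniq.
    by move=> k kX; rewrite mem_iota /= add0n ltnS; exact: leq_bigmax_seq.
  by move=> k; rewrite exprn_ge0.
have -> : \sum_(k <- iota 0 N) rho ^+ k = (1 - rho ^+ N) / (1 - rho).
  have := subrX1 rho N; rewrite -(big_mkord predT (fun k => rho ^+ k)).
  rewrite /index_iota subn0 => e.
  apply: (@mulIf _ (1 - rho)); first by lra.
  rewrite divfK; last by lra.
  by rewrite mulrC -opprB mulNr -e opprB.
rewrite ler_pdivrMr ?mulVf ?subr_gt0 ?gt_eqF ?subr_gt0 // lerBlDr lerDl.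
by rewrite exprn_ge0.
Qed.

Lemma sum_absz_le (w : nat -> R) (B : R) (X : seq int) :
  (forall Y, uniq Y -> \sum_(k <- Y) w k <= B) -> uniq X ->
  \sum_(k <- X) w (absz k) <= 2 * B.
Proof.
move=> hB uX.
have half (P : pred int) : {in P &, injective absz} ->
    \sum_(k <- X | P k) w (absz k) <= B.
  move=> iP; rewrite -big_filter.
  have := hB (map absz [seq k <- X | P k]); rewrite big_map; apply.
  rewrite map_inj_in_uniq ?filter_uniq // => a b.
  by rewrite !mem_filter => /andP[Pa _] /andP[Pb _]; exact: iP.
rewrite (bigID (fun k : int => 0 <= k)) /= mulr_natl mulr2n.
by apply: lerD; apply: half => -[a|a] [b|b] // _ _;
  [move=> /= ->|move=> /= [->]].
Qed.

Lemma sum_geom_int (rho : R) (X : seq int) : 0 <= rho < 1 -> uniq X ->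
  \sum_(k <- X) rho ^+ absz k <= 2 / (1 - rho).
Proof.
by move=> r uX; apply: (sum_absz_le (w := fun k => rho ^+ k)) uX => Y; exact: sum_geom_nat.
Qed.

(** After translation by the integer part of x, (u + f)^2 >= 2 |u| - 3 for 0 <= f < 1 leaves a
    geometric series of ratio exp(- 2 c). Uniformity in x serves the induction on the dimension,
    where completing the square shifts one coordinate by a function of the others. *)
Lemma gauss_bounded (c : R) : 0 < c -> exists2 B : R, 0 <= B &
  forall (x : R) (X : seq int), uniq X ->
    \sum_(m <- X) expR (- c * (m%:~R + x) ^+ 2) <= B.
Proof.
move=> c0; pose rho := expR (- (2 * c)).
have r : 0 <= rho < 1.
  by rewrite expR_ge0 /= -[X in _ < X]expR0 ltr_expR oppr_lt0 mulr_gt0.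
exists (expR (3 * c) * (2 / (1 - rho))).
  by rewrite mulr_ge0 ?expR_ge0 ?divr_ge0 ?subr_ge0 ?ltW //; case/andP: r.
move=> x X uX; pose fl := Num.floor x.
have /andP[f0 f1] : 0 <= x - fl%:~R < 1.
  rewrite subr_ge0 Num.Theory.floor_le_tmp /= ltrBlDr.
  by have := Num.Theory.floorD1_gt x; rewrite rmorphD /= addrC.
apply: (@le_trans _ _ (expR (3 * c) * \sum_(k <- map (fun m => m + fl) X) rho ^+ absz k)).
  rewrite big_map mulr_sumr; apply: ler_sum => m _.
  rewrite /rho -expRM_natl -expRD ler_expR.
  set k := m + fl; have -> : m%:~R + x = k%:~R + (x - fl%:~R).
    by rewrite /k intrD; ring.
  have -> : (absz k)%:R = `|k%:~R| :> R by rewrite -intr_norm -abszE.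
  move: (k%:~R : R) (x - _) f0 f1 => u f f0 f1.
  have h : 2 * `|u| - 3 <= (u + f) ^+ 2.
    have := sqr_ge0 (u + f + 1); have := sqr_ge0 (u + f - 1); rewrite !expr2.
    by case: (ger0P u) => u0; lra.
  by have := ler_wpM2l (ltW c0) h; lra.
rewrite ler_wpM2l ?expR_ge0 //; apply: sum_geom_int => //.
by rewrite map_inj_uniq // => a b /addIr.
Qed.

Lemma gauss_absorb (c D t : R) : 0 < c ->
  D * `|t| - c * t ^+ 2 <= D ^+ 2 / (2 * c) - c / 2 * t ^+ 2.
Proof.
move=> c0; rewrite -[t ^+ 2](real_normK (num_real t)).
move: `|t| => s.
have : 0 <= (D / c - s) ^+ 2 * (c / 2) by rewrite mulr_ge0 ?sqr_ge0 ?divr_ge0 ?ltW.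
have -> : (D / c - s) ^+ 2 * (c / 2) = D ^+ 2 / (2 * c) - D * s + c / 2 * s ^+ 2.
  by field; rewrite gt_eqF.
lra.
Qed.

Lemma sum_inv_sqr (X : seq int) : uniq X ->
  \sum_(k <- X) ((absz k).+1%:R ^+ 2)^-1 <= 4 :> R.
Proof.
have -> : 4 = 2 * 2 :> R by ring.
apply: (sum_absz_le (w := fun k => (k.+1%:R ^+ 2)^-1)) => Y uY.
pose N := \max_(k <- Y) k.
apply: (@le_trans _ _ (\sum_(k <- iota 0 N.+1) (k.+1%:R ^+ 2)^-1)).
  apply: ler_sum_subset => //; first exact: iota_uniq.
    by move=> k kY; rewrite mem_iota add0n ltnS; exact: leq_bigmax_seq.
  by move=> k; rewrite invr_ge0 sqr_ge0.
(* The sums telescope, since 1/(n+2)^2 <= 1/(n+1) - 1/(n+2); the claim keeps the remainder 1/(n+1)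
   for the induction. *)
suff h n : \sum_(k <- iota 0 n.+1) (k.+1%:R ^+ 2)^-1 <= 2 - n.+1%:R^-1 :> R.
  by apply: le_trans (h N) _; rewrite lerBlDr lerDl invr_ge0.
elim: n => [|n IH]; first by rewrite big_seq1 expr1n !invr1; lra.
rewrite -[n.+2]addn1 iotaD big_cat big_seq1 add0n.
apply: le_trans (lerD IH (lexx _)) _.
have -> : n.+2%:R = n.+1%:R + 1 :> R by rewrite -natr1.
rewrite addn1 (_ : n.+2%:R = n.+1%:R + 1 :> R); last by rewrite -natr1.
have p : 0 < n.+1%:R :> R by rewrite ltr0n.
move: (n.+1%:R : R) p => u u0; rewrite -subr_ge0.
have -> : 2 - (u + 1)^-1 - (2 - u^-1 + (u + 1) ^- 2) = (u * (u + 1) ^+ 2)^-1.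
  by field; lra.
by rewrite invr_ge0 mulr_ge0 ?sqr_ge0 ?ltW.
Qed.

End GaussBounds.

(** * Poisson summation in one variable *)

Section Theta.
Variable R : realType.
Local Notation C := R[i].
Implicit Types (b z u h : C).

Lemma Re_int (m : int) : Re (m%:~R : C) = m%:~R.
Proof. by rewrite -(rmorph_int (real_complex R)). Qed.
Lemma Im_int (m : int) : Im (m%:~R : C) = 0.
Proof. by rewrite -(rmorph_int (real_complex R)). Qed.
Lemma Re_real_mul (x : R) z : Re (x%:C * z) = x * Re z.
Proof. by rewrite ReM /= mul0r subr0. Qed.
Lemma Im_real_mul (x : R) z : Im (x%:C * z) = x * Im z.
Proof. by rewrite ImM /= mul0r addr0. Qed.

Definition gau b u : C := cexp (- b * u ^+ 2).
Definition dgau b u : C := - (2 * b * u * gau b u).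

(** One Gaussian majorant in Re u for the function, its derivative and its second-order Taylor
    remainder, uniform on the strip |Im u| <= Y. Giving up half of the exponent absorbs the factors
    exp(O(|Re u|)) produced by Im u and by the step h. *)
Lemma gau_estimates b (Y : R) : 0 < Re b -> 0 <= Y -> exists2 K : R, 0 <= K &
  forall u h, `|Im u| <= Y -> cn h <= 1 ->
  [/\ cn (gau b u) <= K * expR (- (Re b / 2) * Re u ^+ 2),
      cn (dgau b u) <= K * expR (- (Re b / 2) * Re u ^+ 2) &
      cn (gau b (u + h) - gau b u - h * dgau b u)
        <= cn h ^+ 2 * (K * expR (- (Re b / 2) * Re u ^+ 2))].
Proof.
move=> b0 Y0; set n := cn b.
have n0 : 0 <= n := cn_ge0 b.
(* D is the coefficient of |Re u| and E0 the constant in the exponent bounding |gau b u| exp(3 s),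
   where s bounds |b (2 u + h)|; [gauss_absorb] turns D into D^2 / (2 Re b). *)
pose D := 2 * n * Y + 6 * n.
pose E0 := n * Y ^+ 2 + 3 * n * (2 * Y + 1).
exists (5 * expR (D ^+ 2 / (2 * Re b) + E0)); first by rewrite mulr_ge0 ?expR_ge0.
move=> u h uY h1; set p := Re u.
pose s := n * (2 * `|p| + 2 * Y + 1).
have p0 := normr_ge0 p.
have ns : n <= s by rewrite -[X in X <= _]mulr1 ler_wpM2l //; lra.
have s0 : 0 <= s by apply: le_trans ns.
have es1 : 1 <= expR s by rewrite -expR0 ler_expR.
have ses : s <= expR s by apply: le_trans (expR_ge1Dx s); rewrite lerDr.
have cu : cn u <= `|p| + Y.
  have -> : u = p +i* Im u by rewrite /p; case: (u).
  by apply: le_trans (cn_re_im _ _) _; rewrite lerD2l.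
have gu : cn (gau b u) <= expR (- Re b * p ^+ 2 + 2 * n * Y * `|p| + n * Y ^+ 2).
  rewrite cn_cexp ler_expR; move: uY n0 b0 (Re_le_cn b) (Im_le_cn b).
  rewrite /n /p; case: (b) => be ga; case: (u) => pp q /=; set nn := Num.sqrt _.
  move=> uY n0 b0 hb hg.
  have -> : - be * (pp * pp - q * q) - - ga * (pp * q + q * pp) =
    - be * pp ^+ 2 + 2 * (ga * (pp * q)) + be * q ^+ 2 by ring.
  have h2 : ga * (pp * q) <= nn * (`|pp| * Y).
    apply: le_trans (ler_norm _) _; rewrite !normrM.
    by apply: ler_pM => //; [rewrite mulr_ge0|rewrite ler_wpM2l].
  have h3 : be * q ^+ 2 <= nn * Y ^+ 2.
    apply: ler_pM; rewrite ?sqr_ge0 ?(ltW b0) //.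
      by apply: le_trans hb; exact: ler_norm.
    by rewrite -(real_normK (num_real q)) ler_sqr ?nnegrE.
  lra.
have main : 5 * (cn (gau b u) * expR (3 * s)) <=
    5 * expR (D ^+ 2 / (2 * Re b) + E0) * expR (- (Re b / 2) * p ^+ 2).
  rewrite -mulrA ler_pM2l ?ltr0n // -expRD.
  apply: (@le_trans _ _ (expR (- Re b * p ^+ 2 + 2 * n * Y * `|p| + n * Y ^+ 2)
     * expR (3 * s))); first by rewrite ler_wpM2r ?expR_ge0.
  rewrite -expRD ler_expR.
  have := gauss_absorb D p b0; rewrite /D /E0 /s; lra.
have e3 : expR (3 * s) = expR s * expR s * expR s.
  by rewrite -!expRD; congr expR; ring.
have g0 := cn_ge0 (gau b u).
have ess : expR s <= expR (3 * s) by rewrite ler_expR; lra.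
have e31 : 1 <= expR (3 * s) by apply: le_trans ess.
split.
- apply: le_trans main.
  have : cn (gau b u) <= cn (gau b u) * expR (3 * s) by rewrite ler_peMr.
  lra.
- apply: le_trans main; rewrite /dgau cnN !cnM cn_natr -/n.
  have h2 : 2 * n * cn u <= expR (3 * s).
    apply: le_trans ess; apply: le_trans ses; rewrite /s -mulrA mulrCA.
    by rewrite ler_wpM2l //; lra.
  have := ler_wpM2l g0 h2.
  have : 0 <= cn (gau b u) * expR (3 * s) by rewrite mulr_ge0 ?expR_ge0.
  lra.
pose w := - b * (2 * u * h + h ^+ 2).
have -> : gau b (u + h) = gau b u * cexp w.
  by rewrite /gau -cexpD; congr cexp; rewrite /w; ring.
have -> : gau b u * cexp w - gau b u - h * dgau b u =
  gau b u * ((cexp w - 1 - w) - b * h ^+ 2) by rewrite /dgau /w; ring.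
have hw : cn w <= s * cn h.
  have -> : w = - b * h * (2 * u + h) by rewrite /w; ring.
  rewrite !cnM cnN -/n /s -!mulrA ler_wpM2l // mulrC ler_wpM2r ?cn_ge0 //.
  apply: le_trans (cnD _ _) _; rewrite cnM cn_natr; lra.
have hw1 : cn w <= s by apply: le_trans hw _; rewrite ler_piMr.
rewrite cnM; apply: (@le_trans _ _ (cn h ^+ 2 * (5 * (cn (gau b u) * expR (3 * s))))); last first.
  by rewrite ler_wpM2l // exprn_ge0 ?cn_ge0.
have -> : cn h ^+ 2 * (5 * (cn (gau b u) * expR (3 * s))) =
  cn (gau b u) * (4 * (cn h ^+ 2 * expR (3 * s)) + cn h ^+ 2 * expR (3 * s)) by ring.
rewrite ler_wpM2l //; apply: le_trans (cnB _ _) _; apply: lerD.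
  apply: le_trans (cn_cexp_sub1B w) _; rewrite -mulrA ler_pM2l ?ltr0n // e3 mulrA.
  apply: ler_pM; rewrite ?expR_ge0 ?exprn_ge0 ?cn_ge0 ?ler_expR //.
  apply: (@le_trans _ _ ((s * cn h) ^+ 2)); first by rewrite lerXn2r ?nnegrE ?cn_ge0 ?(mulr_ge0 s0 (cn_ge0 h)).
  rewrite exprMn mulrC ler_wpM2l ?exprn_ge0 ?cn_ge0 // expr2.
  by apply: ler_pM.
rewrite cnM cnX mulrC ler_wpM2l ?exprn_ge0 ?cn_ge0 //.
by apply: le_trans ns _; apply: le_trans ses _.
Qed.
End Theta.

Section Theta1.
Variable R : realType.
Local Notation C := R[i].
Implicit Types (b z u h : C).

Definition th b z : C := csum (fun m : int => gau b (z + m%:~R)).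
Definition dth b z : C := csum (fun m : int => dgau b (z + m%:~R)).

Lemma th_summable b z : 0 < Re b -> summable (fun m : int => gau b (z + m%:~R)).
Proof.
move=> b0; have [K K0 hK] := gau_estimates b0 (normr_ge0 (Im z)).
have [|B B0 hB] := @gauss_bounded R (Re b / 2); first by rewrite divr_gt0.
exists (K * B) => X uX; apply: le_trans (ler_wpM2l K0 (hB (Re z) X uX)).
rewrite mulr_sumr; apply: ler_sum => m _.
have [||+ _ _] := hK (z + m%:~R) 0; rewrite ?cn0 // ?ImD ?Im_int ?addr0 //.
by rewrite ReD Re_int [Re z + _]addrC.
Qed.

Lemma dth_summable b z : 0 < Re b -> summable (fun m : int => dgau b (z + m%:~R)).
Proof.
move=> b0; have [K K0 hK] := gau_estimates b0 (normr_ge0 (Im z)).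
have [|B B0 hB] := @gauss_bounded R (Re b / 2); first by rewrite divr_gt0.
exists (K * B) => X uX; apply: le_trans (ler_wpM2l K0 (hB (Re z) X uX)).
rewrite mulr_sumr; apply: ler_sum => m _.
have [||_ + _] := hK (z + m%:~R) 0; rewrite ?cn0 // ?ImD ?Im_int ?addr0 //.
by rewrite ReD Re_int [Re z + _]addrC.
Qed.

Lemma th_has_sum b z : 0 < Re b -> has_sum (fun m : int => gau b (z + m%:~R)) (th b z).
Proof. by move=> b0; apply/summable_has_sum/th_summable. Qed.

Lemma th_estimates b (Y : R) : 0 < Re b -> 0 <= Y -> exists2 K : R, 0 <= K &
  forall u h, `|Im u| <= Y -> cn h <= 1 ->
  cn (th b u) <= K /\ cn (th b (u + h) - th b u - h * dth b u) <= K * cn h ^+ 2.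
Proof.
move=> b0 Y0; have [K K0 hK] := gau_estimates b0 Y0.
have [|B B0 hB] := @gauss_bounded R (Re b / 2); first by rewrite divr_gt0.
exists (K * B); first exact: mulr_ge0.
move=> u h uY h1.
have imm (m : int) : `|Im (u + m%:~R)| <= Y by rewrite ImD Im_int addr0.
have hKm m := hK (u + m%:~R) h (imm m) h1.
have ree (m : int) : Re (u + m%:~R) = m%:~R + Re u by rewrite ReD Re_int addrC.
split.
  apply: has_sum_norm (th_has_sum u b0) _ => X uX.
  apply: le_trans (ler_wpM2l K0 (hB (Re u) X uX)).
  rewrite mulr_sumr; apply: ler_sum => m _.
  by have [+ _ _] := hKm m; rewrite ree.
have hs : has_sum (fun m : int => gau b (u + m%:~R + h) - gau b (u + m%:~R) -
    h * dgau b (u + m%:~R)) (th b (u + h) - th b u - h * dth b u).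
  apply: has_sumD; first apply: has_sumD.
  - by apply: has_sum_ext (th_has_sum (u + h) b0) => m; rewrite addrAC.
  - by apply: has_sumN; exact: th_has_sum.
  by apply/has_sumN/has_sumZ/summable_has_sum/dth_summable.
apply: has_sum_norm hs _ => X uX; rewrite mulrC.
have h2 : 0 <= cn h ^+ 2 by rewrite exprn_ge0 ?cn_ge0.
apply: le_trans (ler_wpM2l h2 (ler_wpM2l K0 (hB (Re u) X uX))).
rewrite !mulr_sumr; apply: ler_sum => m _.
by have [_ _ +] := hKm m; rewrite ree.
Qed.

Lemma th_add1 b z : 0 < Re b -> th b (z + 1) = th b z.
Proof.
move=> b0; apply: csumE.
have := th_has_sum z b0 => hs.
have bij : bijective (fun m : int => m - 1).
  by exists (fun m => m + 1) => m; rewrite ?subrK ?addrK.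
apply: (has_sum_bij bij); apply: has_sum_ext hs => m /=.
by congr gau; rewrite intrD; ring.
Qed.

(** Expanding the square about z + m leaves, besides the stated factor, only exp(- 2 pi i k m) =
    1. *)
Lemma th_quasi b z (k : int) : 0 < Re b ->
  th b (z + 'i * pi%:C * k%:~R / b) =
  cexp ((pi ^+ 2)%:C * k%:~R ^+ 2 / b - tpi R * k%:~R * z) * th b z.
Proof.
move=> b0; apply: csumE.
have bn0 : b != 0 by apply: contraTneq b0 => ->; rewrite ltxx.
apply: has_sum_ext (has_sumZ _ (th_has_sum z b0)) => m.
rewrite /gau -cexpD.
have -> : - b * (z + 'i * pi%:C * k%:~R / b + m%:~R) ^+ 2 =
  ((pi ^+ 2)%:C * k%:~R ^+ 2 / b - tpi R * k%:~R * z - b * (z + m%:~R) ^+ 2) +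
  tpi R * (- (k * m))%:~R.
  have -> : tpi R = 2 * pi%:C * 'i by rewrite /tpi rmorphM rmorph_nat.
  rewrite rmorphN /= intrM rmorphXn /=.
  have ii : 'i * 'i = -1 :> C by rewrite -expr2 sqr_i.
  transitivity (- b * (z + m%:~R) ^+ 2 - 2 * 'i * pi%:C * k%:~R * (z + m%:~R)
    - ('i * 'i) * (pi%:C ^+ 2) * k%:~R ^+ 2 / b); first by field.
  by rewrite ii; field.
by rewrite [RHS]cexpD cexp_tpi_int mulr1 mulNr.
Qed.

(* Riemann sum of the periodic function [th b] over one period *)
Definition RN b N z : C := N%:R^-1 * \sum_(r < N) th b (z + r%:R / N%:R).

Lemma sum_shift (f : C -> C) N z : (0 < N)%N -> (forall w, f (w + 1) = f w) ->
  \sum_(r < N) f (z + N%:R^-1 + r%:R / N%:R) = \sum_(r < N) f (z + r%:R / N%:R).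
Proof.
case: N => // N _ f1; have nz : N.+1%:R != 0 :> C by rewrite pnatr_eq0.
rewrite big_ord_recr [RHS]big_ord_recl /= addrC.
have : N%:R = N.+1%:R - 1 :> C by rewrite -natr1 addrK.
move: (N.+1%:R : C) nz => q nz nq; congr (_ + _).
  by rewrite -[in RHS](f1 (z + _)) nq; congr f; field.
apply: eq_bigr => i _; congr f.
by rewrite /bump /= add1n -[i.+1%:R]natr1; field.
Qed.

(* The discrete average of the derivative of [th b] is small, because [RN b N] is invariant
under translation by 1/N *)
Lemma RN_diff b (Y K : R) N z h : 0 < Re b -> 0 <= K ->
  (forall u h, `|Im u| <= Y -> cn h <= 1 ->
  cn (th b u) <= K /\ cn (th b (u + h) - th b u - h * dth b u) <= K * cn h ^+ 2) ->
  (0 < N)%N -> `|Im z| <= Y -> cn h <= 1 ->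
  cn (RN b N (z + h) - RN b N z) <= cn h * (K / N%:R) + K * cn h ^+ 2.
Proof.
move=> b0 K0 hK N0 zY h1.
have nR : 0 < N%:R :> R by rewrite ltr0n.
have nz : N%:R != 0 :> C by rewrite pnatr_eq0 -lt0n.
have nc : cn (N%:R : C) = N%:R by rewrite cn_natr.
pose zr r := z + r%:R / N%:R : C.
have zrY r : `|Im (zr r)| <= Y.
  suff -> : Im (zr r) = Im z by [].
  rewrite /zr ImD (_ : r%:R / N%:R = (r%:R / N%:R)%:C) ?addr0 //.
  by rewrite rmorphM fmorphV !rmorph_nat.
pose e h r := th b (zr r + h) - th b (zr r) - h * dth b (zr r).
have sume g : cn g <= 1 -> cn (N%:R^-1 * \sum_(r < N) e g r) <= K * cn g ^+ 2.
  move=> g1; rewrite cnM cnV nc ler_pdivrMl // mulr_natl.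
  apply: le_trans (cn_sum _ _ _) _; rewrite -[X in _ *+ X]card_ord -sumr_const.
  by apply: ler_sum => r _; have [] := hK _ _ (zrY r) g1.
pose S := N%:R^-1 * \sum_(r < N) dth b (zr r).
have eqS g : RN b N (z + g) - RN b N z = N%:R^-1 * \sum_(r < N) e g r + g * S.
  rewrite /RN /S -mulrBr -sumrB mulrCA -mulrDr; congr (_ * _).
  rewrite mulr_sumr -big_split; apply: eq_bigr => r _.
  by rewrite /e /zr /= (addrAC z g) subrK.
have cV : cn (N%:R^-1 : C) = N%:R^-1 by rewrite cnV nc.
have hS : cn S <= K / N%:R.
  have iN : cn (N%:R^-1 : C) <= 1 by rewrite cV invf_le1 // ler1n.
  have e0 : RN b N (z + N%:R^-1) - RN b N z = 0.
    apply/eqP; rewrite subr_eq0; apply/eqP; congr (_ * _).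
    by rewrite (sum_shift _ N0) // => w; exact: th_add1.
  have := eqS N%:R^-1; rewrite e0 => /esym/eqP; rewrite addr_eq0 => /eqP es.
  have := sume _ iN; rewrite es cnN cnM cV ler_pdivrMl //.
  rewrite (_ : N%:R * (K * N%:R^-1 ^+ 2) = K / N%:R) //.
  by field; rewrite gt_eqF.
rewrite eqS; apply: le_trans (cnD _ _) _; rewrite addrC; apply: lerD.
  by rewrite cnM ler_wpM2l ?cn_ge0.
exact: sume.
Qed.

(** This stands in for Cauchy's theorem: the mean of a periodic holomorphic function over a period
    does not depend on the height. The segment from 0 to z is cut into N steps of length |z| / N,
    each costing O(1 / N^2) by [RN_diff]. *)
Lemma RN_cst b z : 0 < Re b -> cv0 (fun N => RN b N z - RN b N 0).
Proof.
move=> b0; have [K K0 hK] := th_estimates b0 (normr_ge0 (Im z)).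
apply: (@cv0_lin _ _ (K * cn z + K * cn z ^+ 2)).
have [M zM] : exists M : nat, cn z < M%:R.
  by exists (Num.truncn (cn z)).+1; exact: truncnS_gt.
exists M.+1 => N MN.
have N0 : (0 < N)%N by exact: leq_trans MN.
have nR : 0 < N%:R :> R by rewrite ltr0n.
have nz : N%:R != 0 :> C by rewrite pnatr_eq0 -lt0n.
have cV : cn (N%:R^-1 : C) = N%:R^-1 by rewrite cnV cn_natr.
pose d := cn (z / N%:R) * (K / N%:R) + K * cn (z / N%:R) ^+ 2.
have step j : (j <= N)%N -> cn (RN b N (j%:R / N%:R * z) - RN b N 0) <= j%:R * d.
  elim: j => [|j IH] jN; first by rewrite !mul0r subrr cn0.
  rewrite -[RN b N _](subrK (RN b N (j%:R / N%:R * z))) -addrA.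
  apply: le_trans (cnD _ _) _.
  have -> : j.+1%:R * d = d + j%:R * d by rewrite -natr1 mulrDl mul1r addrC.
  apply: lerD; last by apply: IH; exact: ltnW.
  have -> : j.+1%:R / N%:R * z = j%:R / N%:R * z + z / N%:R.
    by rewrite -natr1; ring.
  apply: (RN_diff b0 K0 hK N0).
    rewrite (_ : j%:R / N%:R = (j%:R / N%:R)%:C); last first.
      by rewrite rmorphM fmorphV !rmorph_nat.
    rewrite Im_real_mul normrM ger0_norm ?divr_ge0 // ler_piMl //.
    by rewrite ler_pdivrMr // mul1r ler_nat ltnW.
  rewrite cnM cV ler_pdivrMr // mul1r; apply/ltW/(lt_trans zM).
  by rewrite ltr_nat.
have := step N (leqnn N); rewrite mulfV // mul1r => h.
apply: le_trans (ler_wpM2r (ltW nR) h) _; rewrite /d cnM cV.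
rewrite le_eqVlt; apply/orP; left; apply/eqP; field; rewrite gt_eqF ?ltr0n //.
Qed.

End Theta1.

Section Poisson1.
Variable R : realType.
Local Notation C := R[i].
Implicit Types (b z u h : C).

Lemma cn_avg_le N (F : 'I_N -> C) (M : R) : (0 < N)%N ->
  (forall r, cn (F r) <= M) -> cn (N%:R^-1 * \sum_(r < N) F r) <= M.
Proof.
move=> N0 hF; rewrite cnM cnV cn_natr ler_pdivrMl ?ltr0n // mulr_natl.
apply: le_trans (cn_sum _ _ _) _; rewrite -[X in _ *+ X]card_ord -sumr_const.
by apply: ler_sum => r _; exact: hF.
Qed.

Lemma cn_unit_sub1_ge (x : R) : `|x| <= 1 / 2 ->
  pi * `|x| <= cn (cexp (tpi R * x%:C) - 1).
Proof.
move=> hx; rewrite cexpE.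
have -> : Re (tpi R * x%:C) = 0 by rewrite /tpi !ReM /=; ring.
have -> : Im (tpi R * x%:C) = 2 * pi * x by rewrite /tpi !ImM /=; ring.
rewrite expR0 mul1r.
have pi0 := pi_gt0 R.
have e : `|2 * pi * x| = 2 * pi * `|x| by rewrite normrM ger0_norm // mulr_ge0 // ltW.
have := @cn_cis_sub1_ge R (2 * pi * x); rewrite e => h.
apply: le_trans (h _); first by lra.
by have := ler_wpM2l (ltW pi0) hx; lra.
Qed.

Lemma unit_root_neq1 N (k : int) : (0 < absz k < N)%N ->
  cexp (tpi R * (k%:~R / N%:R)) != 1.
Proof.
move=> /andP[k0 kN].
have N0 : 0 < N%:R :> R by rewrite ltr0n (leq_trans _ kN).
have nz : N%:R != 0 :> C by rewrite pnatr_eq0 -lt0n (leq_trans _ kN).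
have small (j : int) : (0 < absz j)%N -> ((absz j).*2 <= N)%N ->
    cexp (tpi R * (j%:~R / N%:R)) != 1.
  move=> j0 jN.
  have -> : j%:~R / N%:R = (j%:~R / N%:R)%:C :> C.
    by rewrite rmorphM fmorphV rmorph_nat rmorph_int.
  have an : `|j%:~R / N%:R| = (absz j)%:R / N%:R :> R.
    by rewrite normrM normfV -intr_norm -abszE normr_nat.
  have h := @cn_unit_sub1_ge (j%:~R / N%:R).
  apply: contraTneq isT => e; move: h; rewrite e subrr cn0 an.
  rewrite ler_pdivrMr // mul1r mulrC ler_pdivlMr // -natrM muln2 ler_nat jN.
  move=> /(_ isT); rewrite leNgt => /negP[].
  by rewrite mulr_gt0 ?pi_gt0 ?divr_gt0 // ltr0n.
case: (leqP (absz k).*2 N) => kN2; first exact: small.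
(* For |k| > N / 2 the exponent is replaced by its representative modulo N of size at most N / 2,
   where the lower bound for |exp(i y) - 1| applies. *)
have shift (s : int) : s \in [:: 1; -1] ->
   cexp (tpi R * (k%:~R / N%:R)) = cexp (tpi R * ((k - s * N%:Z)%:~R / N%:R)).
  move=> _; transitivity (cexp (tpi R * (k%:~R / N%:R)) * cexp (tpi R * (- s)%:~R)).
    by rewrite cexp_tpi_int mulr1.
  rewrite -cexpD; congr cexp.
  by rewrite intrB intrM mulrNz -pmulrn; field.
case: (ltrP 0 k) => ks.
  by rewrite (shift 1) //; apply: small; lia.
by rewrite (shift (-1)) //; apply: small; lia.
Qed.

Lemma unit_root_sum N (k : int) : (absz k < N)%N ->
  \sum_(r < N) cexp (tpi R * (k%:~R * (r%:R / N%:R))) = (N * (k == 0))%:R.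
Proof.
move=> kN; case: (eqVneq k 0) => [->|k0].
  under eq_bigr do rewrite mul0r mulr0 cexp0.
  by rewrite sumr_const card_ord muln1.
rewrite muln0; set zt := cexp (tpi R * (k%:~R / N%:R)).
have zt1 : zt != 1 by apply: unit_root_neq1; rewrite kN absz_gt0 k0.
have nz : N%:R != 0 :> C by rewrite pnatr_eq0 -lt0n (leq_trans _ kN).
apply: (@mulfI _ (zt - 1)); first by rewrite subr_eq0.
rewrite mulr0.
have := subrX1 zt N.
have -> : zt ^+ N = 1.
  by rewrite cexpX -[RHS](cexp_tpi_int R k); congr cexp; field.
rewrite subrr => /esym e; rewrite -[RHS]e; congr (_ * _); apply: eq_bigr => r _.
by rewrite cexpX; congr cexp; ring.
Qed.

Definition uav N (k : int) : C :=
  N%:R^-1 * \sum_(r < N) cexp (tpi R * (k%:~R * (r%:R / N%:R))).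

Lemma uavE N (k : int) : (absz k < N)%N -> uav N k = (k == 0)%:R.
Proof.
move=> kN; rewrite /uav unit_root_sum // natrM mulKf //.
by rewrite pnatr_eq0 -lt0n (leq_trans _ kN).
Qed.

Lemma cn_unit (x : R) : cn (cexp (tpi R * x%:C)) = 1.
Proof. by rewrite cn_cexp (_ : Re _ = 0) ?expR0 // /tpi !ReM /=; ring. Qed.

Lemma uav_le1 N (k : int) : (0 < N)%N -> cn (uav N k) <= 1.
Proof.
move=> N0; apply: cn_avg_le => // r.
by rewrite -rc_nat -rc_int -(rc_nat R N) -rcV -!rcM cn_unit.
Qed.

(** The k-th term of the dual side of Poisson summation: the k-th Fourier term of [th b] up to a
    factor independent of k. The parameter of the dual Gaussian is [dl b]. *)
Definition fc b (k : int) z : C :=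
  cexp (- ((pi ^+ 2)%:C * k%:~R ^+ 2 / b) + tpi R * k%:~R * z).

Definition dl b : C := (pi ^+ 2)%:C / b.

Lemma pi_neq0 : (pi%:C : C) != 0.
Proof. by rewrite -cn_eq0 cn_real normr_eq0 gt_eqF ?pi_gt0. Qed.

Lemma Re_inv b : Re b^-1 = Re b / cn b ^+ 2.
Proof. by rewrite sqr_cn; case: b. Qed.

Lemma Re_gt0_neq0 b : 0 < Re b -> b != 0.
Proof. by apply: contraTneq => ->; rewrite ltxx. Qed.

Lemma Re_inv_gt0 b : 0 < Re b -> 0 < Re b^-1.
Proof.
move=> b0; rewrite Re_inv divr_gt0 // exprn_gt0 // cn_gt0.
exact: Re_gt0_neq0.
Qed.

Lemma Re_dl_gt0 b : 0 < Re b -> 0 < Re (dl b).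
Proof.
by move=> b0; rewrite Re_real_mul mulr_gt0 ?Re_inv_gt0 // exprn_gt0 ?pi_gt0.
Qed.

Lemma dlK b : b != 0 -> dl (dl b) = b.
Proof.
move=> bn; rewrite /dl rmorphXn /=.
by move: (pi%:C : C) pi_neq0 => p pn; field; rewrite bn pn.
Qed.

Lemma fc_gau b (k : int) z : b != 0 ->
  fc b k z = cexp (- b * z ^+ 2) * gau (dl b) (- 'i * z * b / pi%:C + k%:~R).
Proof.
move=> bn; rewrite /fc /gau -cexpD; congr cexp.
have -> : tpi R = 2 * pi%:C * 'i by rewrite /tpi rmorphM rmorph_nat.
rewrite /dl rmorphXn /=.
have ii : 'i * 'i = -1 :> C by rewrite -expr2 sqr_i.
move: (pi%:C : C) pi_neq0 => p pn.
transitivity (- b * z ^+ 2 - 'i * 'i * b * z ^+ 2 + 2 * p * 'i * k%:~R * z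
  - p * p / b * k%:~R ^+ 2).
  by rewrite ii; field.
by field; rewrite bn pn.
Qed.

Definition Hs b z : C := csum (fun k : int => fc b k z).

Lemma fc_summable b z : 0 < Re b -> summable (fun k : int => fc b k z).
Proof.
move=> b0; have bn := Re_gt0_neq0 b0.
have := summableZ (cexp (- b * z ^+ 2)) (th_summable (- 'i * z * b / pi%:C) (Re_dl_gt0 b0)).
by apply: summable_le => k; rewrite fc_gau.
Qed.

Lemma Hs_has_sum b z : 0 < Re b -> has_sum (fun k : int => fc b k z) (Hs b z).
Proof. by move=> b0; apply/summable_has_sum/fc_summable. Qed.

Lemma Hs_th b z : 0 < Re b ->
  Hs b z = cexp (- b * z ^+ 2) * th (dl b) (- 'i * z * b / pi%:C).
Proof.
move=> b0; apply: csumE.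
apply: has_sum_ext (has_sumZ _ (th_has_sum _ (Re_dl_gt0 b0))) => k.
by rewrite fc_gau // Re_gt0_neq0.
Qed.

(** The means of [Hs b] over the points r / N tend to its constant Fourier coefficient, which is 1;
    vanishing on the reals would make them 0. *)
Lemma Hs_neq0 b : 0 < Re b -> exists x : R, Hs b x%:C != 0.
Proof.
move=> b0; apply: contrapT => hn.
have H0 (x : R) : Hs b x%:C = 0.
  by apply: contrapT => /eqP hx; apply: hn; exists x.
have /(@cv0_cst R) /eqP : cv0 (fun=> (-1 : C)); last by rewrite oppr_eq0 oner_eq0.
have [B hB] := fc_summable 0 b0.
pose av n (k : int) := uav n.+1 k.
pose f n (k : int) := fc b k 0 * av n k - (k == 0)%:R.
have avE n (k : int) : (absz k < n.+1)%N -> av n k = (k == 0)%:R := @uavE n.+1 k.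
have fc00 : fc b 0 0 = 1.
  by rewrite /fc expr0n /= !mulr0 mul0r oppr0 addr0 cexp0.
apply: (@tannery _ _ f _ (fun k => cn (fc b k 0)) B).
- by move=> k; exact: cn_ge0.
- exact: hB.
- move=> n k; rewrite /f; case: (eqVneq k 0) => [->|k0].
    by rewrite avE //= fc00 mul1r subrr cn0 cn_ge0.
  by rewrite subr0 cnM ler_piMr ?cn_ge0 // uav_le1.
- move=> k e e0; exists (absz k) => n kn; rewrite /f avE ?ltnS //.
  case: (eqVneq k 0) => [->|k0]; first by rewrite fc00 mul1r subrr cn0.
  by rewrite mulr0 subrr cn0.
move=> n; rewrite /f.
have -> : -1 = n.+1%:R^-1 * (\sum_(r < n.+1) Hs b (r%:R / n.+1%:R)) - 1 :> C.
  rewrite big1 ?mulr0 ?sub0r // => r _.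
  by rewrite -(H0 (r%:R / n.+1%:R)) rmorphM fmorphV !rmorph_nat.
apply: has_sumD; last first.
  apply: has_sumN.
  have := @has_sum_finite R _ (fun k : int => (k == 0)%:R) [:: 0] isT.
  by rewrite big_seq1; apply=> k; rewrite inE => /negbTE ->.
have hsr : has_sum (fun k : int => \sum_(r < n.+1) fc b k (r%:R / n.+1%:R))
    (\sum_(r < n.+1) Hs b (r%:R / n.+1%:R)).
  by apply: has_sum_sum => r; exact: Hs_has_sum.
apply: has_sum_ext (has_sumZ _ hsr) => k.
rewrite /av /uav mulrCA; congr (_ * _); rewrite mulr_sumr; apply: eq_bigr => r _.
by rewrite /fc -cexpD; congr cexp; ring.
Qed.

(* Riemann sum for the k-th Fourier coefficient of [th b], times the k-th exponential; by
completing the square it is [fc b k z] times a Riemann sum [RN], so all Fourier coefficients are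
known up to the common factor lim [RN] *)
Definition SN b N (k : int) z : C :=
  N%:R^-1 * \sum_(r < N) (th b (z + r%:R / N%:R) * cexp (- (tpi R * (k%:~R * (r%:R / N%:R))))).

Lemma SN_fc b N (k : int) z : 0 < Re b ->
  SN b N k z = fc b k z * RN b N (z + 'i * pi%:C * k%:~R / b).
Proof.
move=> b0; rewrite /SN /RN mulrCA; congr (_ * _); rewrite mulr_sumr.
apply: eq_bigr => r _; rewrite [z + _ + _]addrAC th_quasi // [RHS]mulrA [LHS]mulrC; congr (_ * _).
by rewrite /fc -cexpD; congr cexp; ring.
Qed.

Lemma SN_shift b N (k : int) z : 0 < Re b -> (0 < N)%N ->
  SN b N k (z + N%:R^-1) = cexp (tpi R * (k%:~R / N%:R)) * SN b N k z.
Proof.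
move=> b0 N0; rewrite !SN_fc // mulrA; congr (_ * _).
  by rewrite /fc -cexpD; congr cexp; ring.
congr (_ * _); rewrite [z + _ + _]addrAC (sum_shift _ N0) // => w.
exact: th_add1.
Qed.

(** Two discrete integrations by parts. A second difference with step 1 / N multiplies [SN] by om^-1
    (om - 1)^2, of modulus at least (3 |k| / N)^2 when 2 |k| <= N, while the second difference of
    [th b] is at most 2 K / N^2. The result is a summable majorant in k, uniform in N. *)
Lemma SN_bound b z (K : R) : 0 < Re b -> 0 <= K ->
  (forall u h, `|Im u| <= `|Im z| -> cn h <= 1 ->
  cn (th b u) <= K /\ cn (th b (u + h) - th b u - h * dth b u) <= K * cn h ^+ 2) ->
  forall N (k : int), (0 < N)%N -> ((absz k).*2 <= N)%N ->
  cn (SN b N k z) <= K * ((absz k).+1%:R ^+ 2)^-1.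
Proof.
move=> b0 K0 hK N k N0 kN.
have nR : 0 < N%:R :> R by rewrite ltr0n.
have nz : N%:R != 0 :> C by rewrite pnatr_eq0 -lt0n.
have cV : cn (N%:R^-1 : C) = N%:R^-1 by rewrite cnV cn_natr.
have realq (r : nat) : r%:R / N%:R = (r%:R / N%:R)%:C :> C.
  by rewrite rmorphM fmorphV !rmorph_nat.
have realk : k%:~R / N%:R = (k%:~R / N%:R)%:C :> C.
  by rewrite rmorphM fmorphV rmorph_nat rmorph_int.
have cun r : cn (cexp (- (tpi R * (k%:~R * (r%:R / N%:R))))) = 1 :> R.
  rewrite cn_cexp (_ : Re _ = 0) ?expR0 // realq ReN.
  rewrite (_ : k%:~R * _ = (k%:~R * (r%:R / N%:R))%:C); last by rewrite !rmorphM rmorph_int.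
  by rewrite /tpi !ReM /=; ring.
have imr (r : nat) : `|Im (z + r%:R / N%:R)| <= `|Im z|.
  by rewrite realq ImD addr0.
have avg (F : nat -> C) (M : R) : (forall r, cn (F r) <= M) ->
   cn (N%:R^-1 * \sum_(r < N) (F r * cexp (- (tpi R * (k%:~R * (r%:R / N%:R)))))) <= M.
  by move=> hF; apply: cn_avg_le => // r; rewrite cnM cun mulr1.
have [k0|k0] := eqVneq k 0.
  rewrite [in X in _ <= X]k0 expr1n invr1 mulr1.
  apply: (avg (fun r => th b (z + r%:R / N%:R))) => r.
  by have [] := hK _ 0 (imr r); rewrite ?cn0.
set om := cexp (tpi R * (k%:~R / N%:R)).
have om0 : om != 0 by exact: cexp_neq0.
have com : cn om = 1.
  rewrite cn_cexp (_ : Re _ = 0) ?expR0 // realk.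
  by rewrite /tpi !ReM /=; ring.
have iN : cn (N%:R^-1 : C) <= 1 by rewrite cV invf_le1 // ler1n.
have e1 : SN b N k (z + N%:R^-1) = om * SN b N k z by exact: SN_shift.
have e2 : SN b N k (z - N%:R^-1) = om^-1 * SN b N k z.
  by rewrite -[in RHS](subrK N%:R^-1 z) SN_shift // mulKf.
have second : cn (SN b N k (z + N%:R^-1) - 2 * SN b N k z + SN b N k (z - N%:R^-1))
    <= 2 * K / N%:R ^+ 2.
  have -> : SN b N k (z + N%:R^-1) - 2 * SN b N k z + SN b N k (z - N%:R^-1) =
    N%:R^-1 * \sum_(r < N) ((th b (z + r%:R / N%:R + N%:R^-1) - 2 * th b (z + r%:R / N%:R)
       + th b (z + r%:R / N%:R - N%:R^-1)) *
       cexp (- (tpi R * (k%:~R * (r%:R / N%:R))))).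
    rewrite /SN mulrCA -mulrBr -mulrDr; congr (_ * _).
    rewrite mulr_sumr -sumrB -big_split; apply: eq_bigr => r _ /=.
    by rewrite (addrAC z N%:R^-1) (addrAC z (- N%:R^-1)); ring.
  apply: (avg (fun r => th b (z + r%:R / N%:R + N%:R^-1) - 2 * th b (z + r%:R / N%:R)
       + th b (z + r%:R / N%:R - N%:R^-1))) => r.
  set u := z + r%:R / N%:R.
  have [_ h1] := hK u _ (imr r) iN.
  have iN' : cn (- (N%:R^-1 : C)) <= 1 by rewrite cnN.
  have [_ h2] := hK u _ (imr r) iN'.
  have -> : th b (u + N%:R^-1) - 2 * th b u + th b (u - N%:R^-1) =
   (th b (u + N%:R^-1) - th b u - N%:R^-1 * dth b u) +
   (th b (u - N%:R^-1) - th b u - - N%:R^-1 * dth b u) by ring.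
  apply: le_trans (cnD _ _) _; apply: le_trans (lerD h1 h2) _.
  rewrite cnN cV exprVn; set q := _ ^-1; lra.
have e3 : SN b N k (z + N%:R^-1) - 2 * SN b N k z + SN b N k (z - N%:R^-1) =
    om^-1 * (om - 1) ^+ 2 * SN b N k z.
  by rewrite e1 e2; field.
have cE : cn (om^-1 * (om - 1) ^+ 2 * SN b N k z) = cn (om - 1) ^+ 2 * cn (SN b N k z).
  by rewrite (cnM (_ * _)) (cnM om^-1) cnV com invr1 mul1r cnX.
move: second; rewrite e3 cE => second.
have an : `|k%:~R / N%:R| = (absz k)%:R / N%:R :> R.
  by rewrite normrM normfV -intr_norm -abszE normr_nat.
have lo : pi * ((absz k)%:R / N%:R) <= cn (om - 1).
  have := @cn_unit_sub1_ge (k%:~R / N%:R); rewrite -realk an; apply.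
  by rewrite ler_pdivrMr // mul1r mulrC ler_pdivlMr // -natrM muln2 ler_nat.
have ka : 1 <= (absz k)%:R :> R by rewrite ler1n absz_gt0.
have lo3 : (3 * ((absz k)%:R / N%:R)) ^+ 2 <= cn (om - 1) ^+ 2.
  have q0 : 0 <= 3 * ((absz k)%:R / N%:R) :> R by rewrite mulr_ge0 ?divr_ge0.
  apply: lerXn2r; rewrite ?nnegrE ?cn_ge0 //.
  by apply: le_trans lo; rewrite ler_wpM2r ?divr_ge0 ?pi_ge3.
have := le_trans (ler_wpM2r (cn_ge0 (SN b N k z)) lo3) second.
rewrite ler_pdivlMr ?exprn_gt0 // => fin.
have {}fin : 9 * (absz k)%:R ^+ 2 * cn (SN b N k z) <= 2 * K.
  apply: le_trans fin; rewrite le_eqVlt; apply/orP; left; apply/eqP.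
  by field; rewrite gt_eqF.
have a2 : (absz k).+1%:R ^+ 2 <= 4 * (absz k)%:R ^+ 2 :> R.
  by rewrite -natr1; move: ((absz k)%:R : R) ka => a a1; nra.
have s0 := cn_ge0 (SN b N k z).
rewrite ler_pdivlMr ?exprn_gt0 ?ltr0n //.
have := ler_wpM2l s0 a2; lra.
Qed.

(** N consecutive integers around 0: a complete residue system modulo N, as discrete Fourier
    inversion requires, with 2 |k| <= N, as [SN_bound] requires. *)
Definition IN N : seq int := [seq (j%:Z - (N./2)%:Z) | j <- iota 0 N].

Lemma IN_uniq N : uniq (IN N).
Proof. by rewrite map_inj_uniq ?iota_uniq // => i j /addIr []. Qed.

Lemma IN_bound N k : k \in IN N -> ((absz k).*2 <= N)%N.
Proof. by move=> /mapP[j]; rewrite mem_iota => /andP[_ jN] ->; lia. Qed.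

Lemma mem_IN N (k : int) : ((absz k).*2 < N)%N -> k \in IN N.
Proof.
move=> kN; apply/mapP; exists (absz (k + (N./2)%:Z)); last by lia.
by rewrite mem_iota; lia.
Qed.

(** Discrete Fourier inversion: summing the characters over a full residue system keeps only the
    sample r = 0. *)
Lemma SN_sum b N z : (0 < N)%N -> \sum_(k <- IN N) SN b N k z = th b z.
Proof.
move=> N0; have nz : N%:R != 0 :> C by rewrite pnatr_eq0 -lt0n.
rewrite /SN -mulr_sumr exchange_big /=.
have E (r : 'I_N) : \sum_(k <- IN N)
   th b (z + r%:R / N%:R) * cexp (- (tpi R * (k%:~R * (r%:R / N%:R)))) =
   th b (z + r%:R / N%:R) * (N * ((r : nat) == 0))%:R.
  rewrite -mulr_sumr; congr (_ * _).
  rewrite big_map (_ : iota 0 N = index_iota 0 N) ?big_mkord; last by rewrite /index_iota subn0.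
  have := @unit_root_sum N (- (r : nat)%:Z).
  rewrite abszN absz_nat ltn_ord => /(_ isT).
  rewrite oppr_eq0 => e.
  transitivity (cexp (tpi R * ((N./2)%:R * (r%:R / N%:R))) * (N * ((r : nat) == 0))%:R).
    rewrite -[RHS]/(_ * (N * (r%:Z == 0))%:R) -e mulr_sumr.
    apply: eq_bigr => j _; rewrite -cexpD; congr cexp.
    by rewrite intrB mulrNz -!pmulrn; ring.
  case: eqP => [->|_]; last by rewrite muln0 mulr0.
  by rewrite mul0r !mulr0 cexp0 mul1r.
rewrite (eq_bigr _ (fun r _ => E r)).
rewrite (bigD1 (Ordinal N0)) //= big1 ?addr0 => [|r r0]; last first.
  rewrite (_ : (r : nat) == 0 = false) ?muln0 ?mulr0 //.
  by apply/negbTE; apply: contraNneq r0 => r0; apply/eqP/val_inj.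
by rewrite mul0r addr0 muln1 mulrCA mulVf ?mulr1.
Qed.

(** Dominated convergence in k. For fixed k, [SN] is [fc b k z] times a Riemann sum at a shifted
    argument, and [RN_cst] moves that argument to 0. *)
Lemma th_limit b z : 0 < Re b ->
  cv0 (fun n => th b z - RN b n.+1 0 * Hs b z).
Proof.
move=> b0; have [K K0 hK] := th_estimates b0 (normr_ge0 (Im z)).
have [K' K'0 hK'] := th_estimates b0 (lexx 0).
have [B hB] := fc_summable z b0.
pose F n (k : int) := if k \in IN n.+1 then SN b n.+1 k z else 0.
pose d (k : int) := K * ((absz k).+1%:R ^+ 2)^-1 + K' * cn (fc b k z).
apply: (@tannery _ _ (fun n k => F n k - RN b n.+1 0 * fc b k z) _ d (K * 4 + K' * B)).
- by move=> k; rewrite addr_ge0 ?mulr_ge0 ?cn_ge0 ?invr_ge0 ?exprn_ge0.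
- move=> X uX; rewrite big_split -!mulr_sumr; apply: lerD; apply: ler_wpM2l => //.
    exact: sum_inv_sqr.
  exact: hB.
- move=> n k; apply: le_trans (cnB _ _) _; apply: lerD.
    rewrite /F; case: ifP => [/IN_bound kN|_]; first exact: SN_bound.
    by rewrite cn0 mulr_ge0 // invr_ge0 exprn_ge0.
  rewrite cnM ler_wpM2r ?cn_ge0 //; apply: cn_avg_le => // r.
  have [||+ _] := hK' (0 + r%:R / n.+1%:R) 0; rewrite ?cn0 //.
  rewrite add0r (_ : r%:R / n.+1%:R = (r%:R / n.+1%:R)%:C) ?normr0 //.
  by rewrite rmorphM fmorphV !rmorph_nat.
- move=> k e e0.
  have /(cv0Z (fc b k z)) := RN_cst (z + 'i * pi%:C * k%:~R / b) b0.
  move=> /(_ e e0) [M hM]; exists (maxn M (absz k).*2) => n; rewrite geq_max => /andP[Mn kn].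
  rewrite /F mem_IN ?ltnS // SN_fc //.
  have := hM n.+1 (leq_trans Mn (leqnSn n)).
  by rewrite mulrBr [RN b n.+1 0 * _]mulrC.
move=> n; apply: has_sumD; last by apply/has_sumN/has_sumZ/Hs_has_sum.
rewrite -(SN_sum b z (ltn0Sn n)).
have -> : \sum_(k <- IN n.+1) SN b n.+1 k z = \sum_(k <- IN n.+1) F n k.
  by rewrite big_seq [RHS]big_seq; apply: eq_bigr => k kI; rewrite /F kI.
by apply: has_sum_finite (IN_uniq _) _ => k /negbTE kI; rewrite /F kI.
Qed.

(** At a point where [Hs b] is nonzero, [th_limit] forces the Riemann sums to converge, and their
    limit is the factor. If it were 0, [th b] would vanish; but since [dl] is an involution, [th b]
    is up to exponentials the dual series of [dl b], which is not identically 0. *)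
Lemma poisson1 b : 0 < Re b -> exists2 kap : C, kap != 0 &
  cv0 (fun n => kap - RN b n.+1 0) /\ forall z, th b z = kap * Hs b z.
Proof.
move=> b0; have [x' hx] := Hs_neq0 b0; set x : C := x'%:C in hx.
have lim : cv0 (fun n => th b x / Hs b x - RN b n.+1 0).
  apply: cv0_le (cv0Z (Hs b x)^-1 (th_limit x b0)) => n.
  by rewrite mulrBr [_^-1 * _]mulrC [_^-1 * (_ * _)]mulrC mulfK.
have P z : th b z = th b x / Hs b x * Hs b z.
  apply/eqP; rewrite -subr_eq0; apply/eqP/(@cv0_cst R).
  apply: cv0_le (cv0D (th_limit z b0) (cv0Z (- Hs b z) lim)) => n.
  suff -> : th b z - th b x / Hs b x * Hs b z = th b z - RN b n.+1 0 * Hs b z +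
    - Hs b z * (th b x / Hs b x - RN b n.+1 0) by [].
  by ring.
exists (th b x / Hs b x); last by [].
have [y] := Hs_neq0 (Re_dl_gt0 b0); rewrite Hs_th ?Re_dl_gt0 // (dlK (Re_gt0_neq0 b0)).
by apply: contraNneq => k0; rewrite P k0 mul0r mulr0.
Qed.

End Poisson1.

(** * The Poisson factor and its scaling *)

Section Kappa.
Variable R : realType.
Local Notation C := R[i].
Implicit Types (b z u h : C).

(* The Poisson factor. Its value sqrt(pi / b) is never needed: it suffices that it does not
vanish and that it scales like the inverse square root *)
Definition kap b : C := xget 0 [set k : C | k != 0 /\
  (cv0 (fun n => k - RN b n.+1 0) /\ forall z, th b z = k * Hs b z)]%classic.

Lemma kapP b : 0 < Re b -> kap b != 0 /\
  (cv0 (fun n => kap b - RN b n.+1 0) /\ forall z, th b z = kap b * Hs b z).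
Proof.
move=> b0; rewrite /kap; apply: (xgetPex 0 (P := [set k : C | k != 0 /\
  (cv0 (fun n => k - RN b n.+1 0) /\ forall z, th b z = k * Hs b z)]%classic)).
by have [k k0 [h1 h2]] := poisson1 b0; exists k.
Qed.

(** The points m + r / N with m integral and 0 <= r < N are exactly the j / N with j integral. *)
Lemma RN_th b N : 0 < Re b -> (0 < N)%N ->
  N%:R * RN b N 0 = th (b / N%:R ^+ 2) 0.
Proof.
move=> b0 N0.
have nz : N%:R != 0 :> C by rewrite pnatr_eq0 -lt0n.
have bN0 : 0 < Re (b / N%:R ^+ 2).
  rewrite (_ : b / N%:R ^+ 2 = (N%:R ^- 2)%:C * b); last first.
    by rewrite fmorphV rmorphXn rmorph_nat mulrC.
  by rewrite Re_real_mul mulr_gt0 // invr_gt0 exprn_gt0 // ltr0n.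
pose g (r : nat) := if (r < N)%N then th b (r%:R / N%:R) else 0.
have h : has_sum g (th (b / N%:R ^+ 2) 0).
  apply: (has_sum_fibers (p := fun j : int => absz (j %% N)%Z) (th_has_sum 0 bN0)) => r.
  rewrite /g; case: (ltnP r N) => rN; last first.
    have := @has_sum_finite R int (fun=> 0) [::] isT; rewrite big_nil => hh.
    apply: has_sum_ext (hh _) => // j; case: eqP => // e.
    by move: rN; rewrite -e; lia.
  apply: (@has_sum_inj _ _ _ (fun m : int => m * N%:Z + r%:Z)).
  - by move=> m m' /addIr h; apply: mulIf h; lia.
  - move=> j hj; case: eqP => // e; have /eqP[] := hj (j %/ N)%Z.
    have NN : N%:Z != 0 by lia.
    by have := divz_eq j N; have := modz_ge0 j NN; lia.
  apply: has_sum_ext (th_has_sum (r%:R / N%:R) b0) => m /=.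
  have -> : absz ((m * N%:Z + r%:Z) %% N)%Z = r.
    by rewrite modzMDl modz_small //; lia.
  rewrite eqxx add0r intrD intrM -!pmulrn /gau; congr cexp; field.
  by rewrite nz.
have h2 : has_sum g (\sum_(r <- iota 0 N) g r).
  apply: has_sum_finite; first exact: iota_uniq.
  by move=> r; rewrite mem_iota add0n leq0n /g /= => /negbTE ->.
rewrite (has_sum_unique h h2).
rewrite /RN mulrA mulfV // mul1r (_ : iota 0 N = index_iota 0 N) ?big_mkord.
  by apply: eq_bigr => r _; rewrite /g ltn_ord add0r.
by rewrite /index_iota subn0.
Qed.

Lemma cv0_unique (u : nat -> C) a c :
  cv0 (fun n => a - u n) -> cv0 (fun n => c - u n) -> a = c.
Proof.
move=> h1 h2; apply/eqP; rewrite -subr_eq0; apply/eqP/(@cv0_cst R).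
apply: cv0_le (cv0D h1 (cv0Z (-1) h2)) => n.
by suff -> : a - c = a - u n + -1 * (c - u n) by []; ring.
Qed.

Lemma cv0_mul (u : nat -> C) (p : nat) : (0 < p)%N ->
  cv0 (fun n => u n.+1) -> cv0 (fun n => u (p * n.+1)%N).
Proof.
move=> p0 h e e0; have [N hN] := h e e0; exists N => n Nn.
have -> : (p * n.+1 = (p * n.+1).-1.+1)%N by rewrite prednK // muln_gt0 p0.
apply: hN; apply: leq_trans Nn _.
by rewrite -ltnS prednK ?muln_gt0 ?p0 // leq_pmull.
Qed.

(* A Riemann sum of exp(-b x^2) with step 1/N depends only on b / N^2, which gives the scaling of
[kap] by squares of rationals; positive reals follow by continuity of theta series *)
Lemma kap_rat b (p q : nat) : 0 < Re b -> (0 < p)%N -> (0 < q)%N ->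
  kap ((p%:R / q%:R) ^+ 2 * b) = q%:R / p%:R * kap b.
Proof.
move=> b0 p0 q0; set b' := _ * b.
have pz : p%:R != 0 :> C by rewrite pnatr_eq0 -lt0n.
have qz : q%:R != 0 :> C by rewrite pnatr_eq0 -lt0n.
have b'0 : 0 < Re b'.
  rewrite /b' (_ : (p%:R / q%:R) ^+ 2 = ((p%:R / q%:R) ^+ 2)%:C); last first.
    by rewrite rmorphXn rmorphM fmorphV !rmorph_nat.
  by rewrite Re_real_mul mulr_gt0 // exprn_gt0 // divr_gt0 // ltr0n.
have [_ [h1 _]] := kapP b0; have [_ [h1' _]] := kapP b'0.
have key n : RN b' (p * n.+1) 0 = q%:R / p%:R * RN b (q * n.+1) 0.
  have nz : n.+1%:R != 0 :> C by rewrite pnatr_eq0.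
  have e1 := @RN_th b' (p * n.+1) b'0 _; have e2 := @RN_th b (q * n.+1) b0 _.
  have e : b' / (p * n.+1)%:R ^+ 2 = b / (q * n.+1)%:R ^+ 2.
    rewrite /b' !natrM; move: (n.+1%:R : C) nz => t tz.
    by field; rewrite qz tz pz.
  move: e1; rewrite muln_gt0 p0 e => /(_ isT); rewrite -e2 ?muln_gt0 ?q0 // !natrM => e3.
  apply: (@mulfI _ (p%:R * n.+1%:R)); first by rewrite mulf_neq0.
  by rewrite e3; move: (n.+1%:R : C) nz => t tz; field.
apply: (@cv0_unique (fun n => RN b' (p * n.+1) 0)).
  exact: (cv0_mul (u := fun n => kap b' - RN b' n 0)) p0 h1'.
have := cv0Z (q%:R / p%:R) (cv0_mul (u := fun n => kap b - RN b n 0) q0 h1).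
by apply: cv0_le => n; rewrite key mulrBr.
Qed.

Lemma cexp_cvg (w : nat -> C) w0 : cv0 (fun n => w n - w0) ->
  cv0 (fun n => cexp (w n) - cexp w0).
Proof.
move=> h e e0.
pose K := expR (Re w0) * (3 * expR 1).
have K0 : 0 < K by rewrite !mulr_gt0 ?expR_gt0.
have m0 : 0 < Num.min 1 (e / K) by rewrite lt_min ltr01 divr_gt0.
have [N hN] := h _ m0; exists N => n /hN; rewrite lt_min => /andP[h1 h2].
have -> : cexp (w n) - cexp w0 = cexp w0 * (cexp (w n - w0) - 1).
  by rewrite mulrBr -cexpD mulr1; congr (cexp _ - _); ring.
rewrite cnM cn_cexp.
apply: (@le_lt_trans _ _ (expR (Re w0) * (3 * cn (w n - w0) * expR 1))).
  rewrite ler_wpM2l ?expR_ge0 //; apply: le_trans (cn_cexp_sub1 _) _.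
  by rewrite ler_wpM2l ?mulr_ge0 ?cn_ge0 // ler_expR ltW.
move: h2; rewrite ltr_pdivlMr // /K; set x := cn _; lra.
Qed.

Lemma series_cvg (w : nat -> int -> C) (w0 : int -> C) (S : nat -> C) S0 (c x : R) :
  0 < c -> (forall n (m : int), Re (w n m) <= - c * (m%:~R + x) ^+ 2) ->
  (forall (m : int), Re (w0 m) <= - c * (m%:~R + x) ^+ 2) ->
  (forall m, cv0 (fun n => w n m - w0 m)) ->
  (forall n, has_sum (fun m => cexp (w n m)) (S n)) ->
  has_sum (fun m => cexp (w0 m)) S0 -> cv0 (fun n => S n - S0).
Proof.
move=> c0 hw hw0 hc hS hS0.
have [B B0 hB] := gauss_bounded c0.
apply: (@tannery _ _ (fun n m => cexp (w n m) - cexp (w0 m)) _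
  (fun m : int => 2 * expR (- c * (m%:~R + x) ^+ 2)) (2 * B)).
- by move=> m; rewrite mulr_ge0 ?expR_ge0.
- by move=> X uX; rewrite -mulr_sumr ler_wpM2l // hB.
- move=> n m; apply: le_trans (cnB _ _) _; rewrite !cn_cexp mulr_natl mulr2n.
  by apply: lerD; rewrite ler_expR.
- by move=> m; exact: cexp_cvg.
by move=> n; apply: has_sumD (hS n) (has_sumN hS0).
Qed.

Lemma le_sqr_ge0 (x y : R) : 0 <= x -> x <= y -> x ^+ 2 <= y ^+ 2.
Proof. by move=> x0 xy; rewrite lerXn2r ?nnegrE // (le_trans x0). Qed.

Lemma kap_scale b (al : R) : 0 < Re b -> 0 < al ->
  kap (al%:C * b) = kap b / (Num.sqrt al)%:C.
Proof.
move=> b0 al0; set s := Num.sqrt al.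
have s0 : 0 < s by rewrite sqrtr_gt0.
have s2 : s ^+ 2 = al by rewrite sqr_sqrtr // ltW.
have ba0 : 0 < Re (al%:C * b) by rewrite Re_real_mul mulr_gt0.
(* A rational within 1/(n+1) of sqrt al, taken from above so that the exponents of all the Gaussians
   decay at least at the rate al Re b; the upper bound s + 1 does the same for the dual series. *)
pose p n := (Num.truncn (s * n.+1%:R)).+1.
pose rho n : R := (p n)%:R / n.+1%:R.
have n1 n : 0 < n.+1%:R :> R by rewrite ltr0n.
have rho_gt n : s < rho n by rewrite /rho ltr_pdivlMr // truncnS_gt.
have rho_le n : rho n <= s + n.+1%:R^-1.
  rewrite /rho ler_pdivrMr // mulrDl mulVf ?gt_eqF // /p -natr1 lerD2r.
  by rewrite truncn_le mulr_ge0 ?ltW.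
have rho0 n : 0 < rho n by exact: lt_trans (rho_gt n).
have rhoC n : (rho n)%:C = (p n)%:R / n.+1%:R :> C.
  by rewrite rmorphM fmorphV !rmorph_nat.
pose bn n := (rho n ^+ 2)%:C * b.
have bn0 n : 0 < Re (bn n) by rewrite Re_real_mul mulr_gt0 // exprn_gt0.
have kbn n : kap (bn n) = kap b / (rho n)%:C.
  rewrite /bn rmorphXn /= rhoC kap_rat // invf_div mulrC //.
have rho2 n : al <= rho n ^+ 2.
  by rewrite -s2 lerXn2r ?nnegrE ?ltW.
have inv1 n : n.+1%:R^-1 <= 1 :> R by rewrite invf_le1 // ler1n.
have rho2u n : rho n ^+ 2 - al <= (2 * s + 1) * n.+1%:R^-1.
  rewrite -s2 subr_sqr mulrC; apply: ler_pM.
  - by rewrite addr_ge0 ?ltW.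
  - by rewrite subr_ge0 ltW.
  - have := rho_le n; have := inv1 n.
    by move: (n.+1%:R^-1) (rho n) => i r; lra.
  by have := rho_le n; move: (n.+1%:R^-1) (rho n) => i r; lra.
have cvr (F : nat -> C) K : (forall n, cn (F n) <= K * n.+1%:R^-1) -> cv0 F.
  move=> hF; apply: (@cv0_lin _ _ K); exists 0%N => n _.
  apply: le_trans (ler_wpM2r (ler0n _ n) (hF n)) _.
  have K0 : 0 <= K.
    by have := le_trans (cn_ge0 _) (hF 0%N); rewrite invr1 mulr1.
  rewrite -mulrA ler_piMr // mulrC ler_pdivrMr // mul1r ler_nat //.
(* The scaling is read off at one point x, where the dual series can be cancelled. *)
have [x hx] := Hs_neq0 ba0.
have xm (m : int) : x%:C + m%:~R = (m%:~R + x)%:C by rewrite rmorphD rmorph_int addrC.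
have cth : cv0 (fun n => th (bn n) x%:C - th (al%:C * b) x%:C).
  apply: (@series_cvg (fun n m => - bn n * (x%:C + m%:~R) ^+ 2)
    (fun m => - (al%:C * b) * (x%:C + m%:~R) ^+ 2) _ _ (Re b * al) x).
  - by rewrite mulr_gt0.
  - move=> n m; rewrite xm -rmorphXn mulrC Re_real_mul ReN /bn Re_real_mul.
    rewrite [X in _ <= X]mulrC; apply: ler_wpM2l; first exact: sqr_ge0.
    by rewrite lerN2 [X in X <= _]mulrC; apply: ler_wpM2r; first exact: ltW.
  - move=> m; rewrite xm -rmorphXn mulrC Re_real_mul ReN Re_real_mul.
    by rewrite [X in _ <= X]mulrC [al * _]mulrC.
  - move=> m; apply: (cvr _ ((2 * s + 1) * cn (b * (x%:C + m%:~R) ^+ 2))) => n.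
    have -> : - bn n * (x%:C + m%:~R) ^+ 2 - - (al%:C * b) * (x%:C + m%:~R) ^+ 2 =
      (al - rho n ^+ 2)%:C * (b * (x%:C + m%:~R) ^+ 2) by rewrite /bn rmorphB /=; ring.
    rewrite cnM cn_real distrC ger0_norm ?subr_ge0 // mulrAC.
    by rewrite ler_wpM2r ?cn_ge0.
  - by move=> n; exact: th_has_sum.
  exact: th_has_sum.
pose c := pi ^+ 2 * Re b^-1 / (s + 1) ^+ 2.
have Rib := Re_inv_gt0 b0.
have s10 : 0 < s + 1 by rewrite addr_gt0.
have fcre (t : R) (m : int) : 0 < t -> t <= (s + 1) ^+ 2 ->
   Re (- ((pi ^+ 2)%:C * m%:~R ^+ 2 / (t%:C * b)) + tpi R * m%:~R * x%:C) <=
   - c * (m%:~R + 0) ^+ 2.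
  move=> t0 t1; rewrite addr0.
  have -> : - ((pi ^+ 2)%:C * m%:~R ^+ 2 / (t%:C * b)) + tpi R * m%:~R * x%:C =
    (- (pi ^+ 2 * m%:~R ^+ 2 / t))%:C * b^-1 + (2 * pi * m%:~R * x)%:C * 'i.
    have mC : m%:~R = (m%:~R)%:C :> C by rewrite rmorph_int.
    by rewrite invfM rmorphN fmorph_div mC /tpi; ring.
  rewrite ReD !Re_real_mul mulr0 addr0 !mulNr lerN2 /c.
  have -> : pi ^+ 2 * Re b^-1 / (s + 1) ^+ 2 * m%:~R ^+ 2 =
    pi ^+ 2 * m%:~R ^+ 2 * Re b^-1 / (s + 1) ^+ 2 by ring.
  rewrite [X in _ <= X]mulrAC; apply: ler_wpM2l.
    by apply: mulr_ge0 (ltW Rib); apply: mulr_ge0; exact: sqr_ge0.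
  by rewrite lef_pV2 // posrE exprn_gt0.
have cHs : cv0 (fun n => Hs (bn n) x%:C - Hs (al%:C * b) x%:C).
  apply: (@series_cvg
    (fun n m => - ((pi ^+ 2)%:C * m%:~R ^+ 2 / bn n) + tpi R * m%:~R * x%:C)
    (fun m => - ((pi ^+ 2)%:C * m%:~R ^+ 2 / (al%:C * b)) + tpi R * m%:~R * x%:C) _ _ c 0).
  - by rewrite divr_gt0 ?exprn_gt0 // mulr_gt0 // exprn_gt0 ?pi_gt0.
  - move=> n m; apply: fcre; first by rewrite exprn_gt0.
    apply: le_sqr_ge0; first exact: ltW.
    by apply: le_trans (rho_le n) _; rewrite lerD2l.
  - move=> m; apply: fcre => //; rewrite -s2; apply: le_sqr_ge0; first exact: ltW.
    by rewrite lerDl.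
  - move=> m; pose D := (pi ^+ 2)%:C * m%:~R ^+ 2 / b : C.
    apply: (cvr _ ((2 * s + 1) * (al ^- 2 * cn D))) => n.
    have bz := Re_gt0_neq0 b0.
    have rz : (rho n)%:C != 0 :> C by rewrite -cn_eq0 cn_real normr_eq0 gt_eqF.
    have az : al%:C != 0 :> C by rewrite -cn_eq0 cn_real normr_eq0 gt_eqF.
    have -> : - ((pi ^+ 2)%:C * m%:~R ^+ 2 / bn n) + tpi R * m%:~R * x%:C -
       (- ((pi ^+ 2)%:C * m%:~R ^+ 2 / (al%:C * b)) + tpi R * m%:~R * x%:C) =
       ((rho n ^+ 2 - al) / (rho n ^+ 2 * al))%:C * D.
      rewrite /bn /D; move: ((pi ^+ 2)%:C : C) (tpi R) => P T.
      rewrite rcM rcV rcB rcM !rcX.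
      by move: ((rho n)%:C) (al%:C) rz az => r a rz az; field; rewrite bz rz az.
    rewrite cnM cn_real normrM normfV ger0_norm ?subr_ge0 //.
    rewrite ger0_norm; last by rewrite mulr_ge0 ?exprn_ge0 ?ltW.
    rewrite mulrA -[X in _ <= X]mulrA [X in _ <= _ * X]mulrC mulrA.
    rewrite ler_wpM2r ?cn_ge0 //.
    rewrite -[X in _ <= X]mulrAC; apply: ler_pM => //.
    + by rewrite subr_ge0.
    + by rewrite invr_ge0 mulr_ge0 ?exprn_ge0 ?ltW.
    have h1 : 0 < rho n ^+ 2 * al by rewrite mulr_gt0 ?exprn_gt0.
    have h2 : 0 < al ^+ 2 by exact: exprn_gt0.
    by rewrite lef_pV2 ?posrE // [al ^+ 2]expr2 ler_wpM2r // (ltW al0).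
  - by move=> n; exact: Hs_has_sum.
  exact: Hs_has_sum.
have [_ [_ P]] := kapP ba0.
apply: (@mulIf _ (Hs (al%:C * b) x%:C)) => //; rewrite -P.
apply/eqP; rewrite -subr_eq0; apply/eqP/(@cv0_cst R).
have sz : s%:C != 0 :> C by rewrite -cn_eq0 cn_real normr_eq0 gt_eqF.
have cinv : cv0 (fun n => (rho n)%:C^-1 - s%:C^-1).
  apply: (cvr _ (s ^- 2)) => n; rewrite -!fmorphV -rmorphB cn_real distrC.
  have e : s^-1 - (rho n)^-1 = (rho n - s) / (rho n * s).
    by field; rewrite !gt_eqF.
  rewrite e ger0_norm; last first.
    by apply: divr_ge0; [rewrite subr_ge0 ltW|apply: mulr_ge0; exact: ltW].
  rewrite mulrC; apply: ler_pM.
  - by rewrite invr_ge0 mulr_ge0 // ltW.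
  - by rewrite subr_ge0 ltW.
  - have h1 : 0 < rho n * s by rewrite mulr_gt0.
    have h2 : 0 < s ^+ 2 by exact: exprn_gt0.
    by rewrite lef_pV2 ?posrE // [s ^+ 2]expr2 ler_wpM2r // ltW.
  by have := rho_le n; move: (n.+1%:R^-1) (rho n) => i r; lra.
have t2 : cv0 (fun n => kap b / (rho n)%:C * (Hs (bn n) x%:C - Hs (al%:C * b) x%:C)).
  apply: cv0_le (cv0Z (kap b / s%:C) cHs) => n; rewrite !cnM ler_wpM2r ?cn_ge0 //.
  rewrite ler_wpM2l ?cn_ge0 // !cnV !cn_real !gtr0_norm //.
  by rewrite lef_pV2 ?posrE // ltW.
apply: cv0_le (cv0D (cv0Z (-1) cth) (cv0D t2 (cv0Z (kap b * Hs (al%:C * b) x%:C) cinv))) => n.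
have [_ [_ /(_ x%:C) Pn]] := kapP (bn0 n).
suff -> : th (al%:C * b) x%:C - kap b / s%:C * Hs (al%:C * b) x%:C =
  -1 * (th (bn n) x%:C - th (al%:C * b) x%:C) +
  (kap b / (rho n)%:C * (Hs (bn n) x%:C - Hs (al%:C * b) x%:C) +
  kap b * Hs (al%:C * b) x%:C * ((rho n)%:C^-1 - s%:C^-1)) by [].
by rewrite Pn kbn; ring.
Qed.

End Kappa.

(** * Poisson summation for positive definite forms *)

Section QuadraticForms.
Variable K : comNzRingType.

Definition dotr n (u v : 'rV[K]_n) : K := (u *m v^T) 0 0.
Definition qf n (G : 'M[K]_n) (v : 'rV[K]_n) : K := (v *m G *m v^T) 0 0.

Lemma dotrC n (u v : 'rV[K]_n) : dotr u v = dotr v u.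
Proof. by rewrite /dotr -[u *m _]trmxK trmx_mul trmxK mxE. Qed.

Lemma dotrDl n (u v w : 'rV[K]_n) : dotr (u + v) w = dotr u w + dotr v w.
Proof. by rewrite /dotr mulmxDl mxE. Qed.

Lemma dotrZl n a (u v : 'rV[K]_n) : dotr (a *: u) v = a * dotr u v.
Proof. by rewrite /dotr -scalemxAl mxE. Qed.

Lemma dotrNl n (u v : 'rV[K]_n) : dotr (- u) v = - dotr u v.
Proof. by rewrite -scaleN1r dotrZl mulN1r. Qed.

Lemma qfD n (G : 'M[K]_n) (u v : 'rV[K]_n) : G^T = G ->
  qf G (u + v) = qf G u + qf G v + 2 * dotr (u *m G) v.
Proof.
move=> symG; have sw : dotr u (v *m G) = dotr (u *m G) v.
  by rewrite /dotr trmx_mul symG mulmxA.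
rewrite -[LHS]/(dotr (_ *m _) _) mulmxDl dotrDl ![dotr _ (u + v)]dotrC !dotrDl.
rewrite sw [dotr v (u *m G)]dotrC [dotr u (u *m G)]dotrC [dotr v (v *m G)]dotrC.
by rewrite -[dotr (u *m G) u]/(qf G u) -[dotr (v *m G) v]/(qf G v); ring.
Qed.

Lemma qfZ n (G : 'M[K]_n) a (v : 'rV[K]_n) : qf G (a *: v) = a ^+ 2 * qf G v.
Proof.
by rewrite -[LHS]/(dotr (_ *m _) _) -scalemxAl dotrZl dotrC dotrZl dotrC mulrA.
Qed.

Lemma dotr_row n (s s' : K) (t t' : 'rV[K]_n) :
  dotr (row_mx s%:M t) (row_mx s'%:M t') = s * s' + dotr t t'.
Proof.
rewrite /dotr tr_row_mx mul_row_col mxE tr_scalar_mx mul_scalar_mx.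
by rewrite !mxE eqxx mulr1n.
Qed.

Lemma qf_block n a (be : 'rV[K]_n) (G : 'M[K]_n) (s : K) (t : 'rV[K]_n) :
  qf (block_mx a%:M be be^T G) (row_mx s%:M t) =
  a * s ^+ 2 + 2 * s * dotr be t + qf G t.
Proof.
rewrite /qf mul_row_block tr_row_mx mul_row_col mxE tr_scalar_mx.
rewrite !mul_scalar_mx mul_mx_scalar !mulmxDl.
have -> (M : 'M[K]_1) : (s *: M) 0 0 = s * M 0 0 by rewrite mxE.
have eD (M N : 'M[K]_1) : (M + N) 0 0 = M 0 0 + N 0 0 by rewrite mxE.
rewrite !eD -/(dotr t be) dotrC -scalemxAl.
have -> : (s *: (be *m t^T)) 0 0 = s * dotr be t by rewrite mxE.
have -> : (s *: a%:M : 'M[K]_1) 0 0 = s * a by rewrite !mxE eqxx mulr1n.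
by ring.
Qed.

Lemma qf_schur n a (be : 'rV[K]_n) (G : 'M[K]_n) (t : 'rV[K]_n) :
  qf (G + a *: (be^T *m be)) t = qf G t + a * dotr be t ^+ 2.
Proof.
rewrite /qf mulmxDr mulmxDl mxE; congr (_ + _).
rewrite -scalemxAr -scalemxAl mxE; congr (_ * _).
rewrite (mulmxA t) -(mulmxA (t *m be^T)) mxE big_ord1 expr2; congr (_ * _).
exact: dotrC.
Qed.

End QuadraticForms.

Section PoissonN.
Variable R : realType.
Local Notation C := R[i].

Definition posdef n (G : 'M[R]_n) := forall v, v != 0 -> 0 < qf G v.

Definition zr n (m : 'rV[int]_n) : 'rV[R]_n := map_mx intr m.

Lemma qf_ge0 n (G : 'M[R]_n) v : posdef G -> 0 <= qf G v.
Proof.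
move=> pG; have [->|v0] := eqVneq v 0; last exact/ltW/pG.
by rewrite /qf !mul0mx mxE.
Qed.

Section Block.
Variables (n : nat) (G : 'M[R]_(1 + n)).
Hypotheses (symG : G^T = G) (pG : posdef G).
Let a := G 0 0.
Let be := ursubmx G.
Let G2 := drsubmx G.
Let Gs := G2 - a^-1 *: (be^T *m be).

Lemma block_decomp : G = block_mx a%:M be be^T G2.
Proof.
rewrite -[LHS]submxK; congr block_mx.
  by rewrite [LHS]mx11_scalar; congr (_%:M); rewrite !mxE; congr (G _ _); exact/val_inj.
by rewrite /be trmx_ursub symG.
Qed.

Lemma block_pos : 0 < a.
Proof.
have := pG (v := row_mx 1%:M 0); rewrite block_decomp qf_block.
rewrite expr1n mulr1 dotrC /dotr mul0mx mxE mulr0 addr0 /qf !mul0mx mxE addr0; apply.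
apply/eqP => /(congr1 (fun M => lsubmx M 0 0)); rewrite row_mxKl !mxE eqxx.
by move/eqP; rewrite oner_eq0.
Qed.

Lemma schur_sym : Gs^T = Gs.
Proof.
rewrite /Gs linearB /= linearZ /= trmx_mul trmxK; congr (_ - _).
by rewrite /G2 trmx_drsub symG.
Qed.

(** Completing the square in the first coordinate, which reduces sums over Z^(n+1) to a one-variable
    sum and a sum for the Schur complement. *)
Lemma qf_schur_block s t :
  qf G (row_mx s%:M t) = a * (s + a^-1 * dotr be t) ^+ 2 + qf Gs t.
Proof.
rewrite block_decomp qf_block /Gs -scaleNr qf_schur.
have := block_pos; move: (a) => a' a0; field; exact: lt0r_neq0.
Qed.

Lemma schur_posdef : posdef Gs.
Proof.
move=> t t0.
have := @pG (row_mx (- (a^-1 * dotr be t))%:M t).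
rewrite qf_schur_block addNr expr0n mulr0 add0r; apply.
by apply: contraNneq t0 => /(congr1 rsubmx); rewrite row_mxKr linear0 => ->.
Qed.

(** The inverse of G in terms of the inverse Gs' of its Schur complement. The lower right block is
    Gs' itself, so the dual form splits over the same coordinates, with the shift now in the last n
    of them ([qf_block_inv]). *)
Definition block_inv (Gs' : 'M[R]_n) : 'M[R]_(1 + n) :=
  block_mx (a^-1 + a^-1 ^+ 2 * qf Gs' be)%:M (- a^-1 *: (be *m Gs'))
           (- a^-1 *: (be *m Gs'))^T Gs'.

Lemma block_invP (Gs' : 'M[R]_n) : Gs'^T = Gs' -> Gs *m Gs' = 1%:M ->
  G *m block_inv Gs' = 1%:M.
Proof.
move=> sG' GG'; have a0 := lt0r_neq0 block_pos.
have e2 : G2 = Gs + a^-1 *: (be^T *m be) by rewrite subrK.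
rewrite block_decomp /block_inv mulmx_block (scalar_mx_block 1 n 1).
rewrite linearZ /= trmx_mul sG'.
have eq1 : be *m (Gs' *m be^T) = (qf Gs' be)%:M by rewrite mulmxA [LHS]mx11_scalar.
congr block_mx.
- rewrite -scalar_mxM -scalemxAr eq1 scale_scalar_mx -raddfD /=; congr (_%:M).
  by move: (qf _ _) => q; field.
- by rewrite mul_scalar_mx scalerA mulrN mulfV // scaleN1r addNr.
- rewrite e2 -scalemxAr mulmxDl mulmxA GG' mul1mx -scalemxAl -mulmxA eq1.
  rewrite !mul_mx_scalar !scalerDr !scalerA -!scalerDl.
  rewrite (_ : _ + _ = 0) ?scale0r //.
  by move: (qf _ _) => q; field.
rewrite e2 mulmxDl GG' -scalemxAr -scalemxAl mulmxA scaleNr addrC -addrA subrr addr0 //.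
Qed.

Lemma qf_block_inv (Gs' : 'M[R]_n) s t : Gs'^T = Gs' ->
  qf (block_inv Gs') (row_mx s%:M t) = s ^+ 2 / a + qf Gs' (t - (s / a) *: be).
Proof.
move=> sG'; rewrite qf_block.
have e1 : dotr (t *m Gs') be = dotr (be *m Gs') t.
  by rewrite dotrC /dotr trmx_mul sG' mulmxA.
have e3 : qf Gs' (t - (s / a) *: be) =
    qf Gs' t - 2 * (s / a) * dotr (be *m Gs') t + (s / a) ^+ 2 * qf Gs' be.
  rewrite -[LHS]/(dotr (_ *m _) _) mulmxBl -scalemxAl dotrDl dotrNl dotrZl.
  rewrite ![dotr _ (t - _)]dotrC !dotrDl !dotrNl !dotrZl ![dotr _ (_ *m _)]dotrC.
  by rewrite e1 -[dotr _ _]/(qf Gs' t) -[dotr (be *m Gs') be]/(qf Gs' be); ring.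
rewrite e3 dotrZl.
have a0 := lt0r_neq0 block_pos.
by move: (qf _ be) (qf _ t) (dotr _ t) => q1 q2 q3; field.
Qed.

End Block.
End PoissonN.

Section PoissonSummation.
Variable R : realType.
Local Notation C := R[i].

(** The first coordinate is placed second in the pair: [has_sum_pair] then sums over it while the
    other coordinates stay fixed. *)
Definition ipair n (p : 'rV[int]_n * int) : 'rV[int]_(1 + n) := row_mx (p.2)%:M p.1.

Lemma ipair_bij n : bijective (@ipair n).
Proof.
exists (fun v => (rsubmx v, lsubmx v 0 0)) => [[m k]|v].
  by rewrite /ipair row_mxKr row_mxKl mxE eqxx mulr1n.
by rewrite /ipair /= -mx11_scalar hsubmxK.
Qed.

Lemma row_decomp n (v : 'rV[R]_(1 + n)) :
  v = row_mx (lsubmx v 0 0)%:M (rsubmx v).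
Proof. by rewrite -mx11_scalar hsubmxK. Qed.

Lemma zr_ipair n (m : 'rV[int]_n) k (x : R) (x' : 'rV[R]_n) :
  zr R (ipair (m, k)) + row_mx x%:M x' = row_mx (k%:~R + x)%:M (zr R m + x').
Proof. by rewrite /zr /ipair map_row_mx map_scalar_mx add_row_mx -raddfD. Qed.

Lemma gaussN_bounded n (G : 'M[R]_n) (c : R) : G^T = G -> posdef G -> 0 < c ->
  exists2 B : R, 0 <= B & forall (x : 'rV[R]_n) (X : seq 'rV[int]_n), uniq X ->
    \sum_(m <- X) expR (- c * qf G (zr R m + x)) <= B.
Proof.
elim: n G => [|n IH] G symG pG c0.
  exists 1 => // x [|m [|m' X]] //=; first by rewrite big_nil.
    by rewrite big_seq1 -expR0 ler_expR mulNr oppr_le0 mulr_ge0 ?qf_ge0 // ltW.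
  by rewrite (thinmx0 m) (thinmx0 m') inE eqxx.
change 'M[R]_(1 + n) in G.
have a0 := block_pos symG pG.
have [B1 B10 hB1] := gauss_bounded (mulr_gt0 c0 a0).
have [B2 B20 hB2] := IH _ (schur_sym symG) (schur_posdef symG pG) c0.
exists (B1 * B2); first exact: mulr_ge0.
move=> x X uX; change 'rV[R]_(1 + n) in x.
have [g hg gh] := ipair_bij n.
have -> : X = map (@ipair n) (map g X) by rewrite mapK.
rewrite big_map; set Gs := (_ - _) in hB2.
apply: (@sum_pair_le _ _ _ (fun p => expR (- c * qf G (zr R (ipair p) + x)))
  (fun m => B1 * expR (- c * qf Gs (zr R m + rsubmx x)))).
- by move=> p; exact: expR_ge0.
- move=> m Y uY.
  pose d := (G 0 0)^-1 * dotr (ursubmx G) (zr R m + rsubmx x).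
  have := hB1 (lsubmx x 0 0 + d) Y uY.
  move/(ler_wpM2r (expR_ge0 (- c * qf Gs (zr R m + rsubmx x)))).
  apply: le_trans; rewrite mulr_suml; apply: ler_sum => k _.
  rewrite -expRD ler_expR [x in qf G (_ + x)]row_decomp zr_ipair qf_schur_block //.
  by rewrite -/Gs -/d addrA; lra.
- by move=> Y uY; rewrite -mulr_sumr ler_wpM2l // hB2.
by rewrite map_inj_uniq //; exact: can_inj gh.
Qed.

Lemma zr_ipair0 n (m : 'rV[int]_n) k : zr R (ipair (m, k)) = row_mx (k%:~R)%:M (zr R m).
Proof. by rewrite /zr /ipair map_row_mx map_scalar_mx. Qed.

(** Here q is the value of a quadratic form and l the phase of a character. The modulus does not
    depend on l, so summability always reduces to Gaussian sums. *)
Definition pterm (b : C) (q l : R) : C := cexp (- b * q%:C + tpi R * l%:C).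

Lemma cn_pterm b q l : cn (pterm b q l) = expR (- Re b * q).
Proof.
rewrite cn_cexp ReD (_ : Re (tpi R * _) = 0) ?addr0.
  by rewrite mulrC Re_real_mul ReN mulrC.
by rewrite /tpi !ReM /=; ring.
Qed.

Lemma pterm_summable n (G : 'M[R]_n) b x (l : 'rV[int]_n -> R) :
  G^T = G -> posdef G -> 0 < Re b ->
  summable (fun m => pterm b (qf G (zr R m + x)) (l m)).
Proof.
move=> symG pG b0; have [B _ hB] := gaussN_bounded symG pG b0.
by exists B => X uX; under eq_bigr do rewrite cn_pterm; exact: hB.
Qed.

Lemma pterm1_summable (b : C) (a y : R) (l : int -> R) : 0 < Re b -> 0 < a ->
  summable (fun k : int => pterm b ((k%:~R - y) ^+ 2 / a) (l k)).
Proof.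
move=> b0 a0; have [B _ hB] := gauss_bounded (divr_gt0 b0 a0).
exists B => X uX; apply: le_trans (hB (- y) X uX); apply: ler_sum => k _.
by rewrite cn_pterm ler_expR; rewrite [_ / a]mulrC mulrA mulNr.
Qed.

Lemma poisson1y (b : C) (a x y : R) : 0 < Re b -> 0 < a ->
  has_sum (fun m : int => pterm b (a * (m%:~R + x) ^+ 2) (y * (m%:~R + x)))
   (kap b / (Num.sqrt a)%:C *
    csum (fun k : int => pterm (dl b) ((k%:~R - y) ^+ 2 / a) (k%:~R * x))).
Proof.
move=> b0 a0; pose b' := a%:C * b.
have b'0 : 0 < Re b' by rewrite Re_real_mul mulr_gt0.
have bz := Re_gt0_neq0 b0.
have az : a%:C != 0 :> C by rewrite -cn_eq0 cn_real normr_eq0 gt_eqF.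
(* Completing the square turns the character of frequency y into a complex translation of the
   argument. *)
pose X : C := x%:C - 'i * pi%:C * y%:C / b'.
have ii : 'i * 'i = -1 :> C by rewrite -expr2 sqr_i.
have tE : tpi R = 2 * pi%:C * 'i by rewrite /tpi rcM rc_nat.
have hs2 : has_sum (fun k : int => pterm (dl b) ((k%:~R - y) ^+ 2 / a) (k%:~R * x))
    (cexp (- (pi ^+ 2)%:C * y%:C ^+ 2 / b') * Hs b' X).
  apply: has_sum_ext (has_sumZ _ (Hs_has_sum X b'0)) => k.
  rewrite /fc /pterm -cexpD; congr cexp.
  rewrite /X /dl /b' tE !(rcX, rcM, rcV, rcB, rc_int).
  move: (pi%:C : C) (a%:C) (x%:C) (y%:C) az => p a' x' y' az.
  transitivity (- (p ^+ 2) * (y' ^+ 2 + k%:~R ^+ 2) / (a' * b) + 2 * p * 'i * k%:~R * x'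
    - 2 * p ^+ 2 * ('i * 'i) * k%:~R * y' / (a' * b)).
    by field; rewrite az bz.
  by rewrite ii; field; rewrite az bz.
rewrite (csumE hs2) -kap_scale // -/b' mulrCA.
have [_ [_ <-]] := kapP b'0.
apply: has_sum_ext (has_sumZ _ (th_has_sum X b'0)) => m.
rewrite /gau /pterm -cexpD; congr cexp.
rewrite /X /b' tE !(rcX, rcM) [(_ + x)%:C]rcD rc_int.
move: (pi%:C : C) (a%:C) (x%:C) (y%:C) az => p a' x' y' az.
transitivity (- (p ^+ 2 * y' ^+ 2 * (1 + 'i * 'i) / (a' * b)) - a' * b * (m%:~R + x') ^+ 2
  + 2 * p * 'i * y' * (m%:~R + x')).
  by field; rewrite az bz.
by rewrite ii; field; rewrite az bz.
Qed.

(* Induction on n: Poisson summation over the first coordinate after completing the square, then over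
the lattice of the Schur complement *)
Theorem poissonN n (G : 'M[R]_n) : G^T = G -> posdef G ->
  exists K G', [/\ 0 < K, G'^T = G', posdef G', G *m G' = 1%:M &
  forall b : C, 0 < Re b -> forall x y : 'rV[R]_n,
  has_sum (fun m : 'rV[int]_n => pterm b (qf G (zr R m + x)) (dotr y (zr R m + x)))
    (K%:C * kap b ^+ n *
     csum (fun k : 'rV[int]_n => pterm (dl b) (qf G' (zr R k - y)) (dotr (zr R k) x)))].
Proof.
elim: n G => [|n IH] G symG pG.
  exists 1, G; split => //; first by apply/matrixP => -[].
  move=> b b0 x y.
  have single (F : 'rV[int]_0 -> C) : has_sum F (F 0).
    have := @has_sum_finite R _ F [:: 0] isT; rewrite big_seq1; apply=> t.
    by rewrite (thinmx0 t) inE eqxx.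
  rewrite (csumE (single _)) expr0 !mul1r.
  have z (v : 'rV[R]_0) : v = 0 by exact: thinmx0.
  have q0 (M : 'M[R]_0) v : qf M v = 0 by rewrite (z v) /qf !mul0mx mxE.
  have d0 (u v : 'rV[R]_0) : dotr u v = 0 by rewrite (z u) /dotr !mul0mx mxE.
  rewrite q0 d0; have := single (fun m => pterm b (qf G (zr R m + x)) (dotr y (zr R m + x))).
  by rewrite q0 d0 /pterm !mulr0.
change 'M[R]_(1 + n) in G.
have a0 := block_pos symG pG; set a := G 0 0 in a0.
have [K [Gs' [K0 symGs' pGs' GGs' hP]]] := IH _ (schur_sym symG) (schur_posdef symG pG).
set be := ursubmx G in GGs' hP.
exists (K / Num.sqrt a), (block_inv G Gs').
have sa0 : 0 < Num.sqrt a by rewrite sqrtr_gt0.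
have symG' : (block_inv G Gs')^T = block_inv G Gs'.
  by rewrite /block_inv tr_block_mx tr_scalar_mx trmxK symGs'.
have pG' : posdef (block_inv G Gs').
  move=> v v0; change 'rV[R]_(1 + n) in v.
  rewrite (row_decomp v) qf_block_inv //.
  set s := lsubmx v 0 0; set t := rsubmx v.
  have [s0|s0] := eqVneq s 0.
    rewrite s0 expr0n !mul0r scale0r subr0 add0r; apply: pGs'.
    by apply: contraNneq v0 => t0; rewrite (row_decomp v) -/s -/t s0 t0 raddf0 row_mx0.
  by rewrite ltr_pwDl ?qf_ge0 // divr_gt0 // exprn_even_gt0 ?orbT.
split=> //; [exact: divr_gt0|exact: block_invP|].
move=> b b0 x y; change 'rV[R]_(1 + n) in x, y.
have db0 := Re_dl_gt0 b0.
rewrite (row_decomp x) (row_decomp y).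
set x1 := lsubmx x 0 0; set x' := rsubmx x.
set y1 := lsubmx y 0 0; set y' := rsubmx y.
set Gs := (drsubmx G - _) in hP GGs'.
pose u (m : 'rV[int]_n) := zr R m + x'.
pose c m := a^-1 * dotr be (u m).
(* The half-transformed sum: Poisson summation has been applied in the first coordinate only.
   Summing over k first gives back the original series, summing over m first the dual one, up to
   constants. *)
pose F (p : 'rV[int]_n * int) :=
  pterm (dl b) ((p.2%:~R - y1) ^+ 2 / a) (p.2%:~R * x1) *
  pterm b (qf Gs (u p.1)) (dotr (y' + ((p.2%:~R - y1) / a) *: be) (u p.1)).
(* Characters have modulus 1, so |F| is the product of a Gaussian in m and one in k, and the order
   of summation is free. *)
have sF : summable F.
  apply: summable_le (summableM (pterm_summable x' (fun=> 0) (schur_sym symG) (schur_posdef symG pG) b0)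
    (pterm1_summable y1 (fun=> 0) db0 a0)) => -[m k].
  by rewrite /F !cnM !cn_pterm mulrC.
pose LT (p : 'rV[int]_n * int) :=
  pterm b (qf G (zr R (ipair p) + row_mx x1%:M x')) (dotr (row_mx y1%:M y') (zr R (ipair p) + row_mx x1%:M x')).
have sLT : summable LT.
  apply: (summable_inj (h := @ipair n)
   (f := fun m => pterm b (qf G (zr R m + row_mx x1%:M x')) (dotr (row_mx y1%:M y') (zr R m + row_mx x1%:M x')))).
    exact: bij_inj (ipair_bij n).
  exact: pterm_summable.
pose RT (p : 'rV[int]_n * int) :=
  pterm (dl b) (qf (block_inv G Gs') (zr R (ipair p) - row_mx y1%:M y'))
    (dotr (zr R (ipair p)) (row_mx x1%:M x')).
have sRT0 : summable (fun k : 'rV[int]_(1 + n) =>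
   pterm (dl b) (qf (block_inv G Gs') (zr R k - row_mx y1%:M y')) (dotr (zr R k) (row_mx x1%:M x'))).
  exact: pterm_summable.
have sRT : summable RT by exact: (summable_inj (bij_inj (ipair_bij n)) sRT0).
have LTE m k : LT (m, k) = cexp (- (tpi R * (y1 * c m)%:C)) *
    pterm b (qf Gs (u m)) (dotr y' (u m)) *
    pterm b (a * (k%:~R + (x1 + c m)) ^+ 2) (y1 * (k%:~R + (x1 + c m))).
  rewrite /LT zr_ipair qf_schur_block // dotr_row -/a -/be -/Gs -/(u m) -/(c m).
  rewrite /pterm -!cexpD addrA; congr cexp.
  by rewrite !(rcX, rcM, rcD, rc_int); ring.
have FE m k : F (m, k) = cexp (- (tpi R * (y1 * c m)%:C)) *
    pterm b (qf Gs (u m)) (dotr y' (u m)) *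
    pterm (dl b) ((k%:~R - y1) ^+ 2 / a) (k%:~R * (x1 + c m)).
  rewrite /F /= dotrDl dotrZl /pterm -!cexpD; congr cexp.
  have -> : (k%:~R - y1) / a * dotr be (u m) = (k%:~R - y1) * c m by rewrite /c; ring.
  by rewrite !(rcX, rcM, rcD, rcB, rc_int); ring.
have step1 : csum LT = kap b / (Num.sqrt a)%:C * csum F.
  pose g m := cexp (- (tpi R * (y1 * c m)%:C)) * pterm b (qf Gs (u m)) (dotr y' (u m)) *
     csum (fun k : int => pterm (dl b) ((k%:~R - y1) ^+ 2 / a) (k%:~R * (x1 + c m))).
  have hg : has_sum g (csum F).
    apply: has_sum_pair (summable_has_sum sF) _ => m.
    apply: has_sum_ext (has_sumZ _ (summable_has_sum _)) => [k|]; first by rewrite FE.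
    exact: pterm1_summable.
  apply: has_sum_unique (has_sumZ _ hg).
  apply: has_sum_pair (summable_has_sum sLT) _ => m.
  rewrite /g mulrCA; apply: has_sum_ext (has_sumZ _ (poisson1y (x1 + c m) y1 b0 a0)) => k.
  by rewrite LTE.
have step2 : csum F = K%:C * kap b ^+ n * csum RT.
  have hF := has_sum_swap (summable_has_sum sF).
  have hR := has_sum_swap (summable_has_sum sRT).
  pose yy (k : int) := y' + ((k%:~R - y1) / a) *: be.
  pose h (k : int) := pterm (dl b) ((k%:~R - y1) ^+ 2 / a) (k%:~R * x1) *
     csum (fun k' : 'rV[int]_n => pterm (dl b) (qf Gs' (zr R k' - yy k)) (dotr (zr R k') x')).
  have hh : has_sum h (csum RT).
    apply: has_sum_pair hR _ => k.
    apply: has_sum_ext (has_sumZ _ (summable_has_sum _)) => [k'|]; last exact: pterm_summable.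
    have e : - row_mx y1%:M y' = row_mx (- y1)%:M (- y') :> 'rV[R]_(1 + n).
      by rewrite opp_row_mx -raddfN.
    rewrite /RT /= e zr_ipair zr_ipair0 dotr_row qf_block_inv // /yy.
    rewrite opprD addrA /pterm -!cexpD; congr cexp.
    by rewrite -/a -/be [in RHS]rcD [(_ * x1 + _)%:C]rcD; ring.
  apply: has_sum_unique (has_sumZ _ hh).
  apply: has_sum_pair hF _ => k; rewrite /h mulrCA.
  by apply: has_sum_ext (has_sumZ _ (hP b b0 x' (yy k))) => m.
have -> : csum (fun k : 'rV[int]_(1 + n) =>
   pterm (dl b) (qf (block_inv G Gs') (zr R k - row_mx y1%:M y')) (dotr (zr R k) (row_mx x1%:M x')))
   = csum RT.
  by apply: csumE; apply: (has_sum_bij (ipair_bij n)); exact: summable_has_sum.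
have -> : (K / Num.sqrt a)%:C * kap b ^+ n.+1 * csum RT = csum LT.
  by rewrite step1 step2 rcM rcV exprS; ring.
by apply: (has_sum_bij (ipair_bij n)); exact: summable_has_sum.
Qed.

End PoissonSummation.

(** * Theta series of unimodular forms *)

Section ThetaSeries.
Variable R : realType.
Local Notation C := R[i].
Implicit Types (tau : C).

(* exp(i pi tau x^2) = exp(- bt tau * x^2) *)
Definition bt tau : C := - ('i * pi%:C * tau).

Lemma Re_bt tau : Re (bt tau) = pi * Im tau.
Proof. by case: tau => x y; rewrite /bt ReN !ReM !ImM /=; ring. Qed.

Lemma Re_bt_gt0 tau : 0 < Im tau -> 0 < Re (bt tau).
Proof. by move=> h; rewrite Re_bt mulr_gt0 ?pi_gt0. Qed.

Lemma Im_gt0_neq0 tau : 0 < Im tau -> tau != 0.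
Proof. by apply: contraTneq => ->; rewrite ltxx. Qed.

Lemma dl_bt tau : 0 < Im tau -> dl (bt tau) = bt (- tau^-1).
Proof.
move=> h; have tz := Im_gt0_neq0 h.
have ii : 'i * 'i = -1 :> C by rewrite -expr2 sqr_i.
have iz : ('i : C) != 0 by rewrite -cn_eq0 /= expr0n add0r expr1n sqrtr1 oner_eq0.
rewrite /dl /bt rcX; move: (pi%:C : C) (@pi_neq0 R) => p pn.
transitivity (('i * 'i * p) / ('i * tau)); first by rewrite ii; field; rewrite iz pn tz.
by field; rewrite iz tz.
Qed.

Lemma Im_inv tau : Im (- tau^-1) = Im tau / cn tau ^+ 2.
Proof. by rewrite ImN sqr_cn; case: tau => x y /=; rewrite opprK. Qed.

Lemma Im_inv_gt0 tau : 0 < Im tau -> 0 < Im (- tau^-1).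
Proof.
by move=> h; rewrite Im_inv divr_gt0 // exprn_gt0 // cn_gt0 Im_gt0_neq0.
Qed.

Definition gr n (G : 'M[int]_n) : 'M[R]_n := map_mx intr G.

Lemma qf_gr n (G : 'M[int]_n) m : qf (gr G) (zr R m) = (qf G m)%:~R.
Proof. by rewrite /qf /gr /zr -map_mxM map_trmx -map_mxM mxE. Qed.

Lemma dotr_zr n (u v : 'rV[int]_n) : dotr (zr R u) (zr R v) = (dotr u v)%:~R.
Proof. by rewrite /dotr /zr map_trmx -map_mxM mxE. Qed.

Definition thetaA n (G : 'M[int]_n) tau : C :=
  csum (fun v : 'rV[int]_n => pterm (bt tau) (qf (gr G) (zr R v)) 0).

Definition thetaC n (G : 'M[int]_n) (w : 'rV[int]_n) tau : C :=
  csum (fun v : 'rV[int]_n => pterm (bt tau) (qf (gr G) (zr R v + 2^-1 *: zr R w)) 0).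

Definition unimod n (G : 'M[int]_n) (w : 'rV[int]_n) :=
  [/\ G^T = G, posdef (gr G), \det G = 1 &
      forall s, exists k : int, qf G s - dotr (s *m G) w = 2 * k].

Lemma has_sum_pos_neq0 (T : eqType) (f : T -> R) s t0 :
  (forall t, 0 <= f t) -> f t0 = 1 -> has_sum (fun t => (f t)%:C) s -> s != 0.
Proof.
move=> f0 f1 /(_ 1 ltr01)[X hX]; apply/eqP => s0.
have := hX (undup (t0 :: X)) (undup_uniq _).
rewrite s0 subr0 -rmorph_sum cn_real => h.
have : `|\sum_(t <- undup (t0 :: X)) f t| < 1.
  by apply: h => t tX; rewrite mem_undup inE tX orbT.
rewrite ger0_norm ?sumr_ge0 // ltNge -f1 => /negP; apply.
have -> : f t0 = \sum_(t <- [:: t0]) f t by rewrite big_seq1.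
apply: ler_sum_subset => //.
  exact: undup_uniq.
by move=> t; rewrite mem_undup !inE => /eqP ->; rewrite eqxx.
Qed.

Lemma gr_sym n (G : 'M[int]_n) : G^T = G -> (gr G)^T = gr G.
Proof. by move=> h; rewrite /gr map_trmx h. Qed.

Lemma thetaA_i_neq0 n (G : 'M[int]_n) : G^T = G -> posdef (gr G) -> thetaA G 'i != 0.
Proof.
move=> symG pG.
have b0 : 0 < Re (bt 'i : C) by apply: Re_bt_gt0 => /=.
have := summable_has_sum (pterm_summable 0 (fun=> 0) (gr_sym symG) pG b0).
move=> h; apply: (@has_sum_pos_neq0 _ (fun v : 'rV[int]_n => expR (- pi * qf (gr G) (zr R v))) _ 0).
- by move=> v; exact: expR_ge0.
- by rewrite qf_gr /qf !mul0mx mxE mulr0 expR0.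
have -> : thetaA G 'i = csum (fun v => pterm (bt 'i : C) (qf (gr G) (zr R v + 0)) 0).
  by congr csum; apply: funext => v; rewrite addr0.
apply: has_sum_ext h => v; rewrite addr0 -cexp_real /pterm mulr0 addr0; congr cexp.
rewrite /bt rcM rcN mulrAC; have -> : 'i * 'i = -1 :> C by rewrite -expr2 sqr_i.
by rewrite mulN1r opprK mulNr.
Qed.

Lemma pterm_shift tau (q l : R) : pterm (bt (tau + 1)) q l = pterm (bt tau) q (l + q / 2).
Proof.
rewrite /pterm; congr cexp; rewrite /bt /tpi rcM rc_nat [(l + _)%:C]rcD [(q / 2)%:C]rcM.
by rewrite rcV rc_nat; field.
Qed.

Lemma pterm_int (b : C) q l (k : int) : pterm b q (l + k%:~R) = pterm b q l.
Proof. by rewrite /pterm rcD rc_int mulrDr addrA cexpD cexp_tpi_int mulr1. Qed.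

Lemma unimod_bij n (G : 'M[int]_n) : \det G = 1 -> bijective (fun s : 'rV[int]_n => s *m G).
Proof.
move=> d1; have uG : G \in unitmx by rewrite unitmxE d1 unitr1.
by exists (mulmx^~ (invmx G)) => s; rewrite ?mulmxK ?mulmxKV.
Qed.

(** As det G = 1, s -> s G is a bijection of Z^n, and it pulls the inverse form back to G. The
    translation by w / 2 becomes the character of phase (s G w^T) / 2, equal to qf G s / 2 modulo 1
    because w is characteristic; this is the effect of tau -> tau + 1. *)
Lemma theta_inversion n (G : 'M[int]_n) w : unimod G w -> exists2 K : R, 0 < K &
  forall tau, 0 < Im tau ->
   thetaA G tau = K%:C * kap (bt tau) ^+ n * thetaA G (- tau^-1) /\
   thetaC G w tau = K%:C * kap (bt tau) ^+ n * thetaA G (- tau^-1 + 1).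
Proof.
move=> [symG pG d1 hw]; have symGr := gr_sym symG.
have [K [G' [K0 symG' pG' GG' hP]]] := poissonN symGr pG.
exists K => // tau t0; have b0 := Re_bt_gt0 t0.
have db0 := Re_dl_gt0 b0.
have Q s : qf G' (zr R (s *m G)) = qf (gr G) (zr R s).
  have -> : zr R (s *m G) = zr R s *m gr G by rewrite /zr /gr map_mxM.
  by rewrite /qf -(mulmxA _ (gr G)) GG' mulmx1 trmx_mul symGr mulmxA.
have re (l : 'rV[int]_n -> R) :
   csum (fun k => pterm (dl (bt tau)) (qf G' (zr R k - 0)) (l k)) =
   csum (fun s => pterm (bt (- tau^-1)) (qf (gr G) (zr R s)) (l (s *m G))).
  apply: csumE; apply: (has_sum_bij (unimod_bij d1)).
  have := pterm_summable 0 (fun s => l (s *m G)) symGr pG db0.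
  move=> /summable_has_sum h; rewrite -(dl_bt t0).
  have -> : (fun s => pterm (dl (bt tau)) (qf (gr G) (zr R s)) (l (s *m G))) =
    (fun s => pterm (dl (bt tau)) (qf (gr G) (zr R s + 0)) (l (s *m G))).
    by apply: funext => s; rewrite addr0.
  by apply: has_sum_ext h => s /=; rewrite addr0 subr0 Q.
split.
  rewrite [LHS]/thetaA.
  have -> : csum (fun v => pterm (bt tau) (qf (gr G) (zr R v)) 0) =
     csum (fun m => pterm (bt tau) (qf (gr G) (zr R m + 0)) (dotr 0 (zr R m + 0))).
    by congr csum; apply: funext => m; rewrite addr0 /dotr mul0mx mxE.
  rewrite (csumE (hP _ b0 0 0)) re; congr (_ * csum _); apply: funext => s.
  by rewrite dotrC /dotr mul0mx mxE.
have -> : thetaC G w tau = csum (fun m => pterm (bt tau)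
    (qf (gr G) (zr R m + 2^-1 *: zr R w)) (dotr 0 (zr R m + 2^-1 *: zr R w))).
  by congr csum; apply: funext => m; rewrite /dotr mul0mx mxE.
rewrite (csumE (hP _ b0 _ 0)) re; congr (_ * csum _); apply: funext => s.
rewrite pterm_shift add0r dotrC dotrZl dotrC dotr_zr qf_gr.
have [k hk] := hw s.
rewrite -(pterm_int _ _ _ k); congr pterm.
have -> : (qf G s)%:~R = 2 * k%:~R + (dotr (s *m G) w)%:~R :> R.
  by rewrite -[2]/(2%:~R) -intrM -hk -intrD subrK.
by field.
Qed.

Definition G1 : 'M[int]_1 := 1%:M.

Lemma qf_G1 (K : comNzRingType) (v : 'rV[K]_1) : qf 1%:M v = v 0 0 ^+ 2.
Proof. by rewrite /qf mulmx1 mxE big_ord1 mxE expr2. Qed.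

Lemma consecutive_even (z : int) : exists k : int, z * (z - 1) = 2 * k.
Proof.
exists ((z * (z - 1)) %/ 2)%Z.
have e : (2 %| z * (z - 1))%Z.
  have : (2 %| z)%Z || (2 %| z - 1)%Z by lia.
  by case/orP => h; [exact: dvdz_mulr|exact: dvdz_mull].
by rewrite [RHS]mulrC divzK.
Qed.

Lemma unimod_G1 : unimod G1 1%:M.
Proof.
split; first by rewrite trmx1.
- move=> v v0; rewrite /gr map_mx1 qf_G1 exprn_even_gt0 //=.
  by apply: contraNneq v0 => e; rewrite [v]mx11_scalar e raddf0.
- exact: det1.
move=> s; rewrite /G1 mulmx1 qf_G1 /dotr trmx1 mulmx1.
have [k hk] := consecutive_even (s 0 0).
by exists k; rewrite -hk; ring.
Qed.

(* The same factor serves all forms: the constant in [theta_inversion] is determined by the value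
at the fixed point i *)
Lemma theta_S : exists2 kp : C -> C, (forall tau, 0 < Im tau -> kp tau != 0) &
  forall n (G : 'M[int]_n) w, unimod G w -> forall tau, 0 < Im tau ->
   thetaA G tau = kp tau ^+ n * thetaA G (- tau^-1) /\
   thetaC G w tau = kp tau ^+ n * thetaA G (- tau^-1 + 1).
Proof.
have [K1 K10 h1] := theta_inversion unimod_G1.
exists (fun tau => K1%:C * kap (bt tau)).
  move=> tau t0; have [kn _] := kapP (Re_bt_gt0 t0).
  by rewrite mulf_neq0 // -cn_eq0 cn_real normr_eq0 gt_eqF.
move=> n G w uG tau t0.
have [K K0 h] := theta_inversion uG.
suff -> : (K1%:C * kap (bt tau)) ^+ n = K%:C * kap (bt tau) ^+ n by exact: h.
rewrite exprMn; congr (_ * _).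
have i0 : 0 < Im ('i : C) by [].
have ii : - 'i^-1 = 'i :> C.
  have iz : ('i : C) != 0 by rewrite -cn_eq0 /= expr0n add0r expr1n sqrtr1 oner_eq0.
  apply: (mulIf iz); rewrite mulNr mulVf // -expr2 sqr_i //.
have [e1 _] := h1 _ i0; have [e _] := h _ i0; rewrite ii in e e1.
have [symG pG _ _] := uG.
have nz := thetaA_i_neq0 symG pG.
have nz1 : thetaA G1 'i != 0 by case: unimod_G1 => s1 p1 _ _; exact: thetaA_i_neq0.
have {}e1 : K1%:C * kap (bt 'i) = 1.
  by apply: (mulIf nz1); rewrite mul1r -e1.
have {}e : K%:C * kap (bt 'i) ^+ n = 1.
  by apply: (mulIf nz); rewrite mul1r -e.
have [kn _] := kapP (Re_bt_gt0 i0).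
apply: (mulIf (expf_neq0 n kn)).
by rewrite e -exprMn e1 expr1n.
Qed.

Lemma thetaA_T2 n (G : 'M[int]_n) tau : thetaA G (tau + 1 + 1) = thetaA G tau.
Proof.
congr csum; apply: funext => v.
by rewrite !pterm_shift qf_gr -addrA -splitr pterm_int.
Qed.

(** All norms in L + w/2 are congruent to |w|^2 / 4 modulo 2, so tau -> tau + 1 multiplies every
    term by one common phase. *)
Lemma thetaC_T n (G : 'M[int]_n) w tau : unimod G w -> 0 < Im tau ->
  cn (thetaC G w (tau + 1)) = cn (thetaC G w tau).
Proof.
move=> [symG pG d1 hw] t0; pose r : R := (qf G w)%:~R / 4 / 2.
suff -> : thetaC G w (tau + 1) = cexp (tpi R * r%:C) * thetaC G w tau.
  by rewrite cnM cn_unit mul1r.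
apply: csumE.
have hs := summable_has_sum (pterm_summable (2^-1 *: zr R w) (fun=> 0) (gr_sym symG) pG (Re_bt_gt0 t0)).
apply: has_sum_ext (has_sumZ _ hs) => v.
rewrite pterm_shift add0r.
have [k hk] := hw v.
have e : qf (gr G) (zr R v + 2^-1 *: zr R w) / 2 = r + (k + dotr (v *m G) w)%:~R.
  have -> : qf (gr G) (zr R v + 2^-1 *: zr R w) = (qf G v)%:~R + (dotr (v *m G) w)%:~R + (qf G w)%:~R / 4.
    rewrite qfD ?gr_sym // qfZ !qf_gr dotrC dotrZl dotrC.
    by rewrite -map_mxM -/(zr R _) dotr_zr; field.
  have -> : (qf G v)%:~R = 2 * k%:~R + (dotr (v *m G) w)%:~R :> R.
    by rewrite -[2]/(2%:~R) -intrM -hk -intrD subrK.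
  by rewrite /r intrD; field.
rewrite e pterm_int /pterm -cexpD; congr cexp; ring.
Qed.

End ThetaSeries.

(** * Power series in exp(i pi tau) *)

Section QSeries.
Variable R : realType.
Local Notation C := R[i].
Implicit Types (tau : C) (a b : nat -> C) (F : C -> C) (y M : R).

Lemma small_power (x e : R) : 0 <= x < 1 -> 0 < e -> exists k, x ^+ k.+1 < e.
Proof.
move=> /andP[x0 x1] e0; have d0 : 0 < 1 - x by rewrite subr_gt0.
pose N := Num.truncn (((1 - x) * e)^-1).
have hN : ((1 - x) * e)^-1 < N.+1%:R by exact: truncnS_gt.
exists N; rewrite ltNge; apply/negP => he.
have h1 : N.+1%:R * e <= \sum_(k <- iota 0 N.+1) x ^+ k.
  have -> : N.+1%:R * e = \sum_(k <- iota 0 N.+1) e.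
    by rewrite big_const_seq count_predT size_iota iter_addr_0 -[e *+ _]mulr_natl.
  rewrite big_seq [X in _ <= X]big_seq; apply: ler_sum => k.
  rewrite mem_iota add0n /= => kN; apply: le_trans he _.
  by apply: ler_wiXn2l; rewrite ?(ltW x1) // ltnW.
have h2 := sum_geom_nat (rho := x) (X := iota 0 N.+1).
have {}h2 := le_trans h1 (h2 _ (iota_uniq _ _)).
move: hN; rewrite invfM ltNge => /negP; apply.
rewrite ler_pdivlMr //; apply: h2; by rewrite x0 x1.
Qed.

Lemma bernoulli_ineq (e : R) k : 0 <= e <= 1 -> 1 - k%:R * e <= (1 - e) ^+ k.
Proof.
move=> /andP[e0 e1]; elim: k => [|k IH]; first by rewrite mul0r subr0.
rewrite exprS; have := ler_wpM2l (_ : 0 <= 1 - e) IH; rewrite subr_ge0 => /(_ e1).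
apply: le_trans; rewrite -natr1.
have : 0 <= k%:R * e * e by rewrite !mulr_ge0.
by move: (k%:R : R) => q; lra.
Qed.

Definition qe tau : C := cexp ('i * pi%:C * tau).
Definition rad y : R := expR (- (pi * y)).

Lemma cn_qe tau : cn (qe tau) = rad (Im tau).
Proof.
rewrite cn_cexp /rad; congr expR; case: tau => x y.
by rewrite !ReM !ImM /=; ring.
Qed.

Lemma rad_gt0 y : 0 < rad y. Proof. exact: expR_gt0. Qed.

Lemma rad_le y y' : y <= y' -> rad y' <= rad y.
Proof. by move=> h; rewrite ler_expR lerN2 ler_pM2l ?pi_gt0. Qed.

Lemma radB y y' : rad y' = rad y * rad (y' - y).
Proof. by rewrite -expRD; congr expR; ring. Qed.

(** The closed half-plane is the punctured closed disc of radius [rad y] in exp(i pi tau);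
    convergence on the bounding circle is part of the notion. *)
Definition qser y a F := forall tau, y <= Im tau ->
  has_sum (fun m => a m * qe tau ^+ m) (F tau).

Lemma qser_le y y' a F : y <= y' -> qser y a F -> qser y' a F.
Proof. by move=> yy h tau t; apply: h; exact: le_trans t. Qed.

Lemma qser_summable y a F : qser y a F -> exists2 B, 0 <= B &
  forall X, uniq X -> \sum_(m <- X) cn (a m) * rad y ^+ m <= B.
Proof.
move=> h; have t : y <= Im (y *i : C) by [].
have [B hB] := has_sum_summable (h _ t).
have hX X : uniq X -> \sum_(m <- X) cn (a m) * rad y ^+ m <= B.
  move=> uX; apply: le_trans (hB X uX); apply: ler_sum => m _.
  by rewrite cnM cnX cn_qe.
by exists B => //; have := hX [::] isT; rewrite big_nil.
Qed.

Lemma qser_bounded y a F : qser y a F -> exists2 B, 0 <= B &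
  forall tau, y <= Im tau -> cn (F tau) <= B.
Proof.
move=> h; have [B B0 hB] := qser_summable h; exists B => // tau t.
apply: has_sum_norm (h tau t) _ => X uX; apply: le_trans (hB X uX).
apply: ler_sum => m _; rewrite cnM cnX cn_qe ler_wpM2l ?cn_ge0 //.
by rewrite lerXn2r ?nnegrE ?(ltW (rad_gt0 _)) // rad_le.
Qed.

(** Cauchy's coefficient estimate from means over n + 1 points of the line Im tau = y: such a mean
    is the m-th coefficient plus aliasing terms, which vanish in the limit by [tannery]. *)
Lemma qser_cauchy y a F M : qser y a F -> (forall tau, Im tau = y -> cn (F tau) <= M) ->
  forall m, cn (a m) * rad y ^+ m <= M.
Proof.
move=> h hM m; have [B B0 hB] := qser_summable h.
(* The real parts fill an interval of length 2, the period of exp(i pi tau). *)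
pose tr n r : C := (2 * (r%:R / n.+1%:R)) +i* y.
have qtr n r j : qe (tr n r) ^+ j = (rad y)%:C ^+ j * cexp (tpi R * (j%:R * (r%:R / n.+1%:R))).
  rewrite /qe cexpX -rcX -expRM_natl -cexp_real -cexpD; congr cexp.
  have -> : tr n r = (2 * (r%:R / n.+1%:R))%:C + 'i * y%:C by rewrite [LHS]complexE.
  rewrite /tpi !(rcM, rcN, rc_nat, rcV).
  have ii : 'i * 'i = -1 :> C by rewrite -expr2 sqr_i.
  transitivity (j%:R * pi%:C * (2 * (r%:R / n.+1%:R) * 'i + ('i * 'i) * y%:C)); first by ring.
  by rewrite ii; ring.
pose S n := n.+1%:R^-1 * \sum_(r < n.+1) (F (tr n r) * cexp (tpi R * ((- m%:Z)%:~R * (r%:R / n.+1%:R)))).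
have cuc n (k : int) (r : nat) : cn (cexp (tpi R * (k%:~R * (r%:R / n.+1%:R)))) = 1 :> R.
  by rewrite -rc_nat -rc_int -(rc_nat R n.+1) -rcV -!rcM cn_unit.
have hSn n : cn (S n) <= M.
  by apply: cn_avg_le => // r; rewrite cnM cuc mulr1 hM.
have lim : cv0 (fun n => S n - a m * (rad y)%:C ^+ m).
  apply: (@tannery _ _ (fun n j => a j * (rad y)%:C ^+ j * (uav R n.+1 (j%:Z - m%:Z) - (j == m)%:R)) _
     (fun j => 2 * (cn (a j) * rad y ^+ j)) (2 * B)).
  - by move=> j; rewrite !mulr_ge0 ?cn_ge0 ?exprn_ge0 ?(ltW (rad_gt0 _)).
  - by move=> X uX; rewrite -mulr_sumr ler_wpM2l ?hB.
  - move=> n j; rewrite !cnM cnX cn_real (ger0_norm (ltW (rad_gt0 _))) [2 * _]mulrC.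
    rewrite ler_wpM2l ?mulr_ge0 ?cn_ge0 ?exprn_ge0 ?(ltW (rad_gt0 _)) //.
    apply: le_trans (cnB _ _) _; rewrite cn_natr (_ : 2 = 1 + 1) //; apply: lerD.
      exact: uav_le1.
    by rewrite lern1; case: (_ == _).
  - move=> j e e0; exists (j + m)%N => n jn; rewrite uavE; last by lia.
    by rewrite subr_eq0 eqz_nat subrr mulr0 cn0.
  move=> n.
  have hs : has_sum (fun j => n.+1%:R^-1 * \sum_(r < n.+1)
      (cexp (tpi R * ((- m%:Z)%:~R * (r%:R / n.+1%:R))) * (a j * qe (tr n r) ^+ j))) (S n).
    apply: has_sumZ; apply: has_sum_sum => r.
    rewrite [X in has_sum _ X]mulrC; apply: has_sumZ.
    exact: (h (tr n r) (lexx _)).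
  have hd : has_sum (fun j => a j * (rad y)%:C ^+ j * (j == m)%:R) (a m * (rad y)%:C ^+ m).
    have := @has_sum_finite R _ (fun j => a j * (rad y)%:C ^+ j * (j == m)%:R) [:: m] isT.
    rewrite big_seq1 eqxx mulr1; apply=> j; rewrite inE => /negbTE ->.
    by rewrite mulr0.
  apply: has_sum_ext (has_sumD hs (has_sumN hd)) => j.
  rewrite mulrBr; congr (_ - _); rewrite /uav mulrCA; congr (_ * _).
  rewrite mulr_sumr; apply: eq_bigr => r _; rewrite qtr mulrC -!mulrA; congr (_ * (_ * _)).
  by rewrite -cexpD; congr cexp; rewrite intrB mulrNz -!pmulrn; ring.
rewrite leNgt; apply/negP => hlt.
have [N /(_ N (leqnn N))] := lim _ (eq_ind_r (fun x => is_true x) hlt (subr_gt0 _ _)).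
apply/negP; rewrite -leNgt.
rewrite cn_distC; apply: le_trans (cnDB _ _); rewrite cnN cnM cnX cn_real.
by rewrite (ger0_norm (ltW (rad_gt0 _))) lerD2l lerN2.
Qed.

Lemma qser_head y y0 a F M : qser y a F -> (forall tau, Im tau = y -> cn (F tau) <= M) ->
  y < y0 -> forall tau, y0 <= Im tau ->
  cn (F tau) <= cn (a 0%N) + M * (rad (y0 - y) / (1 - rad (y0 - y))).
Proof.
move=> h hM yy tau t; have ca := qser_cauchy h hM.
set s := rad (y0 - y).
have s0 : 0 < s := rad_gt0 _.
have s1 : s < 1 by rewrite /s /rad -expR0 ltr_expR oppr_lt0 mulr_gt0 ?pi_gt0 ?subr_gt0.
have M0 : 0 <= M by apply: le_trans (ca 0%N); rewrite mulr_ge0 ?cn_ge0.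
apply: has_sum_norm (h tau (ltW (lt_le_trans yy t))) _ => X uX.
have term m : cn (a m * qe tau ^+ m) <= M * s ^+ m.
  rewrite cnM cnX cn_qe; apply: (@le_trans _ _ (cn (a m) * rad y0 ^+ m)).
    by rewrite ler_wpM2l ?cn_ge0 // lerXn2r ?nnegrE ?(ltW (rad_gt0 _)) // rad_le.
  rewrite (radB y) exprMn mulrA ler_wpM2r ?exprn_ge0 ?(ltW s0) //.
rewrite (bigID (pred1 0%N)) /=; apply: lerD; rewrite -big_filter.
  apply: (@le_trans _ _ (\sum_(m <- [:: 0%N]) cn (a m * qe tau ^+ m))).
    apply: ler_sum_subset => //; first exact: filter_uniq.
      by move=> m; rewrite mem_filter inE => /andP[].
    by move=> m; exact: cn_ge0.
  by rewrite big_seq1 mulr1.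
set Z := [seq m <- X | _].
have Z0 m : m \in Z -> (0 < m)%N by rewrite mem_filter lt0n => /andP[].
apply: (@le_trans _ _ (\sum_(m <- Z) M * s * s ^+ m.-1)).
  rewrite big_seq [X in _ <= X]big_seq; apply: ler_sum => m /Z0 m0.
  by rewrite -mulrA -exprS prednK.
rewrite -mulr_sumr mulrA ler_wpM2l ?mulr_ge0 ?(ltW s0) //.
rewrite -(big_map predn predT (fun m => s ^+ m)); apply: sum_geom_nat.
  by rewrite s1 (ltW s0).
rewrite map_inj_in_uniq ?filter_uniq // => m m' /Z0 m0 /Z0 m0' e.
by rewrite -(prednK m0) e prednK.
Qed.

Definition conv a b m : C := \sum_(i < m.+1) a i * b (m - i)%N.

Lemma qser_mul y a b F G : qser y a F -> qser y b G ->
  qser y (conv a b) (fun tau => F tau * G tau).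
Proof.
move=> hF hG tau t.
have h := has_sumM (has_sum_summable (hF tau t)) (has_sum_summable (hG tau t)) (hF tau t) (hG tau t).
apply: (has_sum_fibers (p := fun x : nat * nat => (x.1 + x.2)%N) h) => m.
pose X := [seq (i, m - i)%N | i <- iota 0 m.+1].
have uX : uniq X by rewrite map_inj_uniq ?iota_uniq // => i j [].
pose f (x : nat * nat) := if (x.1 + x.2 == m)%N then
   a x.1 * qe tau ^+ x.1 * (b x.2 * qe tau ^+ x.2) else 0.
have <- : \sum_(x <- X) f x = conv a b m * qe tau ^+ m.
  rewrite big_map /conv mulr_suml -(big_mkord predT (fun i => a i * b (m - i)%N * qe tau ^+ m)).
  rewrite /index_iota subn0 big_seq [RHS]big_seq; apply: eq_bigr => i.
  rewrite mem_iota add0n ltnS /= /f /= => im; rewrite subnKC // eqxx.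
  have -> : qe tau ^+ m = qe tau ^+ i * qe tau ^+ (m - i)%N by rewrite -exprD subnKC.
  by ring.
apply: (@has_sum_finite R _ f X uX) => -[i j]; rewrite /f /=; case: eqP => // e.
case/negP; apply/mapP; exists i; first by rewrite mem_iota -e /= add0n ltnS leq_addr.
by rewrite -e addKn.
Qed.

Lemma qser_one y : qser y (fun m => (m == 0%N)%:R) (fun=> 1).
Proof.
move=> tau _; have := @has_sum_finite R _ (fun m : nat => (m == 0%N)%:R * qe tau ^+ m) [:: 0%N] isT.
rewrite big_seq1 mulr1; apply=> m; rewrite inE => /negbTE ->; exact: mul0r.
Qed.

Lemma qser_pow y a F k : qser y a F -> exists b, [/\ qser y b (fun tau => F tau ^+ k),
  b 0%N = a 0%N ^+ k & a 0%N = 1 -> b 1%N = k%:R * a 1%N].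
Proof.
move=> hF; elim: k => [|k [b [hb b0 b1]]].
  by exists (fun m => (m == 0%N)%:R); split=> //; [exact: qser_one|rewrite mul0r].
exists (conv a b); split.
- by move=> tau t; rewrite exprS; exact: (qser_mul hF hb t).
- by rewrite /conv big_ord1 subnn b0 exprS.
move=> a0; rewrite /conv !big_ord_recl big_ord0 addr0 /= /bump /= subn0 b1 // b0 a0.
by rewrite expr1n mul1r mulr1 -natr1; ring.
Qed.

(** Each coefficient of the reciprocal series depends on all earlier ones, so the recursion carries
    their list. *)
Fixpoint invs a n : seq C :=
  if n is n'.+1 then
    rcons (invs a n') (- \sum_(j < n'.+1) a j.+1 * nth 0 (invs a n') (n' - j)%N)
  else [:: 1].

Definition inv_coef a n : C := nth 0 (invs a n) n.

Lemma size_invs a n : size (invs a n) = n.+1.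
Proof. by elim: n => //= n IH; rewrite size_rcons IH. Qed.

Lemma nth_invs a n k : (k <= n)%N -> nth 0 (invs a n) k = inv_coef a k.
Proof.
elim: n => [|n IH]; first by rewrite leqn0 => /eqP ->.
rewrite leq_eqVlt => /orP[/eqP -> //|kn].
by rewrite /= nth_rcons size_invs kn IH.
Qed.

Lemma inv_coefS a n :
  inv_coef a n.+1 = - \sum_(j < n.+1) a j.+1 * inv_coef a (n - j)%N.
Proof.
rewrite /inv_coef /= nth_rcons size_invs ltnn eqxx; congr (- _).
by apply: eq_bigr => j _; rewrite nth_invs // leq_subr.
Qed.

Lemma conv_inv a m : a 0%N = 1 -> conv a (inv_coef a) m = (m == 0%N)%:R.
Proof.
move=> a0; case: m => [|m]; first by rewrite /conv big_ord1 a0 mul1r.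
rewrite /conv big_ord_recl subn0 a0 mul1r inv_coefS addrC.
by rewrite (eq_bigr (fun j : 'I_m.+1 => a j.+1 * inv_coef a (m - j)%N)) ?subrr.
Qed.

(** The recursion closes because 2 (1 + 3 + ... + 3^m) = 3^(m+1) - 1. The hypothesis suits Z, where
    a norm is taken by at most two vectors. *)
Lemma inv_coef_le a m : (forall j, cn (a j.+1) <= 2) -> cn (inv_coef a m) <= 3 ^+ m.
Proof.
move=> ha; elim/ltn_ind: m => -[|m] IH; first by rewrite -[inv_coef a 0]/(1 : C) cn1.
rewrite inv_coefS cnN; apply: le_trans (cn_sum _ _ _) _.
apply: (@le_trans _ _ (\sum_(j < m.+1) 2 * 3 ^+ (m - j)%N)).
  apply: ler_sum => j _; rewrite cnM; apply: ler_pM; rewrite ?cn_ge0 //.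
  by apply: IH; rewrite ltnS leq_subr.
rewrite -mulr_sumr (reindex_inj rev_ord_inj) /=.
rewrite (eq_bigr (fun j : 'I_m.+1 => 3 ^+ j)) => [|j _]; last first.
  by rewrite subSS subKn // -ltnS.
have := subrX1 (3 : R) m.+1; rewrite (_ : 3 - 1 = 2) => [<-|]; last by ring.
by rewrite lerBlDr lerDl.
Qed.

(** The series with coefficients [inv_coef a] converges and its product with F is 1, which gives the
    nonvanishing as well. This excludes zeros of the Jacobi theta functions from Im tau >= 1/2. *)
Lemma qser_inv y a F : qser y a F -> a 0%N = 1 -> (forall j, cn (a j.+1) <= 2) ->
  3 * rad y < 1 -> (forall tau, y <= Im tau -> F tau != 0) /\
  qser y (inv_coef a) (fun tau => (F tau)^-1).
Proof.
move=> hF a0 ha r1.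
have sI tau : y <= Im tau -> summable (fun m => inv_coef a m * qe tau ^+ m).
  move=> t; exists (1 - 3 * rad y)^-1 => X uX.
  apply: le_trans (sum_geom_nat _ uX); last by rewrite r1 mulr_ge0 ?(ltW (rad_gt0 _)).
  apply: ler_sum => m _; rewrite cnM cnX cn_qe exprMn.
  apply: ler_pM; rewrite ?cn_ge0 ?exprn_ge0 ?(ltW (rad_gt0 _)) ?inv_coef_le //.
  by rewrite lerXn2r ?nnegrE ?(ltW (rad_gt0 _)) // rad_le.
pose I tau := csum (fun m => inv_coef a m * qe tau ^+ m).
have hI : qser y (inv_coef a) I by move=> tau t; exact: summable_has_sum (sI tau t).
have FI tau : y <= Im tau -> F tau * I tau = 1.
  move=> t; apply: has_sum_unique (qser_mul hF hI t) _.
  have := @qser_one y tau t; apply: has_sum_ext => m; by rewrite conv_inv.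
have F0 tau : y <= Im tau -> F tau != 0.
  by move=> t; apply: contra_eqN (FI tau t) => /eqP ->; rewrite mul0r eq_sym oner_eq0.
split=> // tau t; have -> : (F tau)^-1 = I tau; last exact: hI.
by apply: (mulfI (F0 tau t)); rewrite FI // mulfV ?F0.
Qed.

(* Applying the coefficient estimate to F^k and letting k grow removes the constant factor *)
Lemma qser_max y a F M : qser y a F -> (forall tau, Im tau = y -> cn (F tau) <= M) ->
  forall tau, y <= Im tau -> cn (F tau) <= M.
Proof.
move=> h hM tau; rewrite le_eqVlt => /orP[/eqP/esym|t]; first exact: hM.
have M0 : 0 <= M by apply: le_trans (hM (y *i) _); rewrite ?cn_ge0.
rewrite leNgt; apply/negP => hlt.
have c0 : 0 < cn (F tau) by exact: le_lt_trans hlt.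
set s := rad (Im tau - y).
have s0 : 0 < s := rad_gt0 _.
have s1 : s < 1 by rewrite /s /rad -expR0 ltr_expR oppr_lt0 mulr_gt0 ?pi_gt0 ?subr_gt0.
have [||k hk] := @small_power (M / cn (F tau)) (1 - s).
- by apply/andP; split; [exact: divr_ge0 M0 (ltW c0)|rewrite ltr_pdivrMr // mul1r].
- by rewrite subr_gt0.
have [b [hb b0 _]] := qser_pow k.+1 h.
have hMk tau' : Im tau' = y -> cn (F tau' ^+ k.+1) <= M ^+ k.+1.
  by move=> e; rewrite cnX lerXn2r ?nnegrE ?cn_ge0 // hM.
have cb : cn (b 0%N) <= M ^+ k.+1.
  by have := qser_cauchy hb hMk 0%N; rewrite mulr1.
have := qser_head hb hMk t (lexx _); rewrite -/s cnX => hh.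
have {}hh : cn (F tau) ^+ k.+1 <= M ^+ k.+1 / (1 - s).
  apply: le_trans hh _; apply: le_trans (lerD cb (lexx _)) _.
  rewrite le_eqVlt; apply/orP; left; apply/eqP; field.
  by rewrite gt_eqF // subr_gt0.
move: hk; rewrite expr_div_n ltr_pdivrMr ?exprn_gt0 // => hk.
have := lt_le_trans hk (ler_wpM2l (ltW _) hh); rewrite subr_gt0 => /(_ s1).
by rewrite mulrC divfK ?ltxx // gt_eqF // subr_gt0.
Qed.

(** For F^(k+1), [qser_head] gives |F|^(k+1) <= |a 0|^(k+1) + q M^(k+1) with q = s / (1 - s) < 1.
    For large k the first term is below M^(k+1) (1 - q) / 2, and Bernoulli's inequality bounds the
    (k+1)-th root of (1 + q) / 2 by 1 - e. *)
Lemma qser_strict y y0 a F M : qser y a F -> (forall tau, Im tau = y -> cn (F tau) <= M) ->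
  cn (a 0%N) < M -> y < y0 -> rad (y0 - y) < 1 / 2 ->
  exists2 rho, 0 <= rho < 1 & forall tau, y0 <= Im tau -> cn (F tau) <= rho * M.
Proof.
move=> h hM aM yy; set s := rad (y0 - y) => s12.
have s0 : 0 < s := rad_gt0 _.
have M0 : 0 < M by apply: le_lt_trans aM; exact: cn_ge0.
have s1s : s / (1 - s) < 1 by rewrite ltr_pdivrMr; lra.
set q := s / (1 - s) in s1s.
have q0 : 0 < q by rewrite divr_gt0 //; lra.
have [||k hk] := @small_power (cn (a 0%N) / M) ((1 - q) / 2).
- by apply/andP; split; [exact: divr_ge0 (cn_ge0 _) (ltW M0)|rewrite ltr_pdivrMr // mul1r].
- lra.
pose e := (1 - q) / 2 / k.+1%:R.
have k0 : 0 < k.+1%:R :> R by rewrite ltr0n.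
have e0 : 0 < e by rewrite divr_gt0 //; lra.
have e1 : e <= 1 / 2.
  rewrite /e ler_pdivrMr //; have : 1 <= k.+1%:R :> R by rewrite ler1n.
  by move: (k.+1%:R : R) => kk; lra.
have [b [hb b0 _]] := qser_pow k.+1 h.
have hMk tau : Im tau = y -> cn (F tau ^+ k.+1) <= M ^+ k.+1.
  by move=> t; rewrite cnX lerXn2r ?nnegrE ?cn_ge0 ?(ltW M0) // hM.
exists (1 - e); first by apply/andP; split; lra.
move=> tau t; have := qser_head hb hMk yy t; rewrite -/s -/q cnX b0 cnX => hh.
have r0 : 0 <= (1 - e) * M by apply: mulr_ge0; [lra|exact: ltW].
rewrite -(ler_pXn2r (ltn0Sn k)) ?nnegrE ?cn_ge0 //.
apply: le_trans hh _; rewrite exprMn.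
have M1 : 0 < M ^+ k.+1 by rewrite exprn_gt0.
move: hk; rewrite expr_div_n ltr_pdivrMr // => hk.
have bern : 1 - (1 - q) / 2 <= (1 - e) ^+ k.+1.
  have -> : (1 - q) / 2 = k.+1%:R * e by rewrite [RHS]mulrC /e divfK // gt_eqF.
  by apply: bernoulli_ineq; apply/andP; split; lra.
have := ler_wpM2r (ltW M1) bern.
move: hk; move: (M ^+ k.+1) (cn (a 0%N) ^+ k.+1) ((1 - e) ^+ k.+1) => X Y Z; lra.
Qed.

(* The q-coefficient of F^k is k times that of F, but stays bounded *)
Lemma qser_coef1 y a F : qser y a F -> a 0%N = 1 ->
  (forall tau, Im tau = y -> cn (F tau) <= 1) -> a 1%N = 0.
Proof.
move=> h a0 hM; apply: cn_small_eq0 => e e0.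
pose k := Num.truncn ((rad y * e)^-1).
have hk : (rad y * e)^-1 < k.+1%:R by exact: truncnS_gt.
have [b [hb _ /(_ a0) b1]] := qser_pow k.+1 h.
have hMk tau : Im tau = y -> cn (F tau ^+ k.+1) <= 1.
  by move=> t; rewrite cnX exprn_ile1 ?cn_ge0 ?hM.
have := qser_cauchy hb hMk 1%N; rewrite b1 cnM cn_natr expr1 => hc.
rewrite ltNge; apply/negP => he.
have re0 : 0 < rad y * e by rewrite mulr_gt0 ?rad_gt0.
have k0 : 0 < k.+1%:R :> R by rewrite ltr0n.
move: hk; rewrite -[_^-1]mul1r ltr_pdivrMr //; apply/negP; rewrite -leNgt.
apply: le_trans hc; rewrite -mulrA ler_wpM2l ?(ltW k0) // mulrC.
by rewrite ler_wpM2r ?(ltW (rad_gt0 _)).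
Qed.

End QSeries.

(** * Theta series as power series that count vectors *)

Section Counting.
Variable R : realType.
Local Notation C := R[i].
Implicit Types (tau : C).

(** The number of elements at level m, as a sum of indicators: that a level is finite is deduced
    from the convergence of a theta series. *)
Definition cnt (T : eqType) (p : T -> nat) (m : nat) : C :=
  csum (fun v : T => (p v == m)%:R : C).

Lemma pterm_qe tau (r0 : R) (k : nat) :
  pterm (bt tau) (r0 + k%:R) 0 = cexp ('i * pi%:C * tau * r0%:C) * qe tau ^+ k.
Proof.
rewrite /pterm /qe cexpX -cexpD; congr cexp.
by rewrite /bt rcD rc_nat; ring.
Qed.

(** All terms at level m equal the same nonzero number, so the convergence of the theta series
    bounds how many there are. *)
Lemma cnt_summable (T : eqType) (p : T -> nat) tau r0 F m :
  has_sum (fun v : T => pterm (bt tau) (r0 + (p v)%:R) 0) F ->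
  has_sum (fun v : T => (p v == m)%:R : C) (cnt p m).
Proof.
move=> h; apply: summable_has_sum.
pose c := (cexp ('i * pi%:C * tau * r0%:C) * qe tau ^+ m)^-1.
apply: summable_le (summableZ c (has_sum_summable h)) => v.
case: eqP => [->|_]; last by rewrite cn0 cn_ge0.
rewrite pterm_qe /c mulVf //.
by rewrite mulf_neq0 ?expf_neq0 // cexp_neq0.
Qed.

Lemma cnt_qser (T : eqType) (p : T -> nat) (r0 y : R) (F : C -> C) :
  (forall tau, y <= Im tau -> has_sum (fun v : T => pterm (bt tau) (r0 + (p v)%:R) 0) (F tau)) ->
  qser y (cnt p) (fun tau => cexp (- ('i * pi%:C * tau * r0%:C)) * F tau).
Proof.
move=> h tau t; have ht := h tau t.
apply: (has_sum_fibers (p := p) (has_sumZ _ ht)) => m.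
rewrite [X in has_sum _ X]mulrC; apply: has_sum_ext (has_sumZ (qe tau ^+ m) (cnt_summable m ht)) => v.
case: eqP => [->|_]; last by rewrite mulr0.
by rewrite pterm_qe mulrA -cexpD addNr cexp0 mul1r mulr1.
Qed.

Lemma cnt_exact (T : eqType) (p : T -> nat) m (X : seq T) : uniq X ->
  (forall v, (p v == m) = (v \in X)) -> cnt p m = (size X)%:R.
Proof.
move=> uX hX; apply: csumE.
have := @has_sum_finite R _ (fun v => (p v == m)%:R) X uX.
rewrite (eq_big_seq (fun=> 1)) => [|v vX]; last by rewrite hX vX.
rewrite big_const_seq count_predT iter_addr_0; apply=> v.
by rewrite -hX => /negbTE ->.
Qed.

Lemma sum_nat_pred (T : eqType) (P : pred T) (X : seq T) :
  \sum_(v <- X) (P v)%:R = (size [seq v <- X | P v])%:R :> R.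
Proof.
rewrite -sum1_size big_filter natr_sum [RHS]big_mkcond.
by apply: eq_bigr => v _; case: (P v).
Qed.

Lemma cnt_le2 (T : eqType) (p : T -> nat) (g : T -> T) m s :
  (forall v v', p v = p v' -> v' = v \/ v' = g v) ->
  has_sum (fun v : T => (p v == m)%:R : C) s -> cn s <= 2.
Proof.
move=> hg h; apply: has_sum_norm h _ => X uX.
rewrite (eq_bigr (fun v => (p v == m)%:R : R)) => [|v _]; last by rewrite cn_natr.
rewrite sum_nat_pred ler_nat.
have uZ := filter_uniq (fun v => p v == m) uX.
have hZ v : v \in [seq v <- X | p v == m] -> p v = m.
  by rewrite mem_filter => /andP[/eqP].
move: [seq v <- X | p v == m] uZ hZ => -[|a Z] uZ hZ //.
apply: (@uniq_leq_size _ _ [:: a; g a] uZ) => v vZ.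
have := hg a v; rewrite (hZ v vZ) (hZ a) ?mem_head // => /(_ erefl)[] ->.
  by rewrite mem_head.
by rewrite !inE eqxx orbT.
Qed.

End Counting.

Section SmallLattices.
Variable R : realType.
Local Notation C := R[i].
Implicit Types (tau : C).

Definition pnorm n (G : 'M[int]_n) (v : 'rV[int]_n) : nat := absz (qf G v).

Lemma qf_int_ge0 n (G : 'M[int]_n) v : posdef (gr R G) -> 0 <= qf G v.
Proof. by move=> pG; have := qf_ge0 (zr R v) pG; rewrite qf_gr ler0z. Qed.

Lemma thetaA_has_sum n (G : 'M[int]_n) tau : G^T = G -> posdef (gr R G) -> 0 < Im tau ->
  has_sum (fun v => pterm (bt tau) (0 + (pnorm G v)%:R) 0) (thetaA G tau).
Proof.
move=> symG pG t0.
have h := summable_has_sum (pterm_summable 0 (fun=> 0) (gr_sym R symG) pG (Re_bt_gt0 t0)).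
have e v : qf (gr R G) (zr R v + 0) = 0 + (pnorm G v)%:R.
  by rewrite addr0 add0r qf_gr /pnorm -[in LHS](gez0_abs (qf_int_ge0 v pG)).
have -> : thetaA G tau = csum (fun v => pterm (bt tau) (qf (gr R G) (zr R v + 0)) 0).
  by congr csum; apply: funext => v; rewrite addr0.
by apply: has_sum_ext h => v; rewrite e.
Qed.

Lemma thetaA_qser n (G : 'M[int]_n) y : G^T = G -> posdef (gr R G) -> 0 < y ->
  qser y (cnt R (pnorm G)) (thetaA G).
Proof.
move=> symG pG y0.
have := @cnt_qser R _ (pnorm G) 0 y (thetaA G) => h.
have {}h := h (fun tau t => thetaA_has_sum symG pG (lt_le_trans y0 t)).
move=> tau /h; by rewrite mulr0 oppr0 cexp0 mul1r.
Qed.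

(* [qf G (v + w / 2) = e0 / 4 + pchar v], where all characteristic norms are in e0 + 4 N *)
Definition pchar n (G : 'M[int]_n) (w : 'rV[int]_n) (e0 : nat) (v : 'rV[int]_n) : nat :=
  absz ((qf G (v *+ 2 + w) - e0%:Z) %/ 4)%Z.

Lemma qf_half n (G : 'M[int]_n) w v :
  qf (gr R G) (zr R v + 2^-1 *: zr R w) = (qf G (v *+ 2 + w))%:~R / 4.
Proof.
rewrite -qf_gr.
have -> : zr R (v *+ 2 + w) = 2 *: (zr R v + 2^-1 *: zr R w).
  rewrite scalerDr scalerA divff ?pnatr_eq0 // scale1r.
  by apply/rowP => i; rewrite !mxE mulr2n !intrD; ring.
rewrite -[RHS]/((dotr (_ *m _) _) / 4) -scalemxAl dotrZl dotrC dotrZl dotrC.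
by rewrite -[dotr _ _]/(qf _ _); field.
Qed.

Lemma thetaC_has_sum n (G : 'M[int]_n) w e0 tau : G^T = G -> posdef (gr R G) -> 0 < Im tau ->
  (forall v, exists j : nat, qf G (v *+ 2 + w) = (e0 + 4 * j)%N) ->
  has_sum (fun v => pterm (bt tau) (e0%:R / 4 + (pchar G w e0 v)%:R) 0) (thetaC G w tau).
Proof.
move=> symG pG t0 he.
have h := summable_has_sum (pterm_summable (2^-1 *: zr R w) (fun=> 0) (gr_sym R symG) pG (Re_bt_gt0 t0)).
have e v : qf (gr R G) (zr R v + 2^-1 *: zr R w) = e0%:R / 4 + (pchar G w e0 v)%:R.
  have [j hj] := he v; have -> : pchar G w e0 v = j by rewrite /pchar hj; lia.
  by rewrite qf_half hj -pmulrn natrD natrM; field.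
by apply: has_sum_ext h => v; rewrite e.
Qed.

Lemma pnorm0 n (G : 'M[int]_n) v : posdef (gr R G) -> (pnorm G v == 0%N) = (v == 0).
Proof.
move=> pG; rewrite /pnorm absz_eq0; apply/eqP/eqP => [h|->]; last first.
  by rewrite /qf !mul0mx mxE.
apply/eqP; apply: contraT => v0.
have := pG (zr R v); rewrite qf_gr h ltxx; apply.
apply: contraNneq v0 => e; apply/eqP/rowP => i.
by move/rowP: e => /(_ i); rewrite !mxE => /eqP; rewrite intr_eq0 => /eqP.
Qed.

Lemma cnt_pnorm0 n (G : 'M[int]_n) : posdef (gr R G) -> cnt R (pnorm G) 0 = 1.
Proof.
by move=> pG; rewrite (@cnt_exact _ _ _ _ [:: 0]) // => v; rewrite pnorm0 // inE.
Qed.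

Lemma qf_G1_int (v : 'rV[int]_1) : qf G1 v = v 0 0 ^+ 2.
Proof. exact: qf_G1. Qed.

Lemma rV1_eq (u v : 'rV[int]_1) : u 0 0 = v 0 0 -> u = v.
Proof. by move=> e; rewrite [u]mx11_scalar [v]mx11_scalar e. Qed.

Lemma sqr_int_eq (a b : int) : a ^+ 2 = b ^+ 2 -> b = a \/ b = - a.
Proof.
move=> /eqP; rewrite -subr_eq0 subr_sqr mulf_eq0 => /orP[/eqP h|/eqP h].
  by left; lia.
by right; lia.
Qed.

Lemma pnorm_G1_eq (v v' : 'rV[int]_1) : pnorm G1 v = pnorm G1 v' -> v' = v \/ v' = - v.
Proof.
rewrite /pnorm !qf_G1_int => h.
have {}h : v 0 0 ^+ 2 = v' 0 0 ^+ 2.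
  by rewrite -(gez0_abs (sqr_ge0 (v 0 0))) h gez0_abs ?sqr_ge0.
by have [e|e] := sqr_int_eq h; [left|right]; apply: rV1_eq; rewrite ?mxE.
Qed.

Lemma cnt_pnorm_G1_1 : cnt R (pnorm G1) 1 = 2.
Proof.
rewrite (@cnt_exact _ _ _ _ [:: 1%:M; - 1%:M]) // => [|v].
  by rewrite /= inE andbT; apply/eqP => /matrixP/(_ 0 0); rewrite !mxE.
rewrite /pnorm qf_G1_int !inE.
have -> : (absz (v 0 0 ^+ 2) == 1%N) = (v 0 0 ^+ 2 == 1).
  by rewrite -(eqz_nat _ 1) gez0_abs ?sqr_ge0.
rewrite sqrf_eq1; congr (_ || _); apply/eqP/eqP => [h|->]; rewrite ?mxE //.
  by apply: rV1_eq; rewrite h mxE.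
by apply: rV1_eq; rewrite h !mxE.
Qed.

Lemma qf_G1_char (v : 'rV[int]_1) :
  qf G1 (v *+ 2 + 1%:M) = (1 + 4 * absz (v 0 0 * (v 0 0 + 1))%R)%N.
Proof.
rewrite qf_G1_int !mxE /= mulr1n.
move: (v 0 0) => z; rewrite PoszD PoszM gez0_abs; last by nia.
by ring.
Qed.

Lemma pchar_G1 v : pchar G1 1%:M 1 v = absz (v 0 0 * (v 0 0 + 1))%R.
Proof. by rewrite /pchar qf_G1_char; lia. Qed.

(** The two elements are 0 and -1, for which 2 v + 1 is 1 and -1. *)
Lemma cnt_pchar_G1_0 : cnt R (pchar G1 1%:M 1) 0 = 2.
Proof.
rewrite (@cnt_exact _ _ _ _ [:: 0; - 1%:M]) // => [|v].
  by rewrite /= inE andbT; apply/eqP => /matrixP/(_ 0 0); rewrite !mxE.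
rewrite pchar_G1 absz_eq0 mulf_eq0 !inE addr_eq0; congr (_ || _).
  by apply/eqP/eqP => [h|->]; [apply: rV1_eq; rewrite h|]; rewrite !mxE.
by apply/eqP/eqP => [h|->]; [apply: rV1_eq; rewrite h|]; rewrite !mxE.
Qed.

Lemma pchar_G1_eq (v v' : 'rV[int]_1) : pchar G1 1%:M 1 v = pchar G1 1%:M 1 v' ->
  v' = v \/ v' = - v - 1%:M.
Proof.
rewrite !pchar_G1 => h.
have {}h : v 0 0 * (v 0 0 + 1) = v' 0 0 * (v' 0 0 + 1) by nia.
have {}h : (v' 0 0 - v 0 0) * (v' 0 0 + v 0 0 + 1) = 0.
  transitivity (v' 0 0 * (v' 0 0 + 1) - v 0 0 * (v 0 0 + 1)); first by ring.
  by rewrite h subrr.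
move/eqP: h; rewrite mulf_eq0 => /orP[/eqP h|/eqP h]; [left|right]; apply: rV1_eq.
  by lia.
by rewrite !mxE /=; lia.
Qed.

End SmallLattices.

(** * The modular group action *)

Section ModularGroup.
Variable R : realType.
Local Notation C := R[i].
Implicit Types (tau : C) (P : C -> Prop).

Lemma shift_int P tau : (forall t, P (t + 1) <-> P t) -> forall m : int, P (tau + m%:~R) -> P tau.
Proof.
move=> hP; case=> m.
  elim: m => [|m IH]; first by rewrite addr0.
  by rewrite -addn1 PoszD intrD addrA => /hP.
elim: m => [|m IH] h.
  have -> : tau = tau + (Negz 0)%:~R + 1 by rewrite NegzE mulrNz subrK.
  exact/hP.
apply: IH; have -> : tau + (Negz m)%:~R = tau + (Negz m.+1)%:~R + 1.
  by rewrite !NegzE -[m.+2]addn1 PoszD opprD intrD addrA subrK.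
exact/hP.
Qed.

Lemma shift_strip tau : exists m : int, `|Re (tau + m%:~R)| <= 1 / 2.
Proof.
exists (- Num.floor (Re tau + 1 / 2)).
rewrite ReD Re_int mulrNz ler_norml.
have := Num.Theory.floor_le_tmp (Re tau + 1 / 2).
have := Num.Theory.floorD1_gt (Re tau + 1 / 2); rewrite intrD.
by move: (_%:~R) => f; lra.
Qed.

Lemma Im_shift tau (m : int) : Im (tau + m%:~R) = Im tau.
Proof. by rewrite ImD Im_int addr0. Qed.

(* Translating to |Re tau| <= 1/2 and inverting multiplies a height below 3/4 by at least 16/13. *)
Lemma modular_reduction P : (forall t, P (t + 1) <-> P t) ->
  (forall t, 0 < Im t -> P (- t^-1) -> P t) ->
  (forall t, 3 / 4 <= Im t -> P t) -> forall tau, 0 < Im tau -> P tau.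
Proof.
move=> hT hS hD tau t0.
have main k : forall t, 0 < Im t -> (13 / 16) ^+ k * (3 / 4) <= Im t -> P t.
  elim: k => [|k IH] t tp; first by rewrite mul1r; exact: hD.
  move=> hk; have [hb|hs] := lerP (3 / 4) (Im t); first exact: hD.
  have [m hm] := shift_strip t; apply: (shift_int hT (m := m)).
  have ip : 0 < Im (t + m%:~R) by rewrite Im_shift.
  apply: hS => //; apply: IH; first exact: Im_inv_gt0.
  rewrite Im_inv Im_shift.
  have cp : 0 < cn (t + m%:~R) ^+ 2 by rewrite exprn_gt0 // cn_gt0 Im_gt0_neq0.
  rewrite ler_pdivlMr //.
  (* 1/4 comes from the real part and 9/16 from Im t < 3/4. *)
  have c1 : cn (t + m%:~R) ^+ 2 <= 13 / 16.
    rewrite sqr_cn Im_shift -(real_normK (num_real (Re _))).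
    have := normr_ge0 (Re (t + m%:~R)); nra.
  apply: le_trans hk; rewrite (exprS (13 / 16)).
  have : 0 <= (13 / 16) ^+ k :> R by rewrite exprn_ge0 ?divr_ge0.
  move: ((13 / 16) ^+ k) (cn _ ^+ 2) c1 => x q q1 x0.
  by have := ler_wpM2l x0 q1; lra.
have [||k hk] := @small_power R (13 / 16) (Im tau); [by apply/andP; split; lra|by []|].
apply: (main k.+1) => //.
have : 0 <= (13 / 16) ^+ k.+1 :> R by apply: exprn_ge0; lra.
move: hk; lra.
Qed.

(** exp(pi / 2) >= exp(3/2) >= (1 + 1/2)^3 > 3. This is the convergence condition of [qser_inv] at
    height 1/2. *)
Lemma rad_half_lt : 3 * rad (1 / 2) < 1 :> R.
Proof.
have hp := pi_ge3 R.
have e1 : 1 + 1 / 2 <= expR (1 / 2 : R) by exact: expR_ge1Dx.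
have e2 : 3 < expR (3 / 2 : R).
  have -> : expR (3 / 2 : R) = expR (1 / 2) ^+ 3 by rewrite -expRM_natl; congr expR; field.
  have : (3 / 2) ^+ 3 <= expR (1 / 2 : R) ^+ 3.
    by apply: lerXn2r; rewrite ?nnegrE ?expR_ge0 //; lra.
  by apply: lt_le_trans; rewrite !exprS expr0; lra.
have e3 : expR (3 / 2) <= expR (pi * (1 / 2)) :> R by rewrite ler_expR; lra.
rewrite /rad expRN ltr_pdivrMr ?expR_gt0 //; have := lt_le_trans e2 e3; lra.
Qed.

(** exp(pi / 4) >= exp(3/4) >= (1 + 1/8)^6 > 2. This is the condition of [qser_strict] between the
    heights 1/2 and 3/4. *)
Lemma rad_quarter_lt : rad (1 / 4) < 1 / 2 :> R.
Proof.
have hp := pi_ge3 R.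
have e1 : 1 + 1 / 8 <= expR (1 / 8 : R) by exact: expR_ge1Dx.
have e2 : 2 < expR (3 / 4 : R).
  have -> : expR (3 / 4 : R) = expR (1 / 8) ^+ 6 by rewrite -expRM_natl; congr expR; field.
  have : (9 / 8) ^+ 6 <= expR (1 / 8 : R) ^+ 6.
    by apply: lerXn2r; rewrite ?nnegrE ?expR_ge0 //; lra.
  by apply: lt_le_trans; rewrite !exprS expr0; lra.
have e3 : expR (3 / 4) <= expR (pi * (1 / 4)) :> R by rewrite ler_expR; lra.
rewrite /rad expRN -[_^-1]mul1r ltr_pdivrMr ?expR_gt0 //.
have := lt_le_trans e2 e3; lra.
Qed.

End ModularGroup.

(** * Bounds transported by the modular group *)

Section ModularPairs.
Variables (R : realType) (kp : R[i] -> R[i]).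
Local Notation C := R[i].
Hypothesis kp0 : forall tau, 0 < Im tau -> kp tau != 0.

(** A and B model the theta series of a lattice of rank n and of its translate by w / 2. As one
    factor [kp] serves all ranks, it cancels from |A| / |A1|^n and |B| / |B1|^n. *)
Definition modular_pair n (A B : C -> C) :=
  [/\ forall tau, A (tau + 1 + 1) = A tau,
      forall tau, 0 < Im tau -> cn (B (tau + 1)) = cn (B tau) &
      forall tau, 0 < Im tau ->
        A tau = kp tau ^+ n * A (- tau^-1) /\ B tau = kp tau ^+ n * A (- tau^-1 + 1)].

Variables (n : nat) (A B A1 B1 : C -> C) (M : R).
Hypotheses (hAB : modular_pair n A B) (hAB1 : modular_pair 1 A1 B1).

Let scale (k : C) x z : cn x <= M * cn z ^+ n -> cn (k ^+ n * x) <= M * cn (k ^+ 1 * z) ^+ n.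
Proof.
by move=> h; rewrite !cnM !cnX expr1 exprMn mulrCA ler_wpM2l ?exprn_ge0 ?cn_ge0.
Qed.

Let unscale (k : C) x z : k != 0 -> cn (k ^+ n * x) <= M * cn (k ^+ 1 * z) ^+ n -> cn x <= M * cn z ^+ n.
Proof.
move=> k0; rewrite !cnM !cnX expr1 exprMn mulrCA ler_pM2l //.
by rewrite exprn_gt0 // cn_gt0.
Qed.

Let Im1 (tau : C) : Im (tau + 1) = Im tau. Proof. exact: (Im_shift tau 1). Qed.

Lemma bound_of_strip :
  (forall tau, 3 / 4 <= Im tau -> cn (A tau) <= M * cn (A1 tau) ^+ n) ->
  (forall tau, 3 / 4 <= Im tau -> cn (B tau) <= M * cn (B1 tau) ^+ n) ->
  forall tau, 0 < Im tau ->
    cn (A tau) <= M * cn (A1 tau) ^+ n /\ cn (B tau) <= M * cn (B1 tau) ^+ n.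
Proof.
have [T2 Tc hS] := hAB; have [T2' Tc' hS'] := hAB1; move=> hA hB.
(* tau -> tau + 1 exchanges the first two inequalities and tau -> -1 / tau the last two. The premise
   0 < Im tau is inside [P] because [modular_reduction] asks for translation invariance at every
   point. *)
pose P tau := 0 < Im tau -> [/\ cn (A tau) <= M * cn (A1 tau) ^+ n,
  cn (A (tau + 1)) <= M * cn (A1 (tau + 1)) ^+ n &
  cn (B tau) <= M * cn (B1 tau) ^+ n].
suff key : forall tau, 0 < Im tau -> P tau by move=> tau t0; have [] := key tau t0 t0.
apply: modular_reduction.
- move=> t; rewrite /P Im1; split=> h t0; have [h1 h2 h3] := h t0.
    by rewrite T2 T2' Tc // Tc' // in h1 h2 h3; split.
  by rewrite T2 T2' Tc // Tc' //; split.
- move=> t t0 hP _; have [h1 h2 h3] := hP (Im_inv_gt0 t0).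
  have [eA eB] := hS _ t0; have [eA1 eB1] := hS' _ t0.
  have [_ eB'] := hS _ (Im_inv_gt0 t0); have [_ eB1'] := hS' _ (Im_inv_gt0 t0).
  have tt : - (- t^-1)^-1 = t by rewrite invrN opprK invrK.
  rewrite tt in eB' eB1'.
  split.
  - by rewrite eA eA1; exact: scale.
  - by move: h3; rewrite eB' eB1'; apply: unscale; exact/kp0/Im_inv_gt0.
  - by rewrite eB eB1; exact: scale.
move=> t t34 _; split; [exact: hA| |exact: hB].
by apply: hA; rewrite Im1.
Qed.

(** For |Re tau| <= 1/2 and 3/4 <= Im tau <= 1, the point -1 / tau has height at least 3/4, and |B|
    at tau is a multiple of |A| at -1 / tau + 1. So a bound for A alone controls B up to the line Im
    tau = 1. *)
Lemma bound_low_strip :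
  (forall tau, 3 / 4 <= Im tau -> cn (A tau) <= M * cn (A1 tau) ^+ n) ->
  forall tau, 3 / 4 <= Im tau <= 1 -> cn (B tau) <= M * cn (B1 tau) ^+ n.
Proof.
have [T2 Tc hS] := hAB; have [T2' Tc' hS'] := hAB1; move=> hA tau.
pose P t := 3 / 4 <= Im t <= 1 -> cn (B t) <= M * cn (B1 t) ^+ n.
have [m hm] := shift_strip tau.
suff : P tau by [].
apply: (@shift_int R P _ _ m) => [t|].
  rewrite /P Im1; split=> h tt; have t0 : 0 < Im t by case/andP: tt; lra.
    by have := h tt; rewrite Tc // Tc'.
  by have := h tt; rewrite Tc // Tc'.
move: (tau + _) hm => t hm /andP[t1 t2].
have t0 : 0 < Im t by lra.
have [_ ->] := hS _ t0; have [_ ->] := hS' _ t0.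
apply/scale/hA; rewrite Im1 Im_inv ler_pdivlMr; last by rewrite exprn_gt0 // cn_gt0 Im_gt0_neq0.
rewrite sqr_cn -(real_normK (num_real (Re t))).
have := normr_ge0 (Re t); nra.
Qed.

End ModularPairs.

Lemma modularity (R : realType) (kp : R[i] -> R[i]) :
  (forall n (G : 'M[int]_n) w, unimod R G w -> forall tau, 0 < Im tau ->
   thetaA G tau = kp tau ^+ n * thetaA G (- tau^-1) /\
   thetaC G w tau = kp tau ^+ n * thetaA G (- tau^-1 + 1)) ->
  forall n (G : 'M[int]_n) w, unimod R G w -> modular_pair kp n (thetaA G) (thetaC G w).
Proof.
move=> hS n G w uG; split; [exact: thetaA_T2| |exact: hS uG].
by move=> tau; exact: thetaC_T.
Qed.

(** * The bound on the theta quotients *)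

Section Elkies.
Variable R : realType.
Local Notation C := R[i].
Implicit Types (tau : C).

Lemma qf_double n (G : 'M[int]_n) v w : G^T = G ->
  qf G (v *+ 2 + w) = 4 * qf G v + 4 * dotr (v *m G) w + qf G w.
Proof.
by move=> symG; rewrite qfD // -scaler_nat qfZ -scalemxAl dotrZl; ring.
Qed.

(** By [qf_double] the norms of all 2 v + w agree modulo 4; e0 is the least integer >= n in their
    residue class. *)
Lemma char_residue n (G : 'M[int]_n) w : G^T = G ->
  (forall v, n%:Z <= qf G (v *+ 2 + w)) ->
  exists2 e0 : nat, (n <= e0)%N & forall v, exists j : nat, qf G (v *+ 2 + w) = (e0 + 4 * j)%N.
Proof.
move=> symG hc; pose r := absz ((qf G w - n%:Z) %% 4)%Z.
exists (n + r)%N; first exact: leq_addr.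
move=> v; exists (absz ((qf G (v *+ 2 + w) - (n + r)%N%:Z) %/ 4)%Z).
have := hc v; rewrite /r qf_double //.
move: (qf G v) (dotr _ _) (qf G w) => a b c; lia.
Qed.

Let th3 : C -> C := thetaA G1.
Let th2 : C -> C := thetaC G1 1%:M.

Lemma th3_inv : (forall tau, 1 / 2 <= Im tau -> th3 tau != 0) /\
  exists2 a, qser (1 / 2) a (fun tau => (th3 tau)^-1) & a 0%N = 1 /\ a 1%N = -2.
Proof.
have [s1 p1 _ _] := unimod_G1 R.
have y0 : 0 < 1 / 2 :> R by lra.
have h := thetaA_qser s1 p1 y0.
have c0 := cnt_pnorm0 p1.
have i0 : 0 < Im ('i : C) by [].
have cb j : cn (cnt R (pnorm G1) j.+1) <= 2.
  apply: (@cnt_le2 _ _ (pnorm G1) -%R j.+1) => [v v'|]; first exact: pnorm_G1_eq.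
  exact: cnt_summable (thetaA_has_sum s1 p1 i0).
have [nz hi] := qser_inv h c0 cb (rad_half_lt R).
split=> //; exists (inv_coef (cnt R (pnorm G1))) => //; split=> //.
by rewrite inv_coefS big_ord1 subnn [inv_coef _ 0]/(1 : C) mulr1 cnt_pnorm_G1_1.
Qed.

(* [th2] starts with 2 exp(i pi tau / 4); P2 is normalized to have constant term 1 *)
Definition P2 tau : C := 2^-1 * (cexp (- ('i * pi%:C * tau * (1 / 4)%:C)) * th2 tau).

Lemma P2_inv : (forall tau, 1 / 2 <= Im tau -> P2 tau != 0) /\
  exists a, qser (1 / 2) a (fun tau => (P2 tau)^-1).
Proof.
have [s1 p1 _ _] := unimod_G1 R.
have y0 : 0 < 1 / 2 :> R by lra.
have he v : exists j : nat, qf G1 (v *+ 2 + 1%:M) = (1 + 4 * j)%N.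
  by exists (absz (v 0 0 * (v 0 0 + 1))%R); exact: qf_G1_char.
have hs tau (t : 0 < Im tau) := thetaC_has_sum s1 p1 t he.
have h := cnt_qser (fun tau t => hs tau (lt_le_trans y0 t)).
have i0 : 0 < Im ('i : C) by [].
have cb j : cn (cnt R (pchar G1 1%:M 1) j) <= 2.
  apply: (@cnt_le2 _ _ (pchar G1 1%:M 1) (fun v => - v - 1%:M) j) => [v v'|]; first exact: pchar_G1_eq.
  exact: cnt_summable (hs _ i0).
have h2 : qser (1 / 2) (fun m => 2^-1 * cnt R (pchar G1 1%:M 1) m) P2.
  move=> tau t; have := has_sumZ 2^-1 (h tau t).
  by apply: has_sum_ext => m; rewrite mulrA.
have c0 : 2^-1 * cnt R (pchar G1 1%:M 1) 0 = 1.
  by rewrite cnt_pchar_G1_0 mulVf // pnatr_eq0.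
have cb2 j : cn (2^-1 * cnt R (pchar G1 1%:M 1) j.+1) <= 2.
  rewrite cnM cnV cn_natr ler_pdivrMl ?ltr0n //; apply: le_trans (cb _) _; lra.
have [nz hi] := qser_inv h2 c0 cb2 (rad_half_lt R).
by split=> //; exists (inv_coef (fun m => 2^-1 * cnt R (pchar G1 1%:M 1) m)).
Qed.

Section Bound.
Variables (n : nat) (G : 'M[int]_n) (w : 'rV[int]_n).
Hypotheses (uG : unimod R G w) (hc : forall v, n%:Z <= qf G (v *+ 2 + w)).

Definition f3 tau := thetaA G tau * (th3 tau)^-1 ^+ n.

Lemma f3_qser : exists2 a, qser (1 / 2) a f3 &
  a 0%N = 1 /\ a 1%N = cnt R (pnorm G) 1 - n%:R * 2.
Proof.
have [symG pG _ _] := uG; have y0 : 0 < 1 / 2 :> R by lra.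
have [_ [a ha [a0 a1]]] := th3_inv.
have [b [hb b0 /(_ a0) b1]] := qser_pow n ha.
exists (conv (cnt R (pnorm G)) b).
  by move=> tau t; exact: qser_mul (thetaA_qser symG pG y0) hb tau t.
split; first by rewrite /conv big_ord1 cnt_pnorm0 // b0 a0 expr1n mul1r.
rewrite /conv !big_ord_recl big_ord0 /= /bump /= subn0 b1 b0 a0 a1 cnt_pnorm0 // expr1n.
by ring.
Qed.

(** Stated without division, since [th3] and [th2] are shown to be nonzero only for Im tau >=
    1/2. *)
Definition good (M : R) := forall tau, 0 < Im tau ->
  cn (thetaA G tau) <= M * cn (th3 tau) ^+ n /\
  cn (thetaC G w tau) <= M * cn (th2 tau) ^+ n.

Lemma good_of_strip M :
  (forall tau, 3 / 4 <= Im tau -> cn (thetaA G tau) <= M * cn (th3 tau) ^+ n) ->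
  (forall tau, 3 / 4 <= Im tau -> cn (thetaC G w tau) <= M * cn (th2 tau) ^+ n) ->
  good M.
Proof.
move=> hA hC; have [kp kp0 hS] := @theta_S R.
exact: (bound_of_strip kp0 (modularity hS uG) (modularity hS (unimod_G1 R)) hA hC).
Qed.

Lemma cn_f3 tau : cn (f3 tau) = cn (thetaA G tau) / cn (th3 tau) ^+ n.
Proof.
rewrite /f3; move: (thetaA G tau) (th3 tau) => x y.
by rewrite cnM cnX cnV exprVn.
Qed.

Lemma good_f3 M tau : good M -> 1 / 2 <= Im tau -> cn (f3 tau) <= M.
Proof.
move=> hg t; have t0 : 0 < Im tau by apply: lt_le_trans t; lra.
have [/(_ tau t) nz _] := th3_inv; have [h _] := hg tau t0.
rewrite cn_f3; move: (th3 tau) nz h => x nz h.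
by rewrite ler_pdivrMr // exprn_gt0 // cn_gt0.
Qed.

Lemma f3_bound M tau : 1 / 2 <= Im tau -> cn (f3 tau) <= M ->
  cn (thetaA G tau) <= M * cn (th3 tau) ^+ n.
Proof.
move=> t; have [/(_ tau t) nz _] := th3_inv.
rewrite cn_f3; move: (th3 tau) nz => x nz.
by rewrite ler_pdivrMr // exprn_gt0 // cn_gt0.
Qed.

(* e0 >= n, i.e. the absence of short characteristic vectors, gives s >= 0 *)
Lemma f2_exists : exists (s : R) (a : nat -> C) (f : C -> C), [/\ 0 <= s, qser (1 / 2) a f &
  forall tau, 1 / 2 <= Im tau ->
    cn (thetaC G w tau) = rad (s * Im tau) * cn (f tau) * cn (th2 tau) ^+ n /\ th2 tau != 0].
Proof.
have [symG pG _ _] := uG; have y0 : 0 < 1 / 2 :> R by lra.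
have [e0 ne he] := char_residue symG hc.
have hs tau (t : 0 < Im tau) := thetaC_has_sum symG pG t he.
have h := cnt_qser (fun tau t => hs tau (lt_le_trans y0 t)).
have [nz [a ha]] := P2_inv.
have [b [hb _ _]] := qser_pow n ha.
have hm := qser_mul h hb.
pose c : C := 2^-1 ^+ n.
exists ((e0%:R - n%:R) / 4), (fun m => c * conv (cnt R (pchar G w e0)) b m),
  (fun tau => c * (cexp (- ('i * pi%:C * tau * (e0%:R / 4)%:C)) * thetaC G w tau * (P2 tau)^-1 ^+ n)).
split.
- by rewrite divr_ge0 // subr_ge0 ler_nat.
- move=> tau t; have := has_sumZ c (hm tau t).
  by apply: has_sum_ext => m; rewrite mulrA.
move=> tau t.
have tz : th2 tau != 0.
  by have := nz tau t; apply: contraNneq => e; rewrite /P2 e !mulr0.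
split=> //.
have ce (r : R) : cn (cexp (- ('i * pi%:C * tau * r%:C))) = expR (pi * Im tau * r).
  rewrite cn_cexp; congr expR; case: (tau) => x y.
  by rewrite ReN !ReM !ImM /=; ring.
have cP : cn (P2 tau) = 2^-1 * (expR (pi * Im tau * (1 / 4)) * cn (th2 tau)).
  by rewrite /P2 cnM cnM ce cnV cn_natr.
have cc : cn c = 2^-1 ^+ n by rewrite /c cnX cnV cn_natr.
have cX : cn ((P2 tau)^-1 ^+ n) = (2^-1 * (expR (pi * Im tau * (1 / 4)) * cn (th2 tau)))^-1 ^+ n.
  by rewrite cnX cnV cP.
have -> : forall x y z : C, cn (c * (x * y * z)) = cn c * (cn x * cn y * cn z).
  by move=> x y z; rewrite !cnM.
rewrite cc cX ce.
have c2 : 0 < cn (th2 tau) by rewrite cn_gt0.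
set T := cn (th2 tau) in c2 *; set X := cn (thetaC _ _ _).
(* The exponent e0 / 4 splits into n / 4, cancelled by the n-th power of [P2], and (e0 - n) / 4,
   kept as the decay factor at the cusp. *)
have E4 : expR (pi * Im tau * (e0%:R / 4)) =
   (rad ((e0%:R - n%:R) / 4 * Im tau))^-1 * expR (pi * Im tau * (1 / 4)) ^+ n.
  rewrite /rad expRN invrK -expRM_natl -expRD; congr expR.
  by move: (pi : R) (Im tau) (e0%:R : R) (n%:R : R) => p y e m; field.
rewrite E4; set r := rad _.
have r0 : 0 < r by exact: rad_gt0.
set E := expR _; have E0 : 0 < E by exact: expR_gt0.
rewrite !(exprVn, exprMn); move: (T ^+ n) (E ^+ n) (2 ^+ n) (exprn_gt0 n c2) (exprn_gt0 n E0) (exprn_gt0 n (ltr0Sn R 1)) => Tn En Wn h1 h2 h3.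
by field; rewrite !gt_eqF.
Qed.

Lemma good_exists : exists2 M, 0 <= M & good M.
Proof.
have [a ha _] := f3_qser; have [B B0 hB] := qser_bounded ha.
have [s [a' [f [s0 ha' hf]]]] := f2_exists; have [B' B'0 hB'] := qser_bounded ha'.
have M0 : 0 <= B + B' by exact: addr_ge0.
exists (B + B') => //; apply: good_of_strip => tau t.
  have t2 : 1 / 2 <= Im tau by lra.
  by apply: f3_bound => //; apply: le_trans (hB _ t2) _; rewrite lerDl.
have t2 : 1 / 2 <= Im tau by lra.
have [-> _] := hf tau t2; rewrite ler_wpM2r ?exprn_ge0 ?cn_ge0 //.
apply: (@le_trans _ _ (1 * B')); last by rewrite mul1r lerDr.
apply: ler_pM; rewrite ?cn_ge0 ?(ltW (rad_gt0 _)) ?hB' //.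
rewrite /rad -expR0 ler_expR oppr_le0 !mulr_ge0 ?pi_ge0 //; lra.
Qed.

(* On 3/4 <= Im tau <= 1 the bound for the translate comes by inversion from the improved one for
[thetaA]; above, it follows from the line Im tau = 1 by the maximum principle *)
Lemma good_improve M : 1 < M -> good M -> exists2 rho, 0 <= rho < 1 & good (rho * M).
Proof.
move=> M1 hg; have M0 : 0 < M by apply: lt_trans M1; exact: ltr01.
have [a ha [a0 _]] := f3_qser.
have l1 tau : Im tau = 1 / 2 -> cn (f3 tau) <= M by move=> t; apply: good_f3; rewrite ?t.
have aM : cn (a 0%N) < M by rewrite a0 cn1.
have [||rho hr hrho] := @qser_strict R (1 / 2) (3 / 4) a f3 M ha l1 aM; first by lra.
  by rewrite (_ : 3 / 4 - 1 / 2 = 1 / 4) ?rad_quarter_lt //; field.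
exists rho => //; have rM0 : 0 <= rho * M by case/andP: hr => r0 _; rewrite mulr_ge0 // ltW.
have hA tau : 3 / 4 <= Im tau -> cn (thetaA G tau) <= rho * M * cn (th3 tau) ^+ n.
  by move=> t; apply: f3_bound; [lra|exact: hrho].
have [kp kp0 hS] := @theta_S R.
have low := bound_low_strip (modularity hS uG) (modularity hS (unimod_G1 R)) hA.
have [s [a' [f [s0 ha' hf]]]] := f2_exists.
apply: (good_of_strip hA) => tau t.
have [t1|t1] := lerP (Im tau) 1; first by apply: low; rewrite t t1.
(* Dividing by the cusp factor costs 1 / rad s on this line; above it the factor is at most rad s,
   since s >= 0, and the loss is made up. *)
have line t' : Im t' = 1 -> cn (f t') <= rho * M * (rad s)^-1.
  move=> e; have t2 : 1 / 2 <= Im t' by rewrite e; lra.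
  have [e1 nz] := hf t' t2.
  have := low t'; rewrite e lexx (_ : 3 / 4 <= 1) => [/(_ isT)|]; last by lra.
  rewrite e1 ler_pM2r ?exprn_gt0 ?cn_gt0 // e mulr1 ler_pdivlMr ?rad_gt0 //.
  by rewrite mulrC.
have ha1 : qser 1 a' f by apply: qser_le ha'; lra.
have := qser_max ha1 line (ltW t1) => hft.
have t2 : 1 / 2 <= Im tau by lra.
have [-> _] := hf tau t2; rewrite ler_wpM2r ?exprn_ge0 ?cn_ge0 //.
apply: le_trans (ler_wpM2l (ltW (rad_gt0 _)) hft) _.
rewrite mulrCA -[X in _ <= X]mulr1 ler_wpM2l // ler_pdivrMr ?rad_gt0 // mul1r.
by apply: rad_le; rewrite ler_peMr // ltW.
Qed.

(** For each tau the inequalities are closed conditions on M, so the infimum of the good constants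
    is itself good, and [good_improve] would lower it if it exceeded 1. *)
Lemma good_one : good 1.
Proof.
have [M1 M10 hM1] := good_exists.
pose E := [set M : R | 0 <= M /\ good M]%classic.
have hE : has_inf E by split; [exists M1|exists 0 => M []].
have inf_le M : E M -> inf E <= M by apply: ge_inf; case: hE.
have i0 : 0 <= inf E by apply: lb_le_inf; [case: hE|move=> M []].
have gi : good (inf E).
  have lim (x z : R) : 0 <= z -> (forall M, E M -> x <= M * z) -> x <= inf E * z.
    rewrite le_eqVlt => /orP[/eqP <-|z0] h.
      by have := h M1; rewrite !mulr0; apply.
    rewrite -ler_pdivrMr //; apply: lb_le_inf; first by case: hE.
    by move=> M /h; rewrite ler_pdivrMr.
  move=> tau t; split; apply: lim; rewrite ?exprn_ge0 ?cn_ge0 //.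
    by move=> M [_ hM]; have [h _] := hM tau t; exact: h.
  by move=> M [_ hM]; have [_ h] := hM tau t; exact: h.
have [h|h] := lerP (inf E) 1.
  by move=> tau t; have [h1 h2] := gi tau t; split; [apply: le_trans h1 _|apply: le_trans h2 _];
    rewrite ler_wpM2r ?exprn_ge0 ?cn_ge0.
have [rho /andP[r0 r1] hr] := good_improve h gi.
have := inf_le (rho * inf E); rewrite leNgt.
rewrite -[X in _ < X]mul1r ltr_pM2r ?r1; last by apply: lt_trans h.
by move=> /(_ (conj (mulr_ge0 r0 i0) hr)).
Qed.

Lemma count_norm_one : cnt R (pnorm G) 1 = n%:R * 2.
Proof.
have [a ha [a0 a1]] := f3_qser.
apply/eqP; rewrite -subr_eq0 -a1; apply/eqP/(qser_coef1 ha a0) => tau t.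
by apply: (good_f3 good_one); rewrite t.
Qed.

(** A partial sum of indicators within 1 of the integer 2 n equals 2 n, which turns the analytic
    count into an explicit list. *)
Lemma norm_one_vectors : exists S : seq 'rV[int]_n,
  [/\ uniq S, size S = (n * 2)%N & forall v, v \in S -> qf G v = 1].
Proof.
have [symG pG _ _] := uG; have i0 : 0 < Im ('i : C) by [].
have := cnt_summable 1 (thetaA_has_sum symG pG i0).
rewrite count_norm_one => /(_ 1 ltr01)[X hX].
have sX : {subset X <= undup X} by move=> v; rewrite mem_undup.
have := hX _ (undup_uniq X) sX.
have -> : \sum_(v <- undup X) (pnorm G v == 1%N)%:R = (size [seq v <- undup X | pnorm G v == 1%N])%:R :> C.
  have := congr1 (fun x : R => x%:C) (sum_nat_pred R (fun v => pnorm G v == 1%N) (undup X)).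
  rewrite rc_nat => <-; rewrite rmorph_sum; apply: eq_bigr => v _; exact/esym/rc_nat.
set S := [seq v <- _ | _] => h.
exists S; split; first by rewrite filter_uniq ?undup_uniq.
  move: h; rewrite -natrM -!rc_nat -rcB cn_real ltr_norml.
  move: (size S) (n * 2)%N => p q /andP[].
  rewrite ltrNl opprB !ltrBlDr -[1]/(1%:R) -!natrD !ltr_nat; lia.
move=> v; rewrite mem_filter => /andP[/eqP hv _].
by rewrite -[LHS](gez0_abs (qf_int_ge0 v pG)) -/(pnorm G v) hv.
Qed.

End Bound.
End Elkies.

(** * From norm 1 vectors to an orthonormal basis *)

Section Orthonormal.
Variables (R : realType) (n : nat).
Implicit Types (G : 'M[int]_n) (s t u v w : 'rV[int]_n).

(* x^T G x = sum_i G_ii x_i mod 2 *)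
Lemma characteristic_row_exists G : G^T = G -> G \in unitmx ->
  exists w, forall s, exists k : int, qf G s - dotr (s *m G) w = 2 * k.
Proof.
move=> symG uG; pose d : 'rV[int]_n := \row_i G i i.
exists (d *m invmx G) => s.
have -> : dotr (s *m G) (d *m invmx G) = dotr s d.
  by rewrite /dotr trmx_mul trmx_inv symG mulmxA mulmxK.
pose P s := exists k : int, qf G s - dotr s d = 2 * k.
rewrite -/(P s) [s]row_sum_delta; elim/big_ind: _ => [|u v [k hk] [l hl]|i _].
- by exists 0; rewrite /qf /dotr !mul0mx mxE subr0 mulr0.
- exists (k + l + dotr (u *m G) v).
  by rewrite qfD // dotrDl !mulrDr -hk -hl; ring.
have [k hk] := consecutive_even (s 0 i); exists (G i i * k).
have -> : qf G (s 0 i *: delta_mx 0 i) = s 0 i ^+ 2 * G i i.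
  by rewrite /qf -!scalemxAl linearZ -scalemxAr /= trmx_delta -rowE -colE !mxE; ring.
have -> : dotr (s 0 i *: delta_mx 0 i) d = s 0 i * G i i.
  by rewrite /dotr -scalemxAl -rowE !mxE.
by rewrite mulrCA -hk; ring.
Qed.

Lemma qf_int_gt0 G v : posdef (gr R G) -> v != 0 -> 0 < qf G v.
Proof.
move=> pG v0; rewrite -(ltr0z R) -qf_gr pG //.
apply: contra_neq v0 => e; apply/rowP => j; rewrite mxE.
by have := congr1 (fun z : 'rV[R]_n => z 0 j) e; rewrite !mxE => /eqP; rewrite intr_eq0 => /eqP.
Qed.

(** The norms of u + v and u - v are 2 + 2 d and 2 - 2 d, both positive, so the integer d is 0. *)
Lemma norm_one_orthogonal G u v : G^T = G -> posdef (gr R G) -> qf G u = 1 -> qf G v = 1 ->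
  u != v -> u != - v -> dotr (u *m G) v = 0.
Proof.
move=> symG pG hu hv n1 n2.
have dN : dotr (u *m G) (- v) = - dotr (u *m G) v by rewrite dotrC dotrNl dotrC.
have qN : qf G (- v) = qf G v by rewrite -scaleN1r qfZ sqrrN expr1n mul1r.
have h1 : 0 < qf G (u + v) by apply: qf_int_gt0 => //; rewrite addr_eq0.
have h2 : 0 < qf G (u - v) by apply: qf_int_gt0 => //; rewrite subr_eq0.
move: h1 h2; rewrite !qfD // dN qN hu hv; move: (dotr _ _) => d; lia.
Qed.

End Orthonormal.

(** Keep the head x, discard -x and recurse: each vector kept costs at most one other. *)
Lemma select_antipodal (V : zmodType) (S : seq V) : uniq S -> exists T : seq V,
  [/\ uniq T, {subset T <= S}, (size S <= size T * 2)%N &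
      forall u v, u \in T -> v \in T -> u != v -> u != - v].
Proof.
have [m] := ubnP (size S); elim: m S => [|m IH] [|x S] //=.
  by move=> _ _; exists [::].
rewrite ltnS => hm /andP[xS uS].
have [||T [uT sT hT aT]] := IH [seq v <- S | v != - x].
- by apply: leq_ltn_trans hm; rewrite size_filter count_size.
- exact: filter_uniq.
have inT v : v \in T -> v != - x /\ v \in S by move/sT; rewrite mem_filter => /andP.
exists (x :: T); split=> /=.
- by rewrite uT andbT; apply: contra xS => /inT[].
- by move=> v; rewrite !inE => /orP[->//|/inT[_ ->]]; rewrite orbT.
- move: hT; rewrite size_filter.
  have := count_predC (fun v => v != - x) S.
  have : (count (predC (fun v => v != - x)) S <= 1)%N.
    rewrite (eq_count (a2 := pred1 (- x))) ?count_uniq_mem ?leq_b1 // => v /=.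
    by rewrite negbK.
  move: (count _ _) (count _ _) (size S) (size T) => a b c d; lia.
move=> u v; rewrite !inE => /orP[/eqP ->|uT'] /orP[/eqP ->|vT'].
- by rewrite eqxx.
- by move=> _; have [h _] := inT v vT'; apply: contra_neq h => ->; rewrite opprK.
- by have [] := inT u uT'.
- exact: aT.
Qed.

Lemma orthonormal_rows (R : realType) n (G : 'M[int]_n) w : unimod R G w ->
  (forall v, n%:Z <= qf G (v *+ 2 + w)) -> exists E : 'M[int]_n, E *m G *m E^T = 1%:M.
Proof.
move=> uG hc; have [symG pG _ _] := uG.
have [S [uS sS qS]] := norm_one_vectors uG hc.
have [T [uT sT hT aT]] := select_antipodal uS.
have nT : (n <= size T)%N by move: hT; rewrite sS leq_pmul2r.
exists (\matrix_(i < n) nth 0 T i); apply/matrixP => i j.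
have iT (k : 'I_n) : (k < size T)%N by apply: leq_trans nT.
have -> : forall E : 'M[int]_n, (E *m G *m E^T) i j = dotr (row i E *m G) (row j E).
  by move=> E; rewrite /dotr -row_mul mxE [RHS]mxE; apply: eq_bigr => k _; rewrite !mxE.
rewrite !rowK [RHS]mxE; have [<-|ij] := eqVneq i j.
  by apply: qS; apply/sT/mem_nth.
have nij : nth 0 T i != nth 0 T j by rewrite nth_uniq.
apply: (norm_one_orthogonal (R := R)) => //; try by apply/qS/sT/mem_nth.
by apply: aT nij; exact: mem_nth.
Qed.

(** * Lattices in coordinates *)

Section Lattice.
Variables (R : realType) (n : nat).
Implicit Types (B : 'M[R]_n) (L : set 'rV[R]_n).

Lemma dotvE (u v : 'rV[R]_n) : dotv u v = dotr u v.
Proof. by rewrite /dotr mxE; apply: eq_bigr => i _; rewrite mxE. Qed.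

Lemma gramE B : gram B = B *m B^T.
Proof.
by apply/matrixP => i j; rewrite !mxE; apply: eq_bigr => k _; rewrite !mxE.
Qed.

Lemma zspanP B v : zspan B v <-> exists c, v = zr R c *m B.
Proof.
have e (c : 'rV[int]_n) : \sum_(i < n) (c 0 i)%:~R *: row i B = zr R c *m B.
  by rewrite mulmx_sum_row; apply: eq_bigr => i _; rewrite mxE.
by split=> -[c ->]; exists c; rewrite e.
Qed.

Lemma integral_gram B : (forall v v', zspan B v -> zspan B v' -> dotv v v' \is a Num.int) ->
  exists G, gr R G = gram B.
Proof.
move=> hB; exists (map_mx Num.floor (gram B)); apply/matrixP => i j; rewrite !mxE.
have rB k : zspan B (row k B).
  by apply/zspanP; exists (delta_mx 0 k); rewrite /zr map_delta_mx -rowE.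
apply/eqP; rewrite -intrEfloor; exact: hB.
Qed.

(** The rows of F = E B are orthonormal, and the isometry takes coordinates in this frame. For c B
    these are c G E^T, hence integers; conversely an integral z is the coordinate vector of z E B,
    which lies in the lattice. *)
Lemma isomorphic_Zn B (G E : 'M[int]_n) : gr R G = gram B -> E *m G *m E^T = 1%:M ->
  lattice_isomorphic (zspan B) (Zn_lattice R n).
Proof.
rewrite gramE => hG hE; pose F := gr R E *m B.
have FF : F *m F^T = 1%:M.
  rewrite /F trmx_mul !mulmxA -(mulmxA _ B) -hG /gr map_trmx -!map_mxM hE.
  exact: map_mx1.
have FF' := mulmx1C FF.
exists (mulmxr F^T); split=> [u v|].
  transitivity (dotr (u *m F^T) (v *m F^T)); first by rewrite dotvE.
  by rewrite dotvE /dotr [(v *m _)^T]trmx_mul trmxK mulmxA -(mulmxA u) FF' mulmx1.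
apply/seteqP; split=> [_ [_ /zspanP[c ->] <-] i|z hz] /=.
  have -> : zr R c *m B *m F^T = zr R (c *m G *m E^T).
    by rewrite /F trmx_mul !mulmxA -(mulmxA _ B) -hG /gr map_trmx -!map_mxM.
  by rewrite mxE.
exists (z *m F); last by rewrite -mulmxA FF mulmx1.
apply/zspanP; exists (map_mx Num.floor z *m E); rewrite /zr map_mxM mulmxA.
congr (_ *m _ *m _); apply/rowP => i; rewrite !mxE; apply/esym/eqP.
by rewrite -intrEfloor; exact: hz.
Qed.

End Lattice.

Theorem mainTheorem1 (R : realType) (n : nat) (L : set 'rV[R]_n)
    (hL : unimodular_integral_lattice L)
    (hchar : ~ exists w : 'rV[R]_n,
               characteristic_vector L w /\ normv w < n%:R) :
  lattice_isomorphic L (Zn_lattice R n).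
Proof.
have [_ [B [uB LB] dB] iL] := hL; move: iL hchar; rewrite LB => iL hchar.
have [G hG] := integral_gram iL.
have [symG d1] : G^T = G /\ \det G = 1.
  split; last by apply: (@intr_inj R); rewrite -det_map_mx -/(gr R G) hG.
  have : (gr R G)^T = gr R G by rewrite hG gramE trmx_mul trmxK.
  by move/matrixP => h; apply/matrixP => i j; have := h i j; rewrite !mxE => /intr_inj.
have dotG (u v : 'rV[int]_n) : dotv (zr R u *m B) (zr R v *m B) = (dotr (u *m G) v)%:~R.
  rewrite dotvE /dotr trmx_mul mulmxA -(mulmxA _ B) -gramE -hG /gr /zr map_trmx -!map_mxM.
  by rewrite mxE.
have pG : posdef (gr R G).
  move=> v v0; rewrite hG gramE; have vB : v *m B != 0.
    by apply: contra_neq v0 => e; rewrite -(mulmxK uB v) e mul0mx.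
  rewrite /qf mulmxA -mulmxA -trmx_mul -/(dotr _ _) -dotvE lt_neqAle eq_sym.
  rewrite sumr_ge0 => [|i _]; last by rewrite -expr2 sqr_ge0.
  rewrite andbT psumr_neq0 => [|i _]; last by rewrite -expr2 sqr_ge0.
  have [i hi] := rV0Pn _ vB; apply/hasP; exists i; first by rewrite mem_index_enum.
  by rewrite /= -expr2 exprn_even_gt0.
have uG : G \in unitmx by rewrite unitmxE d1 unitr1.
have [w hw] := characteristic_row_exists symG uG.
have uw : unimod R G w by [].
(* Each 2 v + w is again characteristic, so the hypothesis bounds its norm from below. *)
have hc v : n%:Z <= qf G (v *+ 2 + w).
  rewrite leNgt; apply/negP => lt; apply: hchar; exists (zr R (v *+ 2 + w) *m B).
  split; last by rewrite /normv dotG -(ltr_int R) in lt *.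
  split; first by apply/zspanP; exists (v *+ 2 + w).
  move=> _ /zspanP[s ->]; have [k hk] := hw s.
  (* Replacing w by 2 v + w changes its pairing with s by twice that of s and v, hence the
     correction to k. *)
  exists (k - dotr (s *m G) v).
  rewrite /normv !dotG -[dotr (s *m G) s]/(qf G s) -[2]/(2%:~R) -rmorphM -rmorphB; congr (_%:~R).
  rewrite dotrC dotrDl -scaler_nat dotrZl [dotr v _]dotrC [dotr w _]dotrC mulrBr -hk.
  by ring.
have [E hE] := orthonormal_rows uw hc.
exact: isomorphic_Zn hG hE.
Qed.
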